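(* Let $X$ be a compact metrizable space and $\mathcal{A}\to X$ a unital subhomogeneous (F) $C^*$-algebra bundle. Then there exists a conditional expectation $E:\Gamma(\mathcal{A})\to C(X)$ of finite index, i.e. with $K(E)<\infty$.
   Context: A $C^*$-algebra bundle over $X$ is a continuous open surjection $\pi:\mathcal{A}\to X$ with a $C^*$-algebra structure on each fiber $\mathcal{A}_x=\pi^{-1}(x)$ such that scalar multiplication, fiberwise addition, multiplication and involution are continuous, the norm $\mathcal{A}\to\mathbb{R}_{\ge0}$ is continuous ((F) bundle), and for every $x$ the sets $\{p:\pi(p)\in U,\ \|p\|<\varepsilon\}$ ($U\ni x$ open, $\varepsilon>0$) form a fundamental system of neighbourhoods of $0_x$. It is unital if every fiber is unital and $x\mapsto1_{\mathcal{A}_x}$ is a continuous section, and subhomogeneous if $\sup_x\dim\mathcal{A}_x<\infty$. $\Gamma(\mathcal{A})$ is the $C^*$-algebra of continuous sections (pointwise operations, supremum norm), containing $C(X)$ via $f\mapsto(x\mapsto f(x)1_{\mathcal{A}_x})$. A conditional expectation $E:\Gamma(\mathcal{A})\to C(X)$ is an idempotent linear map of norm one onto $C(X)$; its $K$-constant is $K(E)=\inf\{K\ge1: K\cdot E-\mathrm{id}\text{ is a positive map}\}$. *)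

(* Defs.v *)
(* MathComp + MathComp-Analysis; complex scalars R[i] from real_closed. *)
From mathcomp Require Import all_boot all_order all_algebra.
From mathcomp Require Import all_classical all_reals all_analysis.
From mathcomp Require Import complex.
Import Order.TTheory GRing.Theory Num.Theory numFieldNormedType.Exports.
Set Implicit Arguments. Unset Strict Implicit. Unset Printing Implicit Defensive.
Local Open Scope classical_set_scope.
Local Open Scope ring_scope.

(* real modulus of a complex number *)
Definition cabs (R : realType) (z : R[i]) : R := complex.Re `|z|.

(* Raw data of a fibred object over X: total space, projection and fibrewise
   operations (given as total functions, only meaningful on a single fibre). *)
Record bundle_data (R : realType) (X : topologicalType) := BundleData {
  tot : topologicalType;
  proj : tot -> X;
  bzero : X -> tot;
  badd : tot -> tot -> tot;
  bscale : R[i] -> tot -> tot;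
  bmul : tot -> tot -> tot;
  bstar : tot -> tot;
  bnorm : tot -> R;
  bone : X -> tot }.

Section Bundle.
Variables (R : realType) (X : topologicalType) (A : bundle_data R X).
Local Notation T := (tot A).
Local Notation pi := (@proj _ _ A).
Local Notation "p + q" := (@badd _ _ A p q).
Local Notation "a *: p" := (@bscale _ _ A a p).
Local Notation "p * q" := (@bmul _ _ A p q).
Local Notation "p ^*" := (@bstar _ _ A p).
Local Notation nrm := (@bnorm _ _ A).
Definition bsub (p q : T) : T := p + ((-1) *: q).
Local Notation "p - q" := (bsub p q).

(* each fibre A_x is a unital C*-algebra (with 1 <> 0) *)
Definition fibres_unital_Cstar : Prop :=
  forall x : X,
  [/\ pi (bzero A x) = x /\ pi (bone A x) = x,
      (forall p q, pi p = x -> pi q = x ->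
         [/\ pi (p + q) = x, pi (p * q) = x, pi (p^*) = x &
             forall a, pi (a *: p) = x]) /\
      (* complex vector space *)
      (forall p q r, pi p = x -> pi q = x -> pi r = x ->
         [/\ p + (q + r) = (p + q) + r, p + q = q + p,
             p + bzero A x = p & p + ((-1) *: p) = bzero A x]) /\
      (forall a b p q, pi p = x -> pi q = x ->
         [/\ 1 *: p = p, a *: (b *: p) = (a * b)%R *: p,
             a *: (p + q) = a *: p + a *: q & (a + b)%R *: p = a *: p + b *: p]),
      (
      (* unital associative algebra *)
      (forall a p q r, pi p = x -> pi q = x -> pi r = x ->
         [/\ p * (q * r) = (p * q) * r, p * (q + r) = p * q + p * r,
             (p + q) * r = p * r + q * r,
             a *: (p * q) = (a *: p) * q & a *: (p * q) = p * (a *: q)]) /\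
      (forall p, pi p = x -> bone A x * p = p /\ p * bone A x = p) /\
      bone A x <> bzero A x),
      (* involution *)
      (forall a p q, pi p = x -> pi q = x ->
         [/\ (p^*)^* = p, (p + q)^* = p^* + q^*,
             (a *: p)^* = (a^*)%C *: p^* & (p * q)^* = q^* * p^*]) /\
      (* C*-norm *)
      (forall a p q, pi p = x -> pi q = x ->
         [/\ (nrm (p) = 0 <-> p = bzero A x), nrm (p + q) <= (nrm (p) + nrm (q))%R,
             nrm (a *: p) = (cabs a * nrm (p))%R, nrm (p * q) <= (nrm (p) * nrm (q))%R &
             nrm (p^* * p) = nrm (p) ^+ 2]) &
      (* completeness of the fibre *)
      (forall u : nat -> T, (forall n, pi (u n) = x) ->
         (forall e : R, 0 < e -> exists N, forall n m, (N <= n)%N -> (N <= m)%N ->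
            nrm (u n - u m) < e) ->
         exists2 l, pi l = x &
           forall e : R, 0 < e -> exists N, forall n, (N <= n)%N -> nrm (u n - l) < e)].

(* topological axioms of an (F) C*-algebra bundle, unital *)
Definition bundle_topology : Prop :=
  [/\ continuous pi /\
      (forall U : set T, open U -> open (pi @` U)),
      (forall x : X, exists p, pi p = x),
      ((* continuity of fibrewise addition and multiplication on T x_X T *)
      (forall p q, pi p = pi q -> forall W, nbhs (p + q) W ->
         exists U V, [/\ nbhs p U, nbhs q V &
           forall p' q', U p' -> V q' -> pi p' = pi q' -> W (p' + q')]) /\
      (forall p q, pi p = pi q -> forall W, nbhs (p * q) W ->
         exists U V, [/\ nbhs p U, nbhs q V &
           forall p' q', U p' -> V q' -> pi p' = pi q' -> W (p' * q')]) /\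
      (* continuity of scalar multiplication C x T -> T *)
      (forall (a : R[i]) (p : T) (W : set T), nbhs (a *: p) W ->
         exists e : R, exists U, [/\ 0 < e, nbhs p U &
           forall b q, cabs (b - a)%R < e -> U q -> W (b *: q)])),
      continuous (@bstar _ _ A) /\
      continuous (@bnorm _ _ A) &
      ((* neighbourhoods of 0_x *)
        (forall x (W : set T), nbhs (bzero A x) W <->
           exists U (e : R), [/\ open U, U x, 0 < e &
             forall p, U (pi p) -> nrm (p) < e -> W p]) /\
        (* unit section is continuous *)
        continuous (@bone _ _ A))].

Definition unital_Cstar_bundle : Prop := fibres_unital_Cstar /\ bundle_topology.

(* subhomogeneous: fibre dimensions uniformly bounded *)
Definition subhomogeneous : Prop :=
  exists N : nat, forall x : X, exists b : 'I_N -> T,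
    (forall i, pi (b i) = x) /\
    forall p, pi p = x -> exists c : 'I_N -> R[i],
      p = \big[@badd _ _ A / bzero A x]_(i < N) (c i *: b i).

(* continuous sections, i.e. elements of Gamma(A) *)
Definition is_section (s : X -> T) : Prop :=
  continuous s /\ forall x, pi (s x) = x.

(* elements of C(X) (complex valued continuous functions) *)
Definition contC (f : X -> R[i]) : Prop :=
  forall x (e : R), 0 < e -> \forall y \near x, cabs (f y - f x)%R < e.

(* embedding C(X) -> Gamma(A), f |-> (x |-> f(x) 1_x) *)
Definition embC (f : X -> R[i]) : X -> T := fun x => f x *: bone A x.

(* supremum norms *)
Definition secnorm (s : X -> T) : R := sup (range (fun x => nrm (s x))).
Definition Cnorm (f : X -> R[i]) : R := sup (range (fun x => cabs (f x))).

(* positive elements of the C*-algebra Gamma(A): those of the form t^* t *)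
Definition sec_positive (s : X -> T) : Prop :=
  exists t, is_section t /\ forall x, s x = (t x)^* * t x.

(* operator norm of E : Gamma(A) -> C(X) *)
Definition opnorm (E : (X -> T) -> (X -> R[i])) : R :=
  sup [set Cnorm (E s) | s in [set s | is_section s /\ secnorm s <= 1]].

(* conditional expectation Gamma(A) -> C(X): idempotent linear norm one onto C(X) *)
Definition cond_exp (E : (X -> T) -> (X -> R[i])) : Prop :=
  [/\ (forall s, is_section s -> contC (E s)),
      (forall s t, is_section s -> is_section t ->
         E (fun x => s x + t x) = (fun x => E s x + E t x)%R),
      (forall a s, is_section s -> E (fun x => a *: s x) = (fun x => a * E s x)%R),
      (forall s, is_section s -> E (embC (E s)) = E s) &
      (forall f, contC f -> exists s, is_section s /\ E s = f) /\
      opnorm E = 1].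

(* K * E - id is a positive map on Gamma(A) *)
Definition KE_minus_id_positive (E : (X -> T) -> (X -> R[i])) (K : R) : Prop :=
  forall s, is_section s -> sec_positive s ->
    sec_positive (fun x => embC (fun y => K%:C%C * E s y)%R x - s x).

(* K(E) = inf { K >= 1 | K E - id positive } in the extended reals *)
Definition Kconst (E : (X -> T) -> (X -> R[i])) : \bar R :=
  ereal_inf [set K%:E | K in [set K : R | 1 <= K /\ KE_minus_id_positive E K]].

End Bundle.

(* Main.v *)
(** Let [p x v] be the largest spectral value, in the fibre over [x], of the
    self-adjoint part of a section [v]. It is sublinear in [v] and continuous in
    [x], and its linear minorants are the (real parts of the) states of the
    fibre. The theorem amounts to choosing a state [phi x] of each fibre that
    depends continuously on [x] and satisfies [phi x v >= c * p x v] on positive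
    [v], with [c > 0] independent of [x]: then [E s x = phi x s - i phi x (i s)]
    is a conditional expectation and [c^-1 E - id] is positive.

    The states of a fibre span a space whose dimension is bounded because the
    bundle is subhomogeneous, and averaging states that nearly maximize a
    determinant gives, in each fibre, one such state with a uniform constant.
    Where this dimension (a lower semicontinuous function of [x]) is locally
    constant, states of nearby fibres can be approximated by each other. So one
    goes up the closed strata {dimension < k}: given a continuous selection on
    one stratum, extend by Tietze its values on a separating sequence of
    sections, and on the next stratum take the faithful state minimizing the
    weighted sum of squared distances to these values. The minimizer is unique
    by strict convexity, hence continuous, and agrees with the old selection on
    the old stratum; each step costs a constant factor in [c].

    Fibres come only with the C*-identity, so positivity of [t^* t] and square
    roots are derived by hand, in terms of the right derivative of
    [t |-> N (1 + t h)] at 0 and of the iteration [y |-> (h + y^2) / 2]. *)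

(* All fibres are handled inside one real vector space, the algebra of continuous sections, where
   the fibre over a point is only a C*-seminorm. States at different points are then compared by
   their values on the same vectors, and the selection argument sees nothing of the bundle except
   the sublinear functionals [p x]. The obstacle is that for a fixed [c] the sets of [c]-faithful
   states are convex and closed but not lower semicontinuous in [x]. For instance, if a fibre [C^2]
   has nearby fibres [C^3] in which its second coordinate splits in two, the state with weights 2/3
   and 1/3 is [1/3]-faithful, yet it is not a limit of [1/3]-faithful states nearby, where each half
   of the second coordinate would need weight 1/3. A selection theorem therefore cannot be applied
   with a single constant. Mixing an arbitrary lift with a uniformly faithful state repairs this at
   the price of a factor [kappa = (2 N)^-1], where [N] exceeds all ranks; since there are finitely
   many strata, the constant that is built, [kappa ^ (N + 1)], stays positive. *)
From HB Require Import structures.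
Require Import Defs.
From mathcomp Require Import all_boot all_order all_algebra.
From mathcomp Require Import all_classical all_reals all_analysis.
From mathcomp Require Import complex ring lra perm.
Import Order.TTheory GRing.Theory Num.Theory numFieldNormedType.Exports.
Local Open Scope classical_set_scope.
Local Open Scope ring_scope.

(** * Positivity in algebras with a C*-seminorm *)

(** Identities between polynomials in one element of a noncommutative algebra are proved by [ring]
    in [{poly R}] and transported by [horner_alg]; this bundle of rules performs the transport. *)
Lemma horner_algE {R : comNzRingType} {B : algType R} (h : B) :
  (forall p q : {poly R}, horner_alg h (p + q) = horner_alg h p + horner_alg h q) *
  (forall p : {poly R}, horner_alg h (- p) = - horner_alg h p) *
  (forall p q : {poly R}, horner_alg h (p * q) = horner_alg h p * horner_alg h q) *
  (forall (a : R) (p : {poly R}), horner_alg h (a *: p) = a *: horner_alg h p) *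
  (horner_alg h 1 = 1) * (horner_alg h 'X = h).
Proof.
split; last exact: horner_algX.
split; last exact: rmorph1.
split; last by move=> a p; rewrite linearZ_LR /= mulr_algl.
split; last by move=> p q; rewrite rmorphM.
by split=> [p q|p]; [rewrite rmorphD|rewrite rmorphN].
Qed.

(** A complex *-algebra presented as a real one with a central square root [I] of -1, so that all
    scalars are real. [N] is only a seminorm because it will be the norm of a section at a single
    point. *)
Record cstar_seminorm {R : realType} {B : algType R} (star : B -> B) (I : B)
    (N : B -> R) : Prop := CstarSeminorm {
  csD : forall u v, star (u + v) = star u + star v;
  csZ : forall (a : R) u, star (a *: u) = a *: star u;
  csM : forall u v, star (u * v) = star v * star u;
  csK : forall u, star (star u) = u;
  csI : star I = - I;
  csII : I * I = -1;
  csIC : forall u, I * u = u * I;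
  csN1 : N 1 = 1;
  csND : forall u v, N (u + v) <= N u + N v;
  csNZ : forall (a : R) u, N (a *: u) = `|a| * N u;
  csNM : forall u v, N (u * v) <= N u * N v;
  csNS : forall u, N (star u * u) = N u ^+ 2 }.

Definition dquot {R : realType} {B : algType R} (N : B -> R) (h : B) (t : R) : R :=
  (N (1 + t *: h) - 1) / t.

(* Right derivative at 0 of [t |-> N (1 + t h)]; for self-adjoint [h] in a
   C*-algebra this is the largest spectral value of [h]. *)
Definition lam {R : realType} {B : algType R} (N : B -> R) (h : B) : R :=
  inf [set dquot N h t | t in [set t : R | 0 < t]].

Section CstarSeminorm.
Variables (R : realType) (B : algType R) (star : B -> B) (I : B) (N : B -> R).
Hypothesis hN : cstar_seminorm star I N.

Let ND := csND _ _ _ hN.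
Let NZ := csNZ _ _ _ hN.
Let NM := csNM _ _ _ hN.

Lemma cs_norm0 : N 0 = 0.
Proof. by rewrite -(scale0r (0 : B)) NZ normr0 mul0r. Qed.

Lemma cs_normN u : N (- u) = N u.
Proof. by rewrite -scaleN1r NZ normrN1 mul1r. Qed.

Lemma cs_norm_ge0 u : 0 <= N u.
Proof. by have := ND u (- u); rewrite subrr cs_norm0 cs_normN; lra. Qed.

Lemma cs_normB u v : N (u - v) <= N u + N v.
Proof. by rewrite -(cs_normN v). Qed.

Lemma cs_norm_dist u v : N u <= N v + N (u - v).
Proof. by rewrite -{1}(subrK v u) addrC ND. Qed.

Lemma cs_star1 : star 1 = 1.
Proof.
have := csM _ _ _ hN 1 (star 1); rewrite mul1r (csK _ _ _ hN) => h.
by have : 1 * star 1 = 1; [rewrite -h|rewrite mul1r].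
Qed.

Lemma cs_starN u : star (- u) = - star u.
Proof. by rewrite -scaleN1r (csZ _ _ _ hN) scaleN1r. Qed.

Lemma cs_starB u v : star (u - v) = star u - star v.
Proof. by rewrite (csD _ _ _ hN) cs_starN. Qed.

Lemma cs_norm_star u : N (star u) = N u.
Proof.
suff le v : N v <= N (star v).
  by apply/le_anti; rewrite le andbT -{2}(csK _ _ _ hN u) le.
have := NM (star v) v; rewrite (csNS _ _ _ hN) expr2 => h.
have [v0|] := eqVneq (N v) 0; first by rewrite v0 cs_norm_ge0.
by move=> nv; rewrite -(ler_pM2r (_ : 0 < N v)) // lt_neqAle eq_sym nv cs_norm_ge0.
Qed.

Lemma cs_norm_sqr h : star h = h -> N (h * h) = N h ^+ 2.
Proof. by move=> sh; rewrite -(csNS _ _ _ hN) sh. Qed.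

Lemma dquotE h t : 0 < t -> N (1 + t *: h) = 1 + t * dquot N h t.
Proof. by move=> t0; rewrite /dquot mulrC divfK ?gt_eqF//; lra. Qed.

Lemma dquot_le h t : 0 < t -> dquot N h t <= N h.
Proof.
move=> t0; rewrite /dquot ler_pdivrMr// lerBlDl (le_trans (ND _ _))//.
by rewrite (csN1 _ _ _ hN) NZ gtr0_norm// mulrC.
Qed.

Lemma dquot_ge h t : 0 < t -> - N h <= dquot N h t.
Proof.
move=> t0; rewrite /dquot ler_pdivlMr//.
have := cs_normB (1 + t *: h) (t *: h); rewrite addrK (csN1 _ _ _ hN) NZ gtr0_norm//.
by rewrite [t * _]mulrC; lra.
Qed.

(** Convexity of the norm: [1 + s h] is a convex combination of [1] and [1 + t h]. *)
Lemma dquot_mono h s t : 0 < s -> s <= t -> dquot N h s <= dquot N h t.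
Proof.
move=> s0 st; have t0 : 0 < t by exact: lt_le_trans st.
rewrite {1}/dquot ler_pdivrMr// lerBlDl.
have -> : 1 + s *: h = (1 - s / t) *: (1 : B) + (s / t) *: (1 + t *: h).
  by rewrite scalerDr addrA -scalerDl subrK scale1r scalerA divfK ?gt_eqF.
have st1 : s / t <= 1 by rewrite ler_pdivrMr// mul1r.
have st0 : 0 <= s / t by rewrite divr_ge0// ltW.
rewrite (le_trans (ND _ _))// !NZ (csN1 _ _ _ hN) !ger0_norm ?subr_ge0//.
rewrite (dquotE h t t0) mulr1 mulrDr mulr1 mulrA divfK ?gt_eqF//.
by rewrite addrA subrK [s * _]mulrC.
Qed.

Lemma lam_has_inf h : has_inf [set dquot N h t | t in [set t : R | 0 < t]].
Proof.
split; first by exists (dquot N h 1), 1 => //=.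
by exists (- N h) => _ [t /= t0 <-]; exact: dquot_ge.
Qed.

Lemma lam_le_dquot h t : 0 < t -> lam N h <= dquot N h t.
Proof. by move=> t0; apply: ge_inf; [exact: (lam_has_inf h).2 | exists t]. Qed.

Lemma lam_ge h c : (forall t, 0 < t -> c <= dquot N h t) -> c <= lam N h.
Proof.
move=> hc; apply: lb_le_inf; first exact: (lam_has_inf h).1.
by move=> _ [t /= t0 <-]; exact: hc.
Qed.

Lemma lam_le_norm h : lam N h <= N h.
Proof. by apply: (le_trans (lam_le_dquot h 1 ltr01)); exact: dquot_le. Qed.

Lemma lamD h k : lam N (h + k) <= lam N h + lam N k.
Proof.
suff H s t : 0 < s -> 0 < t -> lam N (h + k) <= dquot N h s + dquot N k t.
  rewrite -lerBlDr; apply: lam_ge => s s0; rewrite lerBlDr -lerBlDl.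
  by apply: lam_ge => t t0; rewrite lerBlDl; exact: H.
(* With a common step [m], [1 + (m / 2) (h + k)] is the midpoint of [1 + m h] and [1 + m k]. *)
move=> s0 t0; pose m := Num.min s t.
have m0 : 0 < m by rewrite lt_min s0.
have m20 : 0 < m / 2 by lra.
apply: (le_trans (lam_le_dquot _ _ m20)).
apply: (@le_trans _ _ (dquot N h m + dquot N k m)); last first.
  by apply: lerD; apply: dquot_mono => //; rewrite ge_min lexx ?orbT.
rewrite {1}/dquot ler_pdivrMr// lerBlDl.
have -> : 1 + (m / 2) *: (h + k) = 2^-1 *: (1 + m *: h) + 2^-1 *: (1 + m *: k).
  rewrite !scalerDr !scalerA addrACA -scalerDl [m / 2]mulrC.
  by have -> : 2^-1 + 2^-1 = 1 :> R; [lra|rewrite scale1r].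
rewrite (le_trans (ND _ _))// !NZ !dquotE// ger0_norm//.
by lra.
Qed.

Lemma lam0 : lam N 0 = 0.
Proof.
have q t : 0 < t -> dquot N 0 t = 0.
  by move=> t0; rewrite /dquot scaler0 addr0 (csN1 _ _ _ hN) subrr mul0r.
apply/le_anti/andP; split; first by rewrite -(q 1)// lam_le_dquot.
by apply: lam_ge => t t0; rewrite q.
Qed.

Lemma lamZ (a : R) h : 0 <= a -> lam N (a *: h) = a * lam N h.
Proof.
rewrite le_eqVlt => /predU1P[<-|a0]; first by rewrite scale0r lam0 mul0r.
have q b k t : 0 < b -> 0 < t -> dquot N (b *: k) t = b * dquot N k (b * t).
  move=> b0 t0; rewrite /dquot scalerA [t * b]mulrC; set y := N _.
  by field; rewrite !gt_eqF.
have le b k : 0 < b -> b * lam N k <= lam N (b *: k).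
  move=> b0; apply: lam_ge => t t0; rewrite q// ler_pM2l//.
  by apply: lam_le_dquot; rewrite mulr_gt0.
apply/le_anti; rewrite le// andbT.
have ia : 0 < a^-1 by rewrite invr_gt0.
have := le _ (a *: h) ia; rewrite scalerA mulVf ?gt_eqF// scale1r => H.
by rewrite -(ler_pM2l ia) mulrA mulVf ?gt_eqF// mul1r.
Qed.

Lemma lam_scalar (c : R) : lam N (c *: 1) = c.
Proof.
have l1 : lam N 1 = 1.
  apply/le_anti; rewrite -{1}(csN1 _ _ _ hN) lam_le_norm /=.
  apply: lam_ge => t t0; rewrite /dquot -{1}(scale1r (1 : B)) -scalerDl NZ.
  rewrite (csN1 _ _ _ hN) mulr1 ger0_norm; last by lra.
  by rewrite ler_pdivlMr//; lra.
have lN1 : lam N (-1) = -1.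
  apply/le_anti/andP; split.
    apply: (le_trans (lam_le_dquot _ 1 ltr01)).
    by rewrite /dquot scale1r subrr cs_norm0; lra.
  apply: lam_ge => t t0; rewrite /dquot -{1}(scale1r (1 : B)) scalerN -scaleNr -scalerDl NZ.
  rewrite (csN1 _ _ _ hN) mulr1 ler_pdivlMr//.
  by have := ler_norm (1 - t); lra.
have [c0|c0] := leP 0 c; first by rewrite lamZ// l1 mulr1.
rewrite -[c]opprK scaleNr -scalerN lamZ ?lN1; last by lra.
by rewrite mulrN1.
Qed.

Lemma lam_shift h (c : R) : lam N (h + c *: 1) = lam N h + c.
Proof.
apply/le_anti/andP; split; first by rewrite -{2}(lam_scalar c) lamD.
have := lamD (h + c *: 1) ((- c) *: 1); rewrite lam_scalar.
by rewrite -addrA -scalerDl subrr scale0r addr0; lra.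
Qed.

Lemma lam_norm_ge h : - N h <= lam N h.
Proof. by apply: lam_ge => t; exact: dquot_ge. Qed.

Lemma lam_dist u v : lam N u <= lam N v + N (u - v).
Proof.
rewrite -{1}(subrK v u) addrC (le_trans (lamD _ _))//.
by rewrite lerD2l lam_le_norm.
Qed.

Lemma cs_norm_double h t : star h = h -> 0 <= t ->
  N (1 + (2 * t) *: h) <= N (1 + t *: h) ^+ 2 + t ^+ 2 * N h ^+ 2.
Proof.
move=> sh t0; have sa : star (1 + t *: h) = 1 + t *: h.
  by rewrite (csD _ _ _ hN) (csZ _ _ _ hN) sh cs_star1.
rewrite -(cs_norm_sqr (1 + t *: h))//.
have -> : 1 + (2 * t) *: h
    = (1 + t *: h) * (1 + t *: h) - (t ^+ 2) *: (h * h).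
  have /(congr1 (horner_alg h)) : 1 + (2 * t) *: 'X =
      (1 + t *: 'X) * (1 + t *: 'X) - t ^+ 2 *: ('X * 'X) :> {poly R}.
    by rewrite -!mul_polyC; ring.
  by rewrite !horner_algE.
rewrite (le_trans (cs_normB _ _))// NZ ger0_norm ?exprn_ge0//.
by rewrite cs_norm_sqr.
Qed.

Lemma dquot_double h t : star h = h -> 0 < t ->
  dquot N h (2 * t) <= dquot N h t + t * N h ^+ 2.
Proof.
move=> sh t0; have := cs_norm_double h t sh (ltW t0).
rewrite !dquotE//; last by lra.
have := dquot_le h t t0; have := dquot_ge h t t0; have := cs_norm_ge0 h.
move: (dquot N h t) (dquot N h (2 * t)) (N h) => q q2 n n0 q1 q3 H.
have qn : q ^+ 2 <= n ^+ 2 by nra.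
have : 2 * t * q2 <= 2 * t * (q + t * n ^+ 2).
  have : t ^+ 2 * q ^+ 2 <= t ^+ 2 * n ^+ 2 by rewrite ler_wpM2l// exprn_ge0// ltW.
  by nra.
by rewrite ler_pM2l//; lra.
Qed.

(** Each halving of the step costs at most (new step) * [N h ^+ 2] by [dquot_double], and the steps
    [t/2 + t/4 + ...] add up to at most [t]. The error depends on [h] only through [N h]; this is
    what later makes [lam] continuous in the base point. *)
Lemma cs_norm_rate h t : star h = h -> 0 < t ->
  N (1 + t *: h) <= 1 + t * lam N h + t ^+ 2 * N h ^+ 2.
Proof.
move=> sh t0; have iter n : dquot N h t <= dquot N h (t / 2 ^+ n)
     + (t - t / 2 ^+ n) * N h ^+ 2.
  elim: n => [|n IH]; first by rewrite expr0 divr1 subrr mul0r addr0.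
  apply: (le_trans IH); have p0 : 0 < t / 2 ^+ n.+1 by rewrite divr_gt0// exprn_gt0.
  have := dquot_double h _ sh p0; rewrite exprS invfM.
  have -> : 2 * (t * (2^-1 / 2 ^+ n)) = t / 2 ^+ n :> R.
    by rewrite mulrCA (mulrA 2) divff// mul1r.
  set q := dquot N h (t * _); set q' := dquot N h _; set n2 := N h ^+ 2.
  have -> : t * (2^-1 / 2 ^+ n) = (t / 2 ^+ n) / 2 by rewrite mulrCA mulrC.
  by set z := t / 2 ^+ n; nra.
rewrite dquotE// -addrA lerD2l expr2 -mulrA -mulrDr ler_pM2l//.
rewrite -lerBlDr; apply: lam_ge => s s0; rewrite lerBlDr.
have [n hn] : exists n : nat, t / 2 ^+ n <= s.
  exists (Num.truncn (t / s)).+1; rewrite ler_pdivrMr ?exprn_gt0//.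
  rewrite mulrC -ler_pdivrMr// (le_trans (ltW (truncnS_gt _)))//.
  by rewrite -natrX ler_nat ltnW// ltn_expl.
apply: (le_trans (iter n)); have p0 : 0 < t / 2 ^+ n by rewrite divr_gt0// exprn_gt0.
apply: lerD; first exact: dquot_mono.
by rewrite ler_wpM2r ?exprn_ge0 ?cs_norm_ge0//; lra.
Qed.

End CstarSeminorm.

(** * Square roots by iteration *)

Fixpoint sqrt_iter {R : realType} {B : algType R} (k : B) (n : nat) : B :=
  if n is m.+1 then 2^-1 *: (k + sqrt_iter k m * sqrt_iter k m) else 0.

Section SqrtIter.
Variables (R : realType) (B : algType R) (star : B -> B) (I : B) (N : B -> R).
Hypothesis hN : cstar_seminorm star I N.
Variable k : B.

Let y := sqrt_iter k.
(* Increases to [1] and dominates the norms of the increments of [y]. *)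
Let Y := sqrt_iter (1 : R^o) : nat -> R.

Lemma sqrt_iter_scalarS n : sqrt_iter (1 : R^o) n.+1 = (1 + Y n ^+ 2) / 2 :> R.
Proof. by rewrite /= /Y -expr2 mulrC. Qed.

Lemma sqrt_iter_scalar_ge0 n : 0 <= Y n.
Proof.
case: n => // n; rewrite [Y _]sqrt_iter_scalarS.
by have := sqr_ge0 (Y n); lra.
Qed.

Lemma sqrt_iter_scalar_near1 n : 0 <= 1 - Y n <= 2 / n.+2%:R.
Proof.
elim: n => [|n /andP[h0 h1]]; first by rewrite /Y /=; apply/andP; split; lra.
have hY := sqrt_iter_scalar_ge0 n.
rewrite [Y n.+1]sqrt_iter_scalarS; move: h0 h1 hY; set z := Y n => h0 h1 hY.
apply/andP; split; first by nra.
have c0 : 0 < n.+2%:R :> R by [].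
have -> : n.+3%:R = n.+2%:R + 1 :> R by rewrite natr1.
move: h1; rewrite !ler_pdivlMr ?addr_gt0//; set c := n.+2%:R in c0 *.
have c2 : 2 <= c by rewrite ler_nat.
have -> : 1 - (1 + z ^+ 2) / 2 = (1 - z) - (1 - z) ^+ 2 / 2 by field.
set d := 1 - z => dc.
(* [2 c] times the slack in the goal equals this product plus [(2 - d c) (c - 2) + 2 d]. *)
have : 0 <= (2 - d * c) * (c + 2 - d * c - d).
  apply: mulr_ge0; first lra.
  have : d <= 1 by rewrite /d; lra.
  lra.
nra.
Qed.

Lemma sqrt_iter_comm z n : z * k = k * z -> z * y n = y n * z.
Proof.
move=> zk; elim: n => [|n IH]; first by rewrite /y /= mulr0 mul0r.
rewrite /y /= -/(y n) -scalerAr -scalerAl mulrDr mulrDl zk; congr (_ *: (_ + _)).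
by rewrite mulrA IH -!mulrA IH.
Qed.

Lemma sqrt_iter_comm2 m n : y m * y n = y n * y m.
Proof.
apply: sqrt_iter_comm; symmetry; exact: sqrt_iter_comm.
Qed.

(** A fixed point of the iteration would give an exact square root [1 - y] of [1 - k]; in general
    the error is twice the next increment. *)
Lemma sqrt_iter_sqr n :
  (1 - y n) * (1 - y n) = 1 - k + 2 *: (y n.+1 - y n).
Proof.
rewrite /y /= -/(y n) scalerBr scalerA divff// scale1r.
rewrite mulrBl mul1r !mulrBr mulr1 scaler_nat mulr2n.
by rewrite opprB addrACA -opprD !addrA subrK.
Qed.

Hypotheses (sk : star k = k) (k1 : N k <= 1).

Lemma sqrt_iter_star n : star (y n) = y n.
Proof.
elim: n => [|n IH].
  by rewrite /y /= -(scale0r (0 : B)) (csZ _ _ _ hN) !scale0r.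
by rewrite /y /= -/(y n) (csZ _ _ _ hN) (csD _ _ _ hN) (csM _ _ _ hN) sk IH.
Qed.

Lemma sqrt_iter_norm n : N (y n) <= Y n.
Proof.
elim: n => [|n IH]; first by rewrite /y /Y /= (cs_norm0 _ _ _ _ _ hN).
rewrite [Y n.+1]sqrt_iter_scalarS /y /= -/(y n) (csNZ _ _ _ hN) ger0_norm// mulrC.
rewrite ler_pM2r// (le_trans (csND _ _ _ hN _ _))// lerD//.
rewrite (le_trans (csNM _ _ _ hN _ _))// expr2.
by apply: ler_pM => //; exact: (cs_norm_ge0 _ _ _ _ _ hN).
Qed.

(** The iterates commute, so a difference of consecutive squares factors just as for the scalar
    sequence, and the two recursions can be compared term by term. *)
Lemma sqrt_iter_dist n : N (y n.+1 - y n) <= Y n.+1 - Y n.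
Proof.
elim: n => [|n IH].
  by rewrite /y /Y /= !mul0r !addr0 !subr0 (csNZ _ _ _ hN) ger0_norm// [_ *: _]mulr1 ler_piMr.
have yS m : y m.+1 = 2^-1 *: (k + y m * y m) by [].
have -> : y n.+2 - y n.+1 = 2^-1 *: ((y n.+1 - y n) * (y n.+1 + y n)).
  have -> : y n.+2 - y n.+1 = 2^-1 *: (y n.+1 * y n.+1 - y n * y n).
    by rewrite (yS n.+1) {3}(yS n) -scalerBr opprD addrACA subrr add0r.
  by rewrite mulrBl !mulrDr (sqrt_iter_comm2 n.+1 n) opprD addrA addrK.
have -> : Y n.+2 - Y n.+1 = 2^-1 * ((Y n.+1 - Y n) * (Y n.+1 + Y n)).
  have YS m : Y m.+1 = (1 + Y m ^+ 2) / 2 by exact: sqrt_iter_scalarS.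
  have -> : Y n.+2 - Y n.+1 = 2^-1 * (Y n.+1 ^+ 2 - Y n ^+ 2).
    by rewrite (YS n.+1) {2}(YS n); field.
  by rewrite subr_sqr.
rewrite (csNZ _ _ _ hN) ger0_norm// ler_pM2l//.
rewrite (le_trans (csNM _ _ _ hN _ _))//.
apply: ler_pM => //; try exact: (cs_norm_ge0 _ _ _ _ _ hN).
by rewrite (le_trans (csND _ _ _ hN _ _))// lerD// sqrt_iter_norm.
Qed.

Lemma sqrt_iter_dist_le m n : (n <= m)%N -> N (y m - y n) <= Y m - Y n.
Proof.
move=> /subnK <-; elim: (m - n)%N => [|i IH].
  by rewrite add0n !subrr (cs_norm0 _ _ _ _ _ hN).
have -> : y (i.+1 + n)%N - y n = (y (i + n).+1 - y (i + n)%N) + (y (i + n)%N - y n).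
  by rewrite addrA subrK.
rewrite (le_trans (csND _ _ _ hN _ _))//.
by have := sqrt_iter_dist (i + n)%N; move: IH; rewrite addSn; lra.
Qed.

Lemma sqrt_iter_cauchy m n : (n <= m)%N -> N (y m - y n) <= 2 / n.+2%:R.
Proof.
move=> /sqrt_iter_dist_le /le_trans; apply.
have /andP[h1 _] := sqrt_iter_scalar_near1 m.
have /andP[_ /(le_trans _)] := sqrt_iter_scalar_near1 n; apply.
by rewrite lerD2r -subr_ge0.
Qed.

End SqrtIter.

(** * Squares, elements [t^* t], and the norm in terms of [lam] *)

Section Positivity.
Variables (R : realType) (B : algType R) (star : B -> B) (I : B) (N : B -> R).
Hypothesis hN : cstar_seminorm star I N.

Let ND := csND _ _ _ hN.
Let NZ := csNZ _ _ _ hN.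
Let NM := csNM _ _ _ hN.
Let N0 := cs_norm_ge0 _ _ _ _ _ hN.
Let starD := csD _ _ _ hN.
Let starZ := csZ _ _ _ hN.
Let starM := csM _ _ _ hN.

(** [c] is the real part of the normal element [z = c + I d], so [N c <= N z], while
    [z^* z = c^2 + d^2]. *)
Lemma cs_norm_sqr_le_add c d : star c = c -> star d = d -> c * d = d * c ->
  N (c * c) <= N (c * c + d * d).
Proof.
move=> sc sd cd; pose z := c + I * d.
have sz : star z = c - I * d.
  by rewrite starD sc starM sd (csI _ _ _ hN) mulrN (csIC _ _ _ hN).
have szz : star z * z = c * c + d * d.
  rewrite sz /z mulrDr !mulrBl -!addrA; congr (_ + _).
  have -> : I * d * (I * d) = - (d * d).
    by rewrite -mulrA (mulrA d) -(csIC _ _ _ hN d) !mulrA (csII _ _ _ hN) mulN1r mulNr.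
  rewrite opprK -mulrA -cd (mulrA c I) -(csIC _ _ _ hN c) -(mulrA I c).
  by rewrite addrA addNr add0r.
have Nc : N c <= N z.
  have -> : c = 2^-1 *: (z + star z).
    by rewrite sz /z addrACA subrr addr0 -[c + c]mulr2n -[c *+ 2]scaler_nat scalerA mulVf// scale1r.
  rewrite NZ ger0_norm// (le_trans (ler_wpM2l _ (ND _ _)))// (cs_norm_star _ _ _ _ _ hN).
  by lra.
rewrite (cs_norm_sqr _ _ _ _ _ hN)// -szz (csNS _ _ _ hN).
by rewrite ler_sqr ?nnegrE.
Qed.

(** Self-adjoint part of the bicommutant of [h]: its elements commute with each other and are stable
    under the algebra operations, which replaces functional calculus. *)
Definition bic (h w : B) := star w = w /\ forall z, z * h = h * z -> z * w = w * z.

Lemma bic_comm h w w' : bic h w -> bic h w' -> w * w' = w' * w.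
Proof. by move=> [_ hw] [_ hw']; apply: hw'; symmetry; exact: hw. Qed.

Lemma bicD h w w' : bic h w -> bic h w' -> bic h (w + w').
Proof.
move=> [sw hw] [sw' hw']; split; first by rewrite starD sw sw'.
by move=> z zh; rewrite mulrDr mulrDl hw// hw'.
Qed.

Lemma bicZ h (a : R) w : bic h w -> bic h (a *: w).
Proof.
move=> [sw hw]; split; first by rewrite starZ sw.
by move=> z zh; rewrite -scalerAr -scalerAl hw.
Qed.

Lemma bicM h w w' : bic h w -> bic h w' -> bic h (w * w').
Proof.
move=> b b'; have c := bic_comm _ _ _ b b'; move: b b' => [sw hw] [sw' hw'].
split; first by rewrite starM sw sw' c.
by move=> z zh; rewrite mulrA hw// -mulrA hw'// mulrA.
Qed.

Lemma bic1 h : bic h 1.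
Proof. by split=> [|z _]; rewrite ?mulr1 ?mul1r// (cs_star1 _ _ _ _ _ hN). Qed.

Lemma bicN h w : bic h w -> bic h (- w).
Proof. by rewrite -scaleN1r; exact: bicZ. Qed.

Lemma bicB h w w' : bic h w -> bic h w' -> bic h (w - w').
Proof. by move=> b /bicN; exact: bicD. Qed.

Lemma bic_self h : star h = h -> bic h h.
Proof. by []. Qed.

Definition psd (h g : B) :=
  forall e : R, 0 < e -> exists2 w, bic h w & N (w * w - g) <= e.

Lemma psd_sub1 h k : bic h k -> N k <= 1 -> psd h (1 - k).
Proof.
move=> [sk hk] k1 e e0.
pose n := Num.truncn (4 / e); exists (1 - sqrt_iter k n).
  apply: bicB; first exact: bic1.
  split; first exact: (sqrt_iter_star _ _ _ _ _ hN).
  by move=> z /hk /sqrt_iter_comm.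
rewrite sqrt_iter_sqr addrAC subrr add0r NZ ger0_norm//.
have := sqrt_iter_cauchy _ _ _ _ _ hN _ k1 n.+1 n (leqnSn n).
have n2 : 4 / e <= n.+2%:R.
  by rewrite (le_trans (ltW (truncnS_gt _)))// ler_nat.
have : 2 / n.+2%:R <= e / 2.
  by rewrite ler_pdivrMr//; move: n2; rewrite ler_pdivrMr//; nra.
by move=> h1 h2; have := le_trans h2 h1; lra.
Qed.

Lemma psd_sqr h c : bic h c -> psd h (c * c).
Proof. by move=> hc e e0; exists c => //; rewrite subrr (cs_norm0 _ _ _ _ _ hN) ltW. Qed.

Lemma psdZ h (a : R) g : 0 <= a -> psd h g -> psd h (a *: g).
Proof.
move=> a0 hg e e0; have [|w bw hw] := hg (e / (a + 1)); first by rewrite divr_gt0//; lra.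
exists (Num.sqrt a *: w); first exact: bicZ.
rewrite -scalerAl -scalerAr scalerA -expr2 sqr_sqrtr// -scalerBr NZ ger0_norm//.
move: hw; rewrite ler_pdivlMr; last lra.
by have := N0 (w * w - g); nra.
Qed.

Lemma psdM h g g' : psd h g -> psd h g' -> psd h (g * g').
Proof.
move=> hg hg' e e0; pose c := N g + N g' + 1.
have c0 : 0 < c by have := N0 g; have := N0 g'; rewrite /c; lra.
pose d := Num.min 1 (e / c).
have d0 : 0 < d by rewrite lt_min ltr01 divr_gt0.
have d1 : d <= 1 by rewrite ge_min lexx.
have dc : d * c <= e by rewrite -ler_pdivlMr// ge_min lexx orbT.
have [w bw hw] := hg _ d0; have [w' bw' hw'] := hg' _ d0.
exists (w * w'); first exact: bicM.
have -> : w * w' * (w * w') - g * g'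
    = (w * w) * (w' * w' - g') + (w * w - g) * g'.
  rewrite mulrBr mulrBl addrA subrK; congr (_ - _).
  by rewrite mulrA -(mulrA w w') -(bic_comm _ _ _ bw bw') !mulrA.
rewrite (le_trans (ND _ _))// (le_trans (lerD (NM _ _) (NM _ _)))//.
have := cs_norm_dist _ _ _ _ _ hN (w * w) g.
have := N0 (w * w); have := N0 (w' * w' - g'); have := N0 (w * w - g); have := N0 g'.
move: dc; rewrite /c; move: (N _) (N (w * w)) (N (w * w - g)) (N g) (N g') hw hw'.
by move=> n1 n2 n3 n4 n5 *; nra.
Qed.

Lemma psd_norm_le_add h c g : bic h c -> psd h g -> N (c * c) <= N (c * c + g).
Proof.
move=> bc hg; apply/ler_addgt0Pl => e e0; have [w bw hw] := hg _ e0.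
have := cs_norm_sqr_le_add c w bc.1 bw.1 (bic_comm _ _ _ bc bw).
have -> : c * c + w * w = (c * c + g) + (w * w - g) by rewrite addrACA subrr addr0.
by move=> /le_trans; apply; rewrite (le_trans (ND _ _))// [leRHS]addrC lerD2l.
Qed.

(** [1 - h^2] is nearly a square [w^2], and adding [h^2] to [w^2] can only increase the norm, up to
    that of nearly [1]. *)
Lemma cs_norm_1Bsqr_le1 h : star h = h -> N h <= 1 -> N (1 - h * h) <= 1.
Proof.
move=> sh h1; have bh := bic_self _ sh.
have hh1 : N (h * h) <= 1 by rewrite (cs_norm_sqr _ _ _ _ _ hN)// exprn_ile1.
apply/ler_addgt0Pl => e e0; have e20 : 0 < e / 2 by lra.
have [w bw hw] := psd_sub1 _ _ (bicM _ _ _ bh bh) hh1 _ e20.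
have := cs_norm_sqr_le_add w h bw.1 sh (bic_comm _ _ _ bw bh).
have -> : w * w + h * h = (w * w - (1 - h * h)) + 1 by rewrite opprB addrA subrK.
have := ND (w * w - (1 - h * h)) 1; rewrite (csN1 _ _ _ hN).
have := cs_norm_dist _ _ _ _ _ hN (1 - h * h) (w * w).
rewrite -(cs_normN _ _ _ _ _ hN (_ - w * w)) opprB.
by move: hw; lra.
Qed.

(** One difference quotient suffices: for a step [t] with [t * N h ^+ 2 <= 1], [1 - t h^2] has norm
    at most 1. *)
Lemma lam_sqrN_le0 h : star h = h -> lam N (- (h * h)) <= 0.
Proof.
move=> sh; pose t := (N h ^+ 2 + 1)^-1.
have c0 : 0 < N h ^+ 2 + 1 by have := sqr_ge0 (N h); lra.
have t0 : 0 < t by rewrite invr_gt0.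
apply: (le_trans (lam_le_dquot _ _ _ _ _ hN _ _ t0)).
rewrite /dquot ler_pdivrMr// mul0r subr_le0 scalerN.
have -> : t *: (h * h) = (Num.sqrt t *: h) * (Num.sqrt t *: h).
  by rewrite -scalerAl -scalerAr scalerA -[Num.sqrt t * _]expr2 sqr_sqrtr// ltW.
apply: cs_norm_1Bsqr_le1; first by rewrite starZ sh.
rewrite -(@ler_pXn2r _ 2) ?nnegrE ?N0 ?ler01// NZ exprMn expr1n.
rewrite ger0_norm ?sqrtr_ge0// sqr_sqrtr ?(ltW t0)// mulrC ler_pdivrMr// mul1r.
by lra.
Qed.

Lemma lam_psd_le0 h g : psd h g -> lam N (- g) <= 0.
Proof.
move=> hg; apply/ler_addgt0Pl => e e0; have [w bw hw] := hg _ e0.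
apply: (le_trans (lam_dist _ _ _ _ _ hN _ (- (w * w)))).
by rewrite opprK [- g + _]addrC [e + 0]addrC lerD// lam_sqrN_le0//; exact: bw.1.
Qed.

Lemma lam_sqr h : star h = h -> lam N (h * h) = N h ^+ 2.
Proof.
move=> sh; apply/le_anti; rewrite -{1}(cs_norm_sqr _ _ _ _ _ hN)// (lam_le_norm _ _ _ _ _ hN)//=.
have [r0|r0] := eqVneq (N h) 0.
  have := lam_norm_ge _ _ _ _ _ hN (h * h).
  by rewrite (cs_norm_sqr _ _ _ _ _ hN)// r0 expr0n oppr0.
have {r0} rpos : 0 < N h by rewrite lt_neqAle eq_sym r0 N0.
suff H k : star k = k -> N k = 1 -> 1 <= lam N (k * k).
  have := H ((N h)^-1 *: h); rewrite starZ sh NZ ger0_norm ?invr_ge0// mulVf ?gt_eqF//.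
  move=> /(_ erefl erefl); rewrite -scalerAl -scalerAr scalerA (lamZ _ _ _ _ _ hN)//.
    by rewrite -expr2 exprVn mulrC ler_pdivlMr ?exprn_gt0// mul1r.
  by rewrite -expr2 exprn_ge0// invr_ge0.
move=> {rpos h sh} sk k1; have bk := bic_self _ sk.
have kk1 : N (k * k) = 1 by rewrite (cs_norm_sqr _ _ _ _ _ hN)// k1 expr1n.
(* [(s + k^2)^2] is [((s + 1) k)^2] plus [s^2 (1 - k^2) (1 - k^2 / s^2)], and the last product is a
   limit of squares, so dropping it does not increase the norm. *)
have main s : 1 <= s -> s + 1 <= N (s *: 1 + k * k).
  move=> s1; have s0 : 0 < s by lra.
  have si : s^-1 <= 1 by rewrite invf_le1.
  have p1 : psd k (1 - k * k) by apply: psd_sub1; [exact: bicM|rewrite kk1].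
  have p2 : psd k (1 - (s^-1 ^+ 2) *: (k * k)).
    apply: psd_sub1; first by apply: bicZ; exact: bicM.
    by rewrite NZ kk1 mulr1 ger0_norm ?sqr_ge0// exprn_ile1// invr_ge0 ltW.
  have p := psdZ _ (s ^+ 2) _ (sqr_ge0 s) (psdM _ _ _ p1 p2).
  have := psd_norm_le_add _ _ _ (bicZ _ (s + 1) _ bk) p.
  have -> : (s + 1) *: k * ((s + 1) *: k) +
      s ^+ 2 *: ((1 - k * k) * (1 - s^-1 ^+ 2 *: (k * k))) =
      (s *: 1 + k * k) * (s *: 1 + k * k).
    have /(congr1 (horner_alg k)) : (s + 1) *: 'X * ((s + 1) *: 'X) +
      s ^+ 2 *: ((1 - 'X * 'X) * (1 - s^-1 ^+ 2 *: ('X * 'X))) =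
      (s *: 1 + 'X * 'X) * (s *: 1 + 'X * 'X) :> {poly R}.
      have e : s ^+ 2 * s^-1 ^+ 2 = 1 by rewrite -exprMn divff ?gt_eqF// expr1n.
      have e' : s%:P ^+ 2 * s^-1%:P ^+ 2 = 1 :> {poly R} by rewrite -!polyC_exp -polyCM e.
      rewrite -!mul_polyC !polyC_exp !polyCD.
      by rewrite polyC1; ring: e'.
    by rewrite !horner_algE.
  rewrite -scalerAl -scalerAr scalerA NZ kk1 mulr1.
  rewrite ger0_norm; last by nra.
  move=> /le_trans/(_ (NM _ _)).
  rewrite -!expr2 ler_sqr ?nnegrE ?N0//; lra.
apply: (lam_ge _ _ _ _ _ hN) => t t0.
suff H u : 0 < u -> u <= 1 -> 1 <= dquot N (k * k) u.
  have [t1|t1] := leP t 1; first exact: H.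
  apply: (le_trans (H 1 ltr01 (lexx _))).
  by apply: (dquot_mono _ _ _ _ _ hN) => //; exact: ltW.
move=> u0 u1; rewrite /dquot ler_pdivlMr// mul1r lerBrDl.
have -> : 1 + u *: (k * k) = u *: (u^-1 *: 1 + k * k).
  by rewrite scalerDr scalerA divff ?gt_eqF// scale1r.
rewrite NZ ger0_norm ?(ltW u0)//.
have := main u^-1; rewrite invf_ge1// => /(_ u1).
by rewrite -(ler_pM2l u0) mulrDr mulr1 divff ?gt_eqF.
Qed.

(** [(M + e) - h] and [(M + e) + h] are limits of squares, hence so is their product
    [(M + e)^2 - h^2], which bounds [lam N (h * h) = N h ^+ 2]. *)
Lemma cs_norm_le_lam h M : star h = h -> lam N h <= M -> lam N (- h) <= M -> N h <= M.
Proof.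
move=> sh h1 h2; have M0 : 0 <= M.
  have := lamD _ _ _ _ _ hN h (- h); rewrite subrr (lam0 _ _ _ _ _ hN).
  by lra.
have psd_shift (e : R) k : bic h k -> 0 < e -> lam N k <= M -> psd h ((M + e) *: 1 - k).
  move=> bk e0 hk; set g := _ - _; have sg : star g = g.
    by rewrite /g (cs_starB _ _ _ _ _ hN) starZ (cs_star1 _ _ _ _ _ hN) bk.1.
  have lg : lam N (- g) <= - e.
    by rewrite /g opprB -scaleNr (lam_shift _ _ _ _ _ hN); lra.
  pose t := e / (N g ^+ 2 + 1).
  have c0 : 0 < N g ^+ 2 + 1 by have := sqr_ge0 (N g); lra.
  have t0 : 0 < t by rewrite divr_gt0.
  have tc : t * N g ^+ 2 <= e.
    by rewrite /t mulrAC ler_pdivrMr//; have := sqr_ge0 (N g); nra.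
  (* Because [lam N (- g)] is strictly negative, the rate estimate keeps [1 - t g] in the unit ball
     for this [t]; then [t g = 1 - (1 - t g)] falls under [psd_sub1]. *)
  have : N (1 - t *: g) <= 1.
    rewrite -scalerN (le_trans (cs_norm_rate _ _ _ _ _ hN _ _ _ t0))//.
      by rewrite (cs_starN _ _ _ _ _ hN) sg.
    by rewrite (cs_normN _ _ _ _ _ hN); nra.
  have bg : bic h g by apply: bicB => //; apply: bicZ; exact: bic1.
  move=> /(psd_sub1 h _ (bicB _ _ _ (bic1 h) (bicZ _ t _ bg))).
  rewrite opprB addrC subrK => /(psdZ _ t^-1).
  by rewrite invr_ge0 (ltW t0) scalerA mulVf ?gt_eqF// scale1r; exact.
apply/ler_addgt0Pl => e e0.
have bh := bic_self _ sh.
have p := psdM _ _ _ (psd_shift e h bh e0 h1) (psd_shift e (- h) (bicN _ _ bh) e0 h2).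
have := lam_psd_le0 _ _ p; have -> : - (((M + e) *: 1 - h) * ((M + e) *: 1 - - h))
    = h * h + (- ((M + e) ^+ 2)) *: 1.
  have /(congr1 (horner_alg h)) : - (((M + e) *: 1 - 'X) * ((M + e) *: 1 - - 'X))
    = 'X * 'X + (- ((M + e) ^+ 2)) *: 1 :> {poly R}.
    by rewrite -!mul_polyC polyCN polyC_exp; ring.
  by rewrite !horner_algE.
rewrite (lam_shift _ _ _ _ _ hN) lam_sqr// subr_le0 ler_sqr ?nnegrE ?N0//; last by lra.
by rewrite addrC.
Qed.

(** Suppose [lam N a < L] for [a = r^* r], [b = r r^*], [L = N r ^+ 2]. As [a + b] is a sum of
    squares, [lam N (- b) <= lam N a < L], and then [N b = L] forces [lam N b >= L]. Now
    [b + b^2 / L = r (1 + a / L) r^*] has norm at most [L + lam N a < 2 L], whereas its [lam] is at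
    least [3 lam N b - L >= 2 L]. *)
Lemma lam_star_mul r : lam N (star r * r) = N r ^+ 2.
Proof.
set a := star r * r; pose b := r * star r; pose L := N r ^+ 2.
have sa : star a = a by rewrite /a starM (csK _ _ _ hN).
have sb : star b = b by rewrite /b starM (csK _ _ _ hN).
have Na : N a = L by exact: (csNS _ _ _ hN).
have Nb : N b = L.
  by rewrite /b -{1}(csK _ _ _ hN r) (csNS _ _ _ hN) (cs_norm_star _ _ _ _ _ hN).
apply/le_anti; rewrite -/L -{1}Na (lam_le_norm _ _ _ _ _ hN)//= leNgt; apply/negP => aL.
have lab : lam N (- (a + b)) <= 0.
  pose x := r + star r; pose y := I * (r - star r).
  have sx : star x = x by rewrite /x starD (csK _ _ _ hN) addrC.
  have sy : star y = y.
    rewrite /y starM (cs_starB _ _ _ _ _ hN) (csK _ _ _ hN) (csI _ _ _ hN) mulrN.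
    by rewrite -(csIC _ _ _ hN) -mulrN opprB.
  have -> : - (a + b) = 2^-1 *: (- (x * x)) + 2^-1 *: (- (y * y)).
    have -> : y * y = - ((r - star r) * (r - star r)).
      by rewrite /y -mulrA (mulrA (r - _)) -(csIC _ _ _ hN) !mulrA (csII _ _ _ hN) mulN1r mulNr.
    have gen (p q c d : B) : - (p + c + (d + q)) + (p - c + (- d + q)) = - (d + c) - (d + c).
      rewrite [d + q]addrC [- d + q]addrC (addrACA p c) (addrACA p (- c)) -opprD [c + d]addrC.
      by rewrite opprD addrACA addNr add0r.
    rewrite opprK -scalerDr /x !mulrDl !mulrDr !mulrN !mulNr opprK gen -/a -/b.
    by rewrite -[X in _ *: X]mulr2n -[X in _ *: X]scaler_nat scalerA mulVf// scale1r.
  rewrite (le_trans (lamD _ _ _ _ _ hN _ _))// !(lamZ _ _ _ _ _ hN)//.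
  by have := lam_sqrN_le0 _ sx; have := lam_sqrN_le0 _ sy; lra.
have lNb : lam N (- b) <= lam N a.
  have -> : - b = - (a + b) + a by rewrite opprD addrAC addNr add0r.
  by rewrite (le_trans (lamD _ _ _ _ _ hN _ _))//; lra.
have lb : L <= lam N b.
  rewrite leNgt; apply/negP => bL.
  have := cs_norm_le_lam b (Num.max (lam N b) (lam N a)) sb.
  rewrite !le_max lexx lNb orbT Nb => /(_ isT isT); rewrite -/L.
  by case: leP; lra.
have L0 : 0 < L.
  by have := lam_norm_ge _ _ _ _ _ hN a; rewrite Na; have := sqr_ge0 (N r); rewrite -/L; lra.
have up : N (b + L^-1 *: (b * b)) <= L * (1 + L^-1 * lam N a).
  have -> : b + L^-1 *: (b * b) = r * (1 + L^-1 *: a) * star r.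
    by rewrite mulrDr mulr1 mulrDl -scalerAr -scalerAl /a /b !mulrA.
  rewrite (le_trans (NM _ _))// (cs_norm_star _ _ _ _ _ hN).
  rewrite (le_trans (ler_wpM2r (N0 _) (NM _ _)))// mulrAC -expr2 -/L ler_wpM2l ?(ltW L0)//.
  have iL : 0 <= L^-1 by rewrite invr_ge0 ltW.
  have hl : -1 <= L^-1 * lam N a.
    have := lam_norm_ge _ _ _ _ _ hN a; rewrite Na -(ler_pM2l (_ : 0 < L^-1)) ?invr_gt0//.
    by rewrite mulrN mulVf ?gt_eqF.
  apply: cs_norm_le_lam.
  - by rewrite starD starZ sa (cs_star1 _ _ _ _ _ hN).
  - rewrite addrC -[X in _ + X]scale1r (lam_shift _ _ _ _ _ hN) (lamZ _ _ _ _ _ hN)//.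
    by rewrite addrC.
  - have -> : - (1 + L^-1 *: a) = L^-1 *: (- a) + (-1) *: 1.
      by rewrite opprD addrC scalerN scaleN1r.
    rewrite (lam_shift _ _ _ _ _ hN) (lamZ _ _ _ _ _ hN)//.
    have : L^-1 * lam N (- a) <= 1.
      rewrite -(mulVf (lt0r_neq0 L0)) ler_wpM2l//.
      by rewrite (le_trans (lam_le_norm _ _ _ _ _ hN _))// (cs_normN _ _ _ _ _ hN) Na.
    by lra.
have low : 3 * lam N b - L <= lam N (b + L^-1 *: (b * b)).
  have l3 : lam N (3 *: b + (- L) *: 1) = 3 * lam N b - L.
    by rewrite (lam_shift _ _ _ _ _ hN) (lamZ _ _ _ _ _ hN).
  rewrite -l3; set d := b - L *: 1.
  have sd : star d = d by rewrite /d (cs_starB _ _ _ _ _ hN) starZ (cs_star1 _ _ _ _ _ hN) sb.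
  have -> : 3 *: b + (- L) *: 1 = (b + L^-1 *: (b * b)) + L^-1 *: (- (d * d)).
    have /(congr1 (horner_alg b)) : 3 *: 'X + (- L) *: 1 = ('X + L^-1 *: ('X * 'X)) +
       L^-1 *: (- (('X - L *: 1) * ('X - L *: 1))) :> {poly R}.
      have e : L%:P * L^-1%:P = 1 :> {poly R} by rewrite -polyCM divff ?gt_eqF.
      by rewrite -!mul_polyC polyCN; ring: e.
    by rewrite !horner_algE.
  rewrite (le_trans (lamD _ _ _ _ _ hN _ _))// (lamZ _ _ _ _ _ hN) ?invr_ge0 ?(ltW L0)//.
  by rewrite gerDl mulr_ge0_le0 ?invr_ge0 ?(ltW L0)// lam_sqrN_le0.
have := lam_le_norm _ _ _ _ _ hN (b + L^-1 *: (b * b)).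
have e : L * (1 + L^-1 * lam N a) = L + lam N a by field; rewrite gt_eqF.
by move: up; rewrite e; lra.
Qed.

(* If [t^* t] had a negative spectral value, passing to [2 t (1 - t^* t)] would
   multiply it by at least 4 without leaving the unit ball. *)
Lemma lam_star_mulN_le0 t : lam N (- (star t * t)) <= 0.
Proof.
have iter n : forall t, N t <= 1 -> lam N (- (star t * t)) <= (4^-1) ^+ n.
  elim: n => [|n IH] {}t t1.
    rewrite expr0 (le_trans (lam_le_norm _ _ _ _ _ hN _))// (cs_normN _ _ _ _ _ hN).
    by rewrite (csNS _ _ _ hN) exprn_ile1.
  set h := star t * t; have sh : star h = h by rewrite /h starM (csK _ _ _ hN).
  have h1 : N h <= 1 by rewrite (csNS _ _ _ hN) exprn_ile1.
  have bh := bic_self _ sh.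
  pose r := t * (1 - h); pose a := (1 - h) * h * (1 - h).
  have ra : star r * r = a.
    by rewrite /r starM (cs_starB _ _ _ _ _ hN) (cs_star1 _ _ _ _ _ hN) sh /a -/h !mulrA -/h.
  have p1 : psd h (1 - h) by exact: psd_sub1.
  have la : lam N a <= 4^-1.
    (* [h (1 - h)^2] peaks at [h = 1/3] with value [4/27 < 1/4], and [4/27 - h (1 - h)^2 = (h -
       1/3)^2 (1/3 + (1 - h))]. The bound [1/4] is what keeps [2 r] in the unit ball. *)
    set c := h - 3^-1 *: 1; have bc : bic h c.
      by apply: bicB => //; apply: bicZ; exact: bic1.
    have pc := psd_sqr _ _ bc.
    have pc3 : psd h (3^-1 *: (c * c)) by exact: psdZ.
    have l1 := lam_psd_le0 _ _ pc3; have l2 := lam_psd_le0 _ _ (psdM _ _ _ pc p1).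
    have -> : a = - (3^-1 *: (c * c)) + - (c * c * (1 - h)) + (4 / 27) *: 1.
      have /(congr1 (horner_alg h)) : (1 - 'X) * 'X * (1 - 'X) =
         - (3^-1 *: (('X - 3^-1 *: 1) * ('X - 3^-1 *: 1))) +
         - (('X - 3^-1 *: 1) * ('X - 3^-1 *: 1) * (1 - 'X)) + (4 / 27) *: 1 :> {poly R}.
        have -> : 4 / 27 = (1 + 3^-1) * 3^-1 * 3^-1 :> R by field.
        have e : 3 * 3^-1%:P = 1 :> {poly R}.
          by rewrite -[3]/(1%:P *+ 3) -polyCMn -polyCM divff.
        rewrite -!mul_polyC !polyCM polyCD polyC1; set t3 := _%:P in e *.
        apply/eqP; rewrite -subr_eq0.
        rewrite [X in X == 0](_ : _ = (3 * t3 - 1) * ('X * 'X - (1 + t3) * 'X)).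
          by rewrite e subrr mul0r.
        by ring.
      by rewrite !horner_algE.
    rewrite (lam_shift _ _ _ _ _ hN).
    by have := lamD _ _ _ _ _ hN (- (3^-1 *: (c * c))) (- (c * c * (1 - h))); lra.
  have Nr : N (2 *: r) <= 1.
    rewrite NZ ger0_norm//; have := lam_star_mul r; rewrite ra => e.
    have : N r ^+ 2 <= (2^-1) ^+ 2 by rewrite -e (le_trans la)//; lra.
    by rewrite ler_sqr ?nnegrE ?N0//; lra.
  have := IH _ Nr; rewrite starZ -scalerAl -scalerAr scalerA ra -scalerN (lamZ _ _ _ _ _ hN)//.
  have l1 := lam_sqrN_le0 _ sh.
  have l2 := lam_psd_le0 _ _ (psdM _ _ _ (psd_sqr _ _ bh) p1).
  (* [- h] differs from [- a] by negatives of positive elements, so [lam N (- h) <= lam N (- a)], a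
     quarter of the quantity for [2 r]. *)
  have -> : - h = - a + (- (h * h) + - (h * h * (1 - h))).
    have /(congr1 (horner_alg h)) : - 'X = - ((1 - 'X) * 'X * (1 - 'X)) +
        (- ('X * 'X) + - ('X * 'X * (1 - 'X))) :> {poly R} by ring.
    by rewrite !horner_algE.
  have := lamD _ _ _ _ _ hN (- a) (- (h * h) + - (h * h * (1 - h))).
  have := lamD _ _ _ _ _ hN (- (h * h)) (- (h * h * (1 - h))).
  by rewrite exprS; lra.
have H s : N s <= 1 -> lam N (- (star s * s)) <= 0.
  move=> s1; rewrite leNgt; apply/negP => l0.
  pose n := Num.truncn (lam N (- (star s * s)))^-1.
  have := iter n.+1 s s1; rewrite exprVn leNgt => /negP; apply.
  rewrite invf_plt ?posrE// (lt_le_trans (truncnS_gt _))//.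
  by rewrite -natrX ler_nat ltnW// ltn_expl.
pose c := N t + 1; have c0 : 0 < c by have := N0 t; rewrite /c; lra.
have := H (c^-1 *: t); rewrite NZ ger0_norm ?invr_ge0 ?(ltW c0)// mulrC ler_pdivrMr// mul1r.
rewrite /c lerDl ler01 => /(_ isT); rewrite -/c starZ -scalerAl -scalerAr scalerA -scalerN.
have c2 : 0 < c^-1 * c^-1 by rewrite mulr_gt0 ?invr_gt0.
by rewrite (lamZ _ _ _ _ _ hN) ?(ltW c2)// pmulr_rle0.
Qed.

End Positivity.

(** * Faithful selections for continuous fields of sublinear functionals *)

Section HahnBanach.
Variables (R : realType) (V : lmodType R).
Implicit Types (p q f : V -> R).

Definition sublin p :=
  (forall u v, p (u + v) <= p u + p v) /\
  (forall (a : R) v, 0 <= a -> p (a *: v) = a * p v).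

Definition linfn f :=
  (forall u v, f (u + v) = f u + f v) /\ (forall (a : R) v, f (a *: v) = a * f v).

Lemma sublin0 p : sublin p -> p 0 = 0.
Proof. by move=> [_ pZ]; rewrite -(scale0r (0 : V)) pZ// mul0r. Qed.

Lemma sublinN_ge p v : sublin p -> - p (- v) <= p v.
Proof.
move=> sp; have := sp.1 v (- v); rewrite subrr sublin0//; lra.
Qed.

Lemma sublin_dist p u v : sublin p -> p u <= p v + p (u - v).
Proof. by move=> sp; rewrite -{1}(subrK v u) addrC sp.1. Qed.

Lemma linfn0 f : linfn f -> f 0 = 0.
Proof. by move=> [_ fZ]; rewrite -(scale0r (0 : V)) fZ mul0r. Qed.

Lemma linfnN f v : linfn f -> f (- v) = - f v.
Proof. by move=> [_ fZ]; rewrite -scaleN1r fZ mulN1r. Qed.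

Lemma linfnB f u v : linfn f -> f (u - v) = f u - f v.
Proof. by move=> lf; rewrite lf.1 linfnN. Qed.

Lemma linfn_sum f n (t : 'I_n -> R) (v : 'I_n -> V) : linfn f ->
  f (\sum_i t i *: v i) = \sum_i t i * f (v i).
Proof.
move=> lf; apply: (big_ind2 (fun x y => f x = y)); first exact: linfn0.
  by move=> ? ? ? ? <- <-; rewrite lf.1.
by move=> i _; rewrite lf.2.
Qed.

Lemma sublin_sum p n (v : 'I_n -> V) : sublin p -> p (\sum_i v i) <= \sum_i p (v i).
Proof.
move=> sp; apply: (big_ind2 (fun x y => p x <= y)) => //; first by rewrite sublin0.
by move=> ? ? ? ? h1 h2; rewrite (le_trans (sp.1 _ _))// lerD.
Qed.

(* Below [q] and sublinear, so that a minimal [q] equals all its tilts and is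
   therefore linear. *)
Let tilt q (w v : V) : R := inf [set q (v + s *: w) - s * q w | s in [set s : R | 0 <= s]].

Let tilt_lb q w v : sublin q ->
  lbound [set q (v + s *: w) - s * q w | s in [set s : R | 0 <= s]] (- q (- v)).
Proof.
move=> sq _ [s /= s0 <-]; have := sq.1 (v + s *: w) (- v).
by rewrite addrAC subrr add0r sq.2//; lra.
Qed.

Let tilt_le q w v s : sublin q -> 0 <= s -> tilt q w v <= q (v + s *: w) - s * q w.
Proof. by move=> sq s0; apply: ge_inf; [exists (- q (- v)); exact: tilt_lb|exists s]. Qed.

Let tilt_ge q w v c : (forall s, 0 <= s -> c <= q (v + s *: w) - s * q w) -> c <= tilt q w v.
Proof.
move=> h; apply: lb_le_inf; first by exists (q (v + 0 *: w) - 0 * q w), 0 => /=.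
by move=> _ [s /= s0 <-]; exact: h.
Qed.

Let sublin_tilt q w : sublin q -> sublin (tilt q w).
Proof.
move=> sq; split=> [u v|a v a0].
  suff H s t : 0 <= s -> 0 <= t -> tilt q w (u + v) <=
      (q (u + s *: w) - s * q w) + (q (v + t *: w) - t * q w).
    rewrite -lerBlDr; apply: tilt_ge => s s0; rewrite lerBlDr -lerBlDl.
    by apply: tilt_ge => t t0; rewrite lerBlDl; exact: H.
  move=> s0 t0; apply: (le_trans (tilt_le _ _ _ (s + t) sq _)); first by rewrite addr_ge0.
  by have := sq.1 (u + s *: w) (v + t *: w); rewrite addrACA -scalerDl; lra.
have [->|an] := eqVneq a 0.
  rewrite scale0r mul0r; apply/le_anti/andP; split.
    by rewrite (le_trans (tilt_le _ _ _ 0 sq _))// scale0r addr0 sublin0// mul0r subrr.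
  by apply: tilt_ge => s s0; rewrite add0r sq.2// subrr.
have ap : 0 < a by rewrite lt_neqAle eq_sym an.
have le b u : 0 < b -> tilt q w (b *: u) <= b * tilt q w u.
  move=> b0; rewrite mulrC -ler_pdivrMr//; apply: tilt_ge => s s0.
  rewrite ler_pdivrMr// mulrC mulrBr -sq.2 ?(ltW b0)// mulrA scalerDr scalerA.
  by apply: tilt_le => //; rewrite mulr_ge0// ltW.
apply/le_anti; rewrite le//=.
have ia : 0 < a^-1 by rewrite invr_gt0.
have := le a^-1 (a *: v) ia; rewrite scalerA mulVf// scale1r.
by rewrite mulrC ler_pdivlMr// mulrC.
Qed.

Lemma hahn_banach q : sublin q -> exists2 f, linfn f & forall v, f v <= q v.
Proof.
move=> sq.
pose T := {r : V -> R | sublin r /\ forall v, r v <= q v}.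
(* The order is reversed, so that a maximal element for Zorn is a minimal sublinear minorant; the
   pointwise infimum bounds a chain and is finite because every member is at least [- q (- v)]. *)
pose le (r s : T) := `[< forall v, sval s v <= sval r v >].
have [||r s|A Atot|m mmin] := @Zorn T le.
- by move=> r; apply/asboolP.
- move=> r s t /asboolP rs /asboolP st; apply/asboolP => v.
  exact: le_trans (st v) (rs v).
- case: r s => [r pr] [s ps] /asboolP /= rs /asboolP /= sr.
  have e : r = s by apply/funext => v; apply/le_anti; rewrite rs sr.
  by move: pr; rewrite e => pr; congr exist; exact: Prop_irrelevance.
- have [[r0 Ar0]|A0] := pselect (A !=set0); last first.
    by exists (exist _ q (conj sq (fun v => lexx _))) => s As; case: A0; exists s.
  pose Z v := [set sval r v | r in A].
  have Zlb v : lbound (Z v) (- q (- v)).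
    move=> _ [r Ar <-]; have [sr rq] := svalP r.
    by have := sublinN_ge _ v sr; have := rq (- v); lra.
  have Zi v : has_inf (Z v) by split; [exists (sval r0 v), r0|exists (- q (- v))].
  pose m v := inf (Z v).
  have m_le r v : A r -> m v <= sval r v.
    by move=> Ar; apply: ge_inf; [exact: (Zi v).2|exists r].
  have m_ge v c : (forall r, A r -> c <= sval r v) -> c <= m v.
    by move=> h; apply: lb_le_inf; [exact: (Zi v).1|move=> _ [r Ar <-]; exact: h].
  have sm : sublin m.
    split=> [u v|a v a0].
      suff H r s : A r -> A s -> m (u + v) <= sval r u + sval s v.
        rewrite -lerBlDr; apply: (m_ge) => r Ar; rewrite lerBlDr -lerBlDl.
        by apply: (m_ge) => s As; rewrite lerBlDl; exact: H.
      move=> Ar As; case: (Atot _ _ Ar As) => /asboolP h.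
        rewrite (le_trans (m_le s _ As))// (le_trans ((svalP s).1.1 _ _))//.
        by rewrite lerD2r.
      rewrite (le_trans (m_le r _ Ar))// (le_trans ((svalP r).1.1 _ _))//.
      by rewrite lerD2l.
    have [->|an] := eqVneq a 0.
      rewrite scale0r mul0r; apply/le_anti/andP; split.
        by rewrite (le_trans (m_le r0 _ Ar0))// sublin0//; exact: (svalP r0).1.
      by apply: (m_ge) => r Ar; rewrite sublin0//; exact: (svalP r).1.
    have ap : 0 < a by rewrite lt_neqAle eq_sym an.
    have le' b u : 0 < b -> m (b *: u) <= b * m u.
      move=> b0; rewrite mulrC -ler_pdivrMr//; apply: (m_ge) => r Ar.
      by rewrite ler_pdivrMr// mulrC -(svalP r).1.2 ?(ltW b0)//; exact: (m_le).
    apply/le_anti; rewrite le'//=.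
    have ia : 0 < a^-1 by rewrite invr_gt0.
    have := le' a^-1 (a *: v) ia; rewrite scalerA mulVf// scale1r.
    by rewrite mulrC ler_pdivlMr// mulrC.
  have mq v : m v <= q v by rewrite (le_trans (m_le r0 v Ar0))// (svalP r0).2.
  exists (exist _ m (conj sm mq)) => s As; apply/asboolP => v /=; exact: (m_le).
have [sm mq] := svalP m.
have tiltm w v : sval m v + sval m w = sval m (v + w).
  have st := sublin_tilt _ w sm.
  have tm u : tilt (sval m) w u <= sval m u.
    by rewrite (le_trans (tilt_le _ _ _ 0 sm _))// scale0r addr0 mul0r subr0.
  have tq u : tilt (sval m) w u <= q u by exact: le_trans (tm u) (mq u).
  have /mmin/(congr1 sval)/= e : le m (exist _ _ (conj st tq)) by apply/asboolP => u /=.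
  apply/le_anti; rewrite sm.1 andbT.
  have := tilt_le _ w v 1 sm ler01; rewrite e scale1r mul1r.
  by rewrite lerBrDr.
have mN v : sval m (- v) = - sval m v.
  by have := tiltm v (- v); rewrite addNr sublin0//; lra.
exists (sval m) => //; split=> [u v|a v]; first by rewrite tiltm.
have [a0|a0] := leP 0 a; first exact: sm.2.
by rewrite -[a]opprK scaleNr mN sm.2 ?mulNr// oppr_ge0 ltW.
Qed.

(** Hahn-Banach is applied to [q u], the infimum over [t] of
    [p (u - sum t v) + sum t b + e * sum |t|]. The hypothesis on [b] is what keeps this infimum
    finite, and [q] at [v i] and at [- v i] gives the two bounds on [f (v i)]. *)
Lemma hahn_banach_approx p n (v : 'I_n -> V) (b : 'I_n -> R) (e : R) :
  sublin p -> 0 <= e ->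
  (forall t : 'I_n -> R,
     \sum_i t i * b i <= p (\sum_i t i *: v i) + e * \sum_i `|t i|) ->
  exists f, [/\ linfn f, forall u, f u <= p u & forall i, `|f (v i) - b i| <= e].
Proof.
move=> sp e0 hb.
pose c (t : 'I_n -> R) u := p (u - \sum_i t i *: v i) + \sum_i t i * b i + e * \sum_i `|t i|.
pose q u := inf [set c t u | t in setT].
have clb u : lbound [set c t u | t in setT] (- p (- u)).
  move=> _ [t _ <-]; rewrite /c; have := hb (fun i => - t i).
  under eq_bigr do rewrite mulNr; rewrite sumrN.
  have -> : \sum_i - t i *: v i = - \sum_i t i *: v i.
    by rewrite -sumrN; apply: eq_bigr => i _; rewrite scaleNr.
  have -> : \sum_i `|- t i| = \sum_i `|t i| by apply: eq_bigr => i _; rewrite normrN.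
  have := sp.1 (u - \sum_i t i *: v i) (- u); rewrite addrAC subrr add0r; lra.
have q_le u t : q u <= c t u by apply: ge_inf; [exists (- p (- u))|exists t].
have q_ge u d : (forall t, d <= c t u) -> d <= q u.
  move=> h; apply: lb_le_inf; first by exists (c (fun=> 0) u), (fun=> 0).
  by move=> _ [t _ <-].
have c0 u : c (fun=> 0) u = p u.
  rewrite /c !big1 ?mulr0 ?addr0 ?subr0// => i _; rewrite ?normr0 ?mul0r ?scale0r//.
have sq : sublin q.
  split=> [u w|a u a0].
    suff H s t : q (u + w) <= c s u + c t w.
      rewrite -lerBlDr; apply: (q_ge) => s; rewrite lerBlDr -lerBlDl.
      by apply: (q_ge) => t; rewrite lerBlDl.
    apply: (le_trans (q_le _ (fun i => s i + t i))); rewrite /c.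
    have -> : \sum_i (s i + t i) *: v i = \sum_i s i *: v i + \sum_i t i *: v i.
      by rewrite -big_split; apply: eq_bigr => i _; rewrite scalerDl.
    have -> : \sum_i (s i + t i) * b i = \sum_i s i * b i + \sum_i t i * b i.
      by rewrite -big_split; apply: eq_bigr => i _; rewrite mulrDl.
    have : \sum_i `|s i + t i| <= \sum_i `|s i| + \sum_i `|t i|.
      by rewrite -big_split; apply: ler_sum => i _; exact: ler_normD.
    move=> /(ler_wpM2l e0); rewrite mulrDr.
    have := sp.1 (u - \sum_i s i *: v i) (w - \sum_i t i *: v i).
    by rewrite addrACA -opprD; lra.
  have [->|an] := eqVneq a 0.
    rewrite scale0r mul0r; apply/le_anti/andP; split.
      by rewrite (le_trans (q_le _ (fun=> 0)))// c0 sublin0.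
    by apply: (q_ge) => t; have := clb 0 _ (ex_intro2 _ _ t I erefl); rewrite oppr0 sublin0// oppr0.
  have ap : 0 < a by rewrite lt_neqAle eq_sym an.
  have le' d w : 0 < d -> q (d *: w) <= d * q w.
    move=> d0; rewrite mulrC -ler_pdivrMr//; apply: (q_ge) => t.
    rewrite ler_pdivrMr// mulrC (le_trans (q_le _ (fun i => d * t i)))// /c.
    under eq_bigr do rewrite -scalerA; rewrite -scaler_sumr -scalerBr sp.2 ?(ltW d0)//.
    have -> : \sum_i d * t i * b i = d * \sum_i t i * b i.
      by rewrite mulr_sumr; apply: eq_bigr => i _; rewrite mulrA.
    have -> : \sum_i `|d * t i| = d * \sum_i `|t i|.
      by rewrite mulr_sumr; apply: eq_bigr => i _; rewrite normrM (gtr0_norm d0).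
    by rewrite !mulrDr (mulrCA e).
  apply/le_anti; rewrite le'//=.
  have ia : 0 < a^-1 by rewrite invr_gt0.
  have := le' a^-1 (a *: u) ia; rewrite scalerA mulVf// scale1r.
  by rewrite mulrC ler_pdivlMr// mulrC.
have [f lf fq] := hahn_banach _ sq.
have fp u : f u <= p u by rewrite (le_trans (fq u))// (le_trans (q_le u (fun=> 0)))// c0.
exists f; split=> // i.
have val (s : R) : c (fun j => if j == i then s else 0) (s *: v i) = s * b i + e * `|s|.
  rewrite /c (bigD1 i)//= eqxx big1 ?addr0; last by move=> j /negbTE ->; rewrite scale0r.
  rewrite subrr sublin0// add0r (bigD1 i)//= eqxx big1 ?addr0; last by move=> j /negbTE ->; rewrite mul0r.
  by rewrite (bigD1 i)//= eqxx big1 ?addr0// => j /negbTE ->; rewrite normr0.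
have h s : f (s *: v i) <= s * b i + e * `|s|.
  by rewrite -val (le_trans (fq _))// q_le.
have := h 1; have := h (-1); rewrite scaleN1r scale1r linfnN// normrN normr1 => h1 h2.
by rewrite ler_norml; apply/andP; split; lra.
Qed.

Lemma hahn_banach_at p v : sublin p -> exists f, [/\ linfn f, forall u, f u <= p u & f v = p v].
Proof.
move=> sp; have [|t|f [lf fp fv]] := hahn_banach_approx p 1 (fun=> v) (fun=> p v) 0 sp.
- by [].
- rewrite !big_ord1 mul0r addr0; have [t0|t0] := leP 0 (t ord0); first by rewrite sp.2.
  have := sublinN_ge _ (- v) sp; rewrite opprK -[t ord0]opprK scaleNr -scalerN sp.2 ?oppr_ge0 ?(ltW t0)//.
  by nra.
- exists f; split=> //; apply/eqP; rewrite -subr_eq0 -normr_le0; exact: fv ord0.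
Qed.

End HahnBanach.

(** * Quantitative invertibility of matrices *)

Section MatrixBound.
Variable R : realType.

Lemma ler_norm_max (a b c : R) : a <= b -> - a <= c -> `|a| <= Num.max b c.
Proof. by move=> h1 h2; rewrite ler_norml lerNl !le_max h1 h2 orbT. Qed.

Lemma sum_ord_const k (m : R) : \sum_(i < k) m = k%:R * m.
Proof. by rewrite sumr_const card_ord mulr_natl. Qed.

Lemma unitmx_sum_bound k (M : 'M[R]_k) : \det M != 0 ->
  exists2 C : R, 0 < C & forall t : 'I_k -> R,
    \sum_j `|t j| <= C * \sum_i `|\sum_j M i j * t j|.
Proof.
move=> dM; have uM : M \in unitmx by rewrite unitmxE unitfE.
pose C := \sum_j \sum_i `|invmx M j i| + 1.
have S0 : 0 <= \sum_j \sum_i `|invmx M j i| by apply: sumr_ge0 => j _; apply: sumr_ge0.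
exists C => [|t]; first by rewrite ltr_wpDl.
pose s i := \sum_j M i j * t j.
have te j : t j = \sum_i invmx M j i * s i.
  have := congr1 (fun A : 'cV[R]_k => A j 0) (mulKmx uM (\col_j t j)).
  rewrite /= [RHS]mxE => <-; rewrite mxE; apply: eq_bigr => i _; congr (_ * _).
  by rewrite mxE /s; apply: eq_bigr => l _; rewrite mxE.
have sle i : `|s i| <= \sum_i `|s i|.
  by rewrite (bigD1 i)//= lerDl sumr_ge0.
apply: (@le_trans _ _ (\sum_j \sum_i `|invmx M j i| * \sum_i `|s i|)).
  apply: ler_sum => j _; rewrite te (le_trans (ler_norm_sum _ _ _))//.
  by apply: ler_sum => i _; rewrite normrM ler_wpM2l.
under eq_bigr do rewrite -mulr_suml; rewrite -mulr_suml /C mulrDl lerDl mul1r.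
exact: sumr_ge0.
Qed.

Lemma det_neq0_of_injective k (M : 'M[R]_k) :
  (forall t : 'I_k -> R, (forall i, \sum_j M i j * t j = 0) -> forall j, t j = 0) ->
  \det M != 0.
Proof.
move=> H; rewrite -det_tr; apply/negP => /det0P [v v0 vM].
case/negP: v0; apply/eqP/rowP => j; rewrite mxE; apply: (H (fun j => v 0 j)) => i.
have := congr1 (fun A : 'rV[R]_k => A 0 i) vM; rewrite !mxE => h.
by rewrite -[RHS]h; apply: eq_bigr => l _; rewrite mxE mulrC.
Qed.

End MatrixBound.

(** * States of a continuous family of sublinear functionals *)

Section StateFields.
Variables (R : realType) (X : topologicalType) (V : lmodType R) (e : V) (p : X -> V -> R).
Hypothesis hsub : forall x, sublin R V (p x).
Hypothesis he : forall x, p x e = 1.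
Hypothesis heN : forall x, p x (- e) = -1.
Hypothesis hcont : forall v, continuous (fun x => p x v : R^o).
Implicit Types (x y : X) (f : V -> R) (c : R).

Definition state x f := linfn R V f /\ forall v, f v <= p x v.

Definition width x v := p x v + p x (- v).

(* [f] is a state with [f g >= c * p x g] on the cone [p x (- g) <= 0]. *)
Definition faithful_state x c f := linfn R V f /\ forall v, f v <= p x v - c * width x v.

Lemma width_ge0 x v : 0 <= width x v.
Proof. by have := sublinN_ge _ _ _ v (hsub x); rewrite /width; lra. Qed.

Lemma p_shift x v (a : R) : p x (v + a *: e) = p x v + a.
Proof.
have pe b : p x (b *: e) = b.
  have [b0|b0] := leP 0 b; first by rewrite (hsub x).2// he mulr1.
  by rewrite -[b]opprK scaleNr -scalerN (hsub x).2 ?heN; [rewrite mulrN1|lra].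
apply/le_anti; rewrite -{2}(pe a) (hsub x).1/=.
have := (hsub x).1 (v + a *: e) ((- a) *: e).
by rewrite -addrA -scalerDl subrr scale0r addr0 pe; lra.
Qed.

Lemma state_ge x f v : state x f -> - p x (- v) <= f v.
Proof. by move=> [lf fp]; have := fp (- v); rewrite (linfnN _ _ _ _ lf); lra. Qed.

Lemma state_e x f : state x f -> f e = 1.
Proof.
move=> sf; have := state_ge _ _ e sf; have := sf.2 e; rewrite he heN.
by lra.
Qed.

Lemma state_norm x f v : state x f -> `|f v| <= Num.max (p x v) (p x (- v)).
Proof.
move=> sf; apply: ler_norm_max; first exact: sf.2.
by have := state_ge _ _ v sf; lra.
Qed.

Lemma faithful_state_weak x c d f : d <= c -> faithful_state x c f -> faithful_state x d f.
Proof.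
move=> dc [lf hf]; split=> // v; have := hf v; have := width_ge0 x v.
by set w := width x v; nra.
Qed.

Lemma faithful_state_state x c f : 0 <= c -> faithful_state x c f -> state x f.
Proof.
move=> c0 hf; have [lf h] := faithful_state_weak _ _ _ _ c0 hf.
by split=> // v; have := h v; rewrite mul0r subr0.
Qed.

Lemma state_faithful_state x f : state x f -> faithful_state x 0 f.
Proof. by move=> [lf h]; split=> // v; rewrite mul0r subr0. Qed.

Lemma faithful_stateP x c f : 0 <= c <= 1 -> state x f ->
  faithful_state x c f <-> (forall g, p x (- g) <= 0 -> c * p x g <= f g).
Proof.
move=> /andP[c0 c1] sf; split=> [[lf h] g g0|h].
  have := h (- g); rewrite /width opprK (linfnN _ _ _ _ lf); nra.
split=> [|v]; first exact: sf.1.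
(* Shifting by [p x v] puts [g = p x v * e - v] on the boundary of the cone, with
   [p x g = width x v] and [f g = p x v - f v]. *)
have := h (- (v + (- p x v) *: e)); rewrite opprK p_shift subrr => /(_ (lexx _)).
rewrite opprD -scaleNr opprK p_shift (sf.1).1 (sf.1).2 (state_e _ _ sf) mulr1.
by rewrite (linfnN _ _ _ _ sf.1) /width addrC; lra.
Qed.

Lemma linfn_comb (a b : R) f g : linfn R V f -> linfn R V g ->
  linfn R V (fun v => a * f v + b * g v).
Proof.
move=> [fD fZ] [gD gZ]; split=> [u v|s v]; first by rewrite fD gD; ring.
by rewrite fZ gZ; ring.
Qed.

Lemma faithful_state_comb x (a c d : R) f g : 0 <= a <= 1 ->
  faithful_state x c f -> faithful_state x d g ->
  faithful_state x ((1 - a) * c + a * d) (fun v => (1 - a) * f v + a * g v).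
Proof.
move=> /andP[a0 a1] [lf hf] [lg hg]; split=> [|v]; first exact: linfn_comb.
have := hf v; have := hg v; move: (f v) (g v) (p x v) (width x v) => F G P W h1 h2.
have : (1 - a) * F <= (1 - a) * (P - c * W) by rewrite ler_wpM2l// subr_ge0.
have : a * G <= a * (P - d * W) by rewrite ler_wpM2l.
lra.
Qed.

Lemma state_attains x v : exists2 f, state x f & f v = p x v.
Proof. by have [f [lf fp fv]] := hahn_banach_at _ _ _ v (hsub x); exists f. Qed.

Lemma p_dist x u v : `|p x u - p x v| <= Num.max (p x (u - v)) (p x (v - u)).
Proof.
have := sublin_dist _ _ _ u v (hsub x); have := sublin_dist _ _ _ v u (hsub x).
by move=> h1 h2; apply: ler_norm_max; lra.
Qed.

Lemma p_near x v (eps : R) : 0 < eps -> \forall y \near x, `|p x v - p y v| < eps.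
Proof. by move=> e0; have /cvgrPdist_lt := hcont v x; apply. Qed.

Lemma p_max_ge0 x v : 0 <= Num.max (p x v) (p x (- v)).
Proof.
by have := width_ge0 x v; rewrite /width; case: (lerP (p x v)); lra.
Qed.

Let B x v := Num.max (p x v) (p x (- v)).

Let B_ge0 x v : 0 <= B x v.
Proof. exact: p_max_ge0. Qed.

Let BZ x (a : R) v : B x (a *: v) = `|a| * B x v.
Proof.
rewrite /B; have [a0|a0] := leP 0 a.
  by rewrite -scalerN !(hsub x).2// ger0_norm// maxr_pMr.
have pa u : p x (a *: u) = - a * p x (- u).
  by rewrite -{1}[a]opprK scaleNr -scalerN (hsub x).2// oppr_ge0 ltW.
by rewrite ltr0_norm// -scalerN !pa opprK maxC maxr_pMr// oppr_ge0 ltW.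
Qed.

Let p_sum_dist x n (v : 'I_n -> V) (s t : 'I_n -> R) :
  `|p x (\sum_i s i *: v i) - p x (\sum_i t i *: v i)| <= \sum_i `|s i - t i| * B x (v i).
Proof.
have bound (r : 'I_n -> R) : p x (\sum_i r i *: v i) <= \sum_i `|r i| * B x (v i).
  rewrite (le_trans (sublin_sum _ _ _ _ _ (hsub x)))//; apply: ler_sum => i _.
  by rewrite -BZ /B le_max lexx.
have sub (r q : 'I_n -> R) :
    \sum_i r i *: v i - \sum_i q i *: v i = \sum_i (r i - q i) *: v i.
  by rewrite -sumrB; apply: eq_bigr => i _; rewrite scalerBl.
rewrite (le_trans (p_dist _ _ _))// ge_max !sub bound/=.
by rewrite (le_trans (bound _))//; apply: ler_sum => i _; rewrite distrC.
Qed.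

(** Pointwise continuity becomes uniform over the coefficients by compactness of the cube
    [[-1, 1]^n], and homogeneity extends the bound to all [t]. *)
Lemma p_equicontinuous x n (v : 'I_n -> V) (eps : R) : 0 < eps ->
  \forall y \near x, forall t : 'I_n -> R,
    `|p y (\sum_i t i *: v i) - p x (\sum_i t i *: v i)| <= eps * \sum_i `|t i|.
Proof.
case: n v => [|n] v e0.
  by near=> y => t; rewrite !big_ord0 !(sublin0 _ _ _ (hsub _)) subrr normr0 mulr0.
pose K := [set t : 'rV[R]_n.+1 | forall i, `[-1, 1]%classic (t ord0 i)].
have cK : compact K.
  exact: (@rV_compact R n.+1 (fun=> `[-1, 1]%classic) (fun=> @segment_compact R (-1) 1)).
have nb : \forall y \near x, forall i, B y (v i) <= B x (v i) + 1.
  apply: filter_forall => i.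
  have h u : \forall y \near x, p y u <= p x u + 1.
    near=> y; have : `|p x u - p y u| < 1.
      by near: y; exact: p_near.
    by rewrite ltr_norml => /andP[? ?]; lra.
  near=> y; rewrite /B ge_max; apply/andP; split.
    have : p y (v i) <= p x (v i) + 1 by near: y; exact: h.
    by move=> /le_trans; apply; rewrite lerD2r le_max lexx.
  have : p y (- v i) <= p x (- v i) + 1 by near: y; exact: h.
  by move=> /le_trans; apply; rewrite lerD2r le_max lexx orbT.
pose D := \sum_i (B x (v i) + 1) + 1.
have D0 : 0 < D by rewrite ltr_wpDl// sumr_ge0// => i _; rewrite addr_ge0.
have e3 : 0 < eps / 3 by rewrite divr_gt0.
have main : \forall y \near x, forall t : 'rV[R]_n.+1, K t ->
    `|p y (\sum_i t ord0 i *: v i) - p x (\sum_i t ord0 i *: v i)| <= eps.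
  have /compact_near_coveringP cov := cK.
  apply: (cov _ (nbhs x) (fun y t => `|p y (\sum_i t ord0 i *: v i) - p x (\sum_i t ord0 i *: v i)| <= eps)).
  move=> t _; have nt : nbhs t [set s : 'rV[R]_n.+1 |
      forall i, `|t ord0 i - s ord0 i| < eps / 3 / D].
    have nti i : nbhs t [set s : 'rV[R]_n.+1 | `|t ord0 i - s ord0 i| < eps / 3 / D].
      have /cvgrPdist_lt := @coord_continuous R 1 n.+1 ord0 i t; apply.
      by rewrite divr_gt0.
    exact: (@filter_forall _ _ _ _ _ nti).
  near=> s y.
  have h1 : `|p x (\sum_i t ord0 i *: v i) - p y (\sum_i t ord0 i *: v i)| < eps / 3.
    by near: y; exact: p_near.
  have h2 i : `|t ord0 i - s ord0 i| <= eps / 3 / D.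
    by rewrite ltW//; move: i; near: s.
  have h3 i : B y (v i) <= B x (v i) + 1 by move: i; near: y; exact: nb.
  have h4 z : (forall i, B z (v i) <= B x (v i) + 1) ->
     \sum_i `|t ord0 i - s ord0 i| * B z (v i) <= eps / 3.
    move=> hz; apply: (@le_trans _ _ (\sum_i (eps / 3 / D) * (B x (v i) + 1))).
      by apply: ler_sum => i _; apply: ler_pM.
    rewrite -mulr_sumr mulrAC ler_pdivrMr// ler_wpM2l ?(ltW e3)// /D lerDl//.
  have := p_sum_dist y _ v (fun i => t ord0 i) (fun i => s ord0 i).
  have := p_sum_dist x _ v (fun i => t ord0 i) (fun i => s ord0 i).
  have := h4 y h3; have /h4 : forall i, B x (v i) <= B x (v i) + 1 by move=> i; rewrite lerDl.
  move: h1; rewrite !ltr_norml !ler_norml.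
  by move=> /andP[? ?] ? ? /andP[? ?] /andP[? ?]; apply/andP; split; lra.
near=> y => t; have [S0|S0] := eqVneq (\sum_i `|t i|) 0.
  have t0 i : t i = 0.
    apply/normr0_eq0/eqP; move/eqP: S0; rewrite psumr_eq0// => /allP /(_ i).
    by rewrite mem_index_enum => /(_ isT).
  by rewrite !big1 ?(sublin0 _ _ _ (hsub _)) ?subrr ?normr0 ?mulr0// => i _; rewrite t0 ?normr0 ?scale0r.
set S := \sum_i _ in S0 *.
have Sp : 0 < S by rewrite lt_neqAle eq_sym S0 sumr_ge0.
have KS : K (\row_i (t i / S)).
  move=> i; rewrite /= mxE in_itv/= -ler_norml normrM normfV (gtr0_norm Sp).
  by rewrite ler_pdivrMr// mul1r /S (bigD1 i)//= lerDl sumr_ge0.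
have mainy : forall t : 'rV[R]_n.+1, K t ->
    `|p y (\sum_i t ord0 i *: v i) - p x (\sum_i t ord0 i *: v i)| <= eps.
  by near: y; exact: main.
have := mainy _ KS.
have -> : \sum_i (\row_j (t j / S)) ord0 i *: v i = S^-1 *: \sum_i t i *: v i.
  by rewrite scaler_sumr; apply: eq_bigr => i _; rewrite mxE scalerA mulrC.
rewrite !(hsub _).2 ?invr_ge0 ?(ltW Sp)// -mulrBr normrM normfV (gtr0_norm Sp) mulrC.
by rewrite ler_pdivrMr.
Unshelve. all: by end_near. Qed.

(* The correction [c * w] leaves room for [f] to be only [c]-faithful at [x]:
   what remains of [f] is then dominated by [p y] up to [eps]. *)
Lemma faithful_state_lift x c f n (v : 'I_n -> V) (eps : R) :
  0 <= c < 1 -> faithful_state x c f -> 0 < eps ->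
  \forall y \near x, forall w, state y w ->
    exists2 g, state y g & forall i, `|(1 - c) * g (v i) + c * w (v i) - f (v i)| <= eps.
Proof.
move=> /andP[c0 c1] [lf hf] e0; near=> y => w sw.
have c1' : 0 < 1 - c by lra.
have [||t|g [lg gp gv]] := hahn_banach_approx R V (p y) n v
   (fun i => (f (v i) - c * w (v i)) / (1 - c)) (eps / (1 - c)).
- exact: hsub.
- by rewrite divr_ge0 ?(ltW e0)// ltW.
- have -> : \sum_i t i * ((f (v i) - c * w (v i)) / (1 - c)) =
     (f (\sum_i t i *: v i) - c * w (\sum_i t i *: v i)) / (1 - c).
    rewrite (linfn_sum _ _ _ _ _ _ lf) (linfn_sum _ _ _ _ _ _ sw.1) mulr_sumr -sumrB mulr_suml.
    by apply: eq_bigr => i _; ring.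
  rewrite ler_pdivrMr// [X in _ <= X](_ : _ =
     p y (\sum_i t i *: v i) * (1 - c) + eps * \sum_i `|t i|); last first.
    by field; rewrite gt_eqF.
  set u := \sum_i _; set T := \sum_i `|_|.
  have eqc : forall t : 'I_n -> R,
    `|p y (\sum_i t i *: v i) - p x (\sum_i t i *: v i)| <= eps * \sum_i `|t i|.
    by near: y; exact: p_equicontinuous.
  have := eqc t; rewrite -/u -/T ler_norml => /andP[h1 _].
  have := eqc (fun i => - t i).
  have -> : \sum_i - t i *: v i = - u.
    by rewrite /u -sumrN; apply: eq_bigr => i _; rewrite scaleNr.
  have -> : \sum_i `|- t i| = T by apply: eq_bigr => i _; rewrite normrN.
  rewrite ler_norml => /andP[_ h2].
  (* Since [w u >= - p y (- u)], subtracting [c * w u] cancels the term [- c * p x (- u)] in the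
     bound on [f u], leaving [(1 - c) * p x u] up to the equicontinuity error. *)
  have := hf u; rewrite /width; have := state_ge _ _ u sw.
  move: h1 h2; set z := eps * T; move: (f u) (w u) (p x u) (p x (- u)) (p y u) (p y (- u)).
  by move=> F W P1 P2 Q1 Q2 *; nra.
- exists g => // i; have := gv i; rewrite ler_pdivlMr//.
  rewrite -[X in _ * X](gtr0_norm c1') -normrM mulrBl divfK ?gt_eqF//.
  by congr (`|_| <= _); ring.
Unshelve. all: by end_near. Qed.

End StateFields.

(** * The rank of the space spanned by the states *)

Section StateRank.
Variables (R : realType) (X : topologicalType) (V : lmodType R) (e : V) (p : X -> V -> R).
Hypothesis hsub : forall x, sublin R V (p x).
Hypothesis he : forall x, p x e = 1.
Hypothesis heN : forall x, p x (- e) = -1.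
Hypothesis hcont : forall v, continuous (fun x => p x v : R^o).
Implicit Types (x y : X) (f : V -> R) (c : R).

Local Notation state := (state R X V p).
Local Notation faithful_state := (faithful_state R X V p).

Definition gram {k} (chi : 'I_k -> V -> R) (b : 'I_k -> V) : 'M[R]_k :=
  \matrix_(i, j) chi i (b j).

Definition independent_at x k (b : 'I_k -> V) :=
  exists2 chi : 'I_k -> V -> R, (forall i, state x (chi i)) & \det (gram chi b) != 0.

(* The space spanned by the states at [x] has dimension at least [k]. *)
Definition rank_ge x k := exists b : 'I_k -> V, independent_at x k b.

Lemma rank_ge0 x : rank_ge x 0.
Proof.
exists (fun=> 0), (fun=> fun=> 0) => [[]//|].
by rewrite det_mx00 oner_neq0.
Qed.

Lemma independent_bound x k (b : 'I_k -> V) : independent_at x k b ->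
  exists2 C, 0 < C & forall t : 'I_k -> R, \sum_j `|t j| <=
    C * Num.max (p x (\sum_j t j *: b j)) (p x (- \sum_j t j *: b j)).
Proof.
move=> [chi schi dchi]; have [C C0 hC] := unitmx_sum_bound _ _ _ dchi.
exists (C * (k%:R + 1)) => [|t]; first by rewrite mulr_gt0// ltr_wpDl.
apply: (le_trans (hC t)); rewrite -mulrA ler_pM2l//.
set m := Num.max _ _.
have hm i : `|\sum_j gram chi b i j * t j| <= m.
  have -> : \sum_j gram chi b i j * t j = chi i (\sum_j t j *: b j).
    rewrite (linfn_sum _ _ _ _ _ _ (schi i).1); apply: eq_bigr => j _.
    by rewrite mxE mulrC.
  exact: (state_norm _ _ _ _ _ _ _ (schi i)).
have m0 : 0 <= m by exact: p_max_ge0.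
apply: (@le_trans _ _ (\sum_(i < k) m)); first exact: ler_sum.
by rewrite sum_ord_const ler_wpM2r// lerDl.
Qed.

(** Lower semicontinuity of the rank: the states [chi i] are approximated on [b] by states at [y],
    and invertibility of the matrix survives the perturbation. The choice of [eps] turns a kernel
    vector into [T <= T / 2]. *)
Lemma independent_near x k (b : 'I_k -> V) : independent_at x k b ->
  \forall y \near x, independent_at y k b.
Proof.
move=> [chi schi dchi]; have [C C0 hC] := unitmx_sum_bound _ _ _ dchi.
pose eps := (C * (k%:R + 1) * 2)^-1.
have D0 : 0 < C * (k%:R + 1) * 2 by rewrite !mulr_gt0// ltr_wpDl.
have e0 : 0 < eps by rewrite invr_gt0.
have near_i : \forall y \near x, forall i, forall w, state y w ->
    exists2 g, state y g & forall j, `|(1 - 0) * g (b j) + 0 * w (b j) - chi i (b j)| <= eps.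
  apply: filter_forall => i; apply: faithful_state_lift => //; first by rewrite lexx ltr01.
  exact: state_faithful_state.
near=> y.
have [w sw _] := state_attains _ _ _ _ hsub y 0.
have hy : forall i, exists g, state y g /\ forall j, `|g (b j) - chi i (b j)| <= eps.
  have near_y : forall i w, state y w -> exists2 g, state y g &
      forall j, `|(1 - 0) * g (b j) + 0 * w (b j) - chi i (b j)| <= eps.
    by near: y; exact: near_i.
  move=> i; have [g sg hg] := near_y i w sw.
  by exists g; split=> // j; have := hg j; rewrite subr0 mul1r mul0r addr0.
have [chi' hchi'] := choice hy.
exists chi' => [i|]; first exact: (hchi' i).1.
apply: det_neq0_of_injective => t ht.
suff T0 : \sum_j `|t j| <= 0.
  move=> j; apply/normr0_eq0/le_anti; rewrite normr_ge0 andbT.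
  by apply: le_trans T0; rewrite (bigD1 j)//= lerDl sumr_ge0.
set T := \sum_j `|t j|.
have T0 : 0 <= T by exact: sumr_ge0.
have row i : `|\sum_j gram chi b i j * t j| <= eps * T.
  have -> : \sum_j gram chi b i j * t j = \sum_j (gram chi b i j - gram chi' b i j) * t j.
    by under [RHS]eq_bigr do rewrite mulrBl; rewrite sumrB ht subr0.
  rewrite (le_trans (ler_norm_sum _ _ _))// mulr_sumr; apply: ler_sum => j _.
  rewrite normrM ler_wpM2r//.
  by rewrite !mxE distrC (hchi' i).2.
have : T <= C * (k%:R * (eps * T)).
  rewrite (le_trans (hC t))// ler_pM2l//.
  apply: (@le_trans _ _ (\sum_(i < k) eps * T)); first exact: ler_sum.
  by rewrite sum_ord_const.
have -> : C * (k%:R * (eps * T)) = C * k%:R * eps * T by ring.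
have : C * k%:R * eps <= 2^-1.
  rewrite /eps ler_pdivrMr// -[_ * 2]mulrC mulKf//.
  by rewrite ler_pM2l// lerDl.
by move=> h1 h2; nra.
Unshelve. all: by end_near. Qed.

(** Subtract from [v] the combination of the [b j] with the same values under all [chi i]. A state
    not vanishing on the difference would extend the matrix to an invertible block triangular one of
    size [k + 1]. *)
Lemma states_spanned x k (b : 'I_k -> V) v : independent_at x k b -> ~ rank_ge x (k + 1) ->
  exists t : 'I_k -> R, forall f, state x f -> f v = \sum_j t j * f (b j).
Proof.
move=> [chi schi dchi] nr.
have uM : gram chi b \in unitmx by rewrite unitmxE unitfE.
pose tt : 'cV[R]_k := invmx (gram chi b) *m \col_i chi i v.
exists (fun j => tt j 0) => f sf; apply: contrapT => fv; apply: nr.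
pose v' := v - \sum_j tt j 0 *: b j.
have val g : linfn R V g -> g v' = g v - \sum_j tt j 0 * g (b j).
  by move=> lg; rewrite /v' (linfnB _ _ _ _ _ lg) (linfn_sum _ _ _ _ _ _ lg).
have chiv' i : chi i v' = 0.
  rewrite val; last exact: (schi i).1.
  have := congr1 (fun A : 'cV[R]_k => A i 0) (mulKVmx uM (\col_i chi i v)).
  rewrite /= -/tt !mxE => <-; apply/eqP; rewrite subr_eq0; apply/eqP.
  by apply: eq_bigr => j _; rewrite mxE mulrC.
pose b' (j : 'I_(k + 1)) := match fintype.split j with inl j => b j | inr _ => v' end.
pose chi' (j : 'I_(k + 1)) := match fintype.split j with inl j => chi j | inr _ => f end.
exists b', chi' => [i|]; first by rewrite /chi'; case: splitP.
have -> : gram chi' b' = block_mx (gram chi b) 0 (\matrix_(i, j) f (b j)) (\matrix_(i, j) f v').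
  rewrite -[LHS]submxK; congr block_mx; apply/matrixP => i j; rewrite !mxE /chi' /b'.
  - by rewrite !(unsplitK (inl _)).
  - by rewrite (unsplitK (inl i)) (unsplitK (inr j)) chiv'.
  - by rewrite (unsplitK (inr i)) (unsplitK (inl j)).
  - by rewrite (unsplitK (inr i)) (unsplitK (inr j)).
rewrite det_lblock mulf_neq0// det_mx11 mxE val ?subr_eq0; last exact: sf.1.
exact/eqP.
Qed.

Lemma p_state_eq x u v : (forall f, state x f -> f u = f v) -> p x u = p x v.
Proof.
have le u' v' : (forall f, state x f -> f u' = f v') -> p x u' <= p x v'.
  by move=> h; have [f sf <-] := state_attains _ _ _ _ hsub x u'; rewrite h// sf.2.
by move=> h; apply/le_anti; rewrite !le// => f /h.
Qed.

(* Choosing states with nearly maximal determinant on [b] bounds the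
   barycentric coordinates of every other state by 2 (Cramer), so that the
   average of the chosen states dominates each state on positive elements. *)
Lemma faithful_state_exists x k : rank_ge x k -> ~ rank_ge x (k + 1) ->
  (0 < k)%N /\ exists f, faithful_state x (2 * k%:R)^-1 f.
Proof.
move=> [b ib] nr.
(* Rank 0 would make every state vanish at [e], where states take the value 1. *)
have [|k0] := posnP k.
  move=> k0; have [f sf fe] := state_attains _ _ _ _ hsub x e.
  have [t ht] := states_spanned _ _ _ e ib nr.
  have := ht f sf; rewrite fe he; move: (t) (b); rewrite k0 => ? ?.
  by rewrite big_ord0 => /eqP; rewrite oner_eq0.
split=> //.
pose D := [set d | exists2 chi : 'I_k -> V -> R, (forall i, state x (chi i)) & d = `|\det (gram chi b)|].
have Dub : has_ubound D.
  exists (\sum_(s : 'S_k) \prod_i Num.max (p x (b (s i))) (p x (- b (s i)))) => _ [chi schi ->].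
  rewrite (le_trans (ler_norm_sum _ _ _))//; apply: ler_sum => s _.
  rewrite normrM normrX normrN1 expr1n mul1r normr_prod; apply: ler_prod => i _.
  by rewrite normr_ge0 mxE (state_norm _ _ _ _ _ _ _ (schi i)).
have [chi0 schi0 dchi0] := ib.
have Dsup : has_sup D by split=> //; exists (`|\det (gram chi0 b)|), chi0.
have S0 : 0 < sup D.
  apply: (@lt_le_trans _ _ `|\det (gram chi0 b)|); first by rewrite normr_gt0.
  by apply: ub_le_sup => //; exists chi0.
(* A determinant above half the supremum is taken instead of a maximal one; this half is the origin
   of the 2 in the constant, and the [k] comes from averaging. *)
have [d [chi schi ->] hd] := sup_adherent (divr_gt0 S0 (ltr0Sn _ 1)) Dsup.
have hdet : sup D < 2 * `|\det (gram chi b)| by lra.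
have dchi : \det (gram chi b) != 0 by rewrite -normr_gt0; lra.
have uM : gram chi b \in unitmx by rewrite unitmxE unitfE.
have coord f : state x f -> exists2 s : 'I_k -> R, (forall i, `|s i| <= 2) &
    forall v, f v = \sum_i s i * chi i v.
  move=> sf; pose r : 'rV[R]_k := \row_j f (b j).
  pose s := r *m invmx (gram chi b).
  exists (fun i => s 0 i) => [i|v].
    pose chi' l := if l == i then f else chi l.
    have schi' l : state x (chi' l) by rewrite /chi'; case: eqP.
    have e1 : s 0 i * \det (gram chi b) = \det (gram chi' b).
      rewrite [RHS](expand_det_row _ i) /s /invmx uM -scalemxAr mxE mulrC mulVKf ?mulfV//.
      rewrite ?mxE; apply: eq_bigr => j _; rewrite !mxE /chi' eqxx; congr (_ * _).
      rewrite /cofactor; congr (_ * \det _); apply/matrixP => a c; rewrite !mxE.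
      by rewrite eq_sym (negbTE (neq_lift _ _)).
    have : `|\det (gram chi' b)| <= sup D by apply: ub_le_sup => //; exists chi'.
    rewrite -e1 normrM => h; have d0 : 0 < `|\det (gram chi b)| by rewrite normr_gt0.
    by rewrite -(ler_pM2r d0); lra.
  have ichi : independent_at x k b by exists chi.
  have [t ht] := states_spanned _ _ _ v ichi nr.
  rewrite (ht f sf).
  under [RHS]eq_bigr do rewrite (ht _ (schi _)) mulr_sumr.
  rewrite exchange_big/=; apply: eq_bigr => j _.
  under eq_bigr do rewrite mulrCA; rewrite -mulr_sumr; congr (_ * _).
  have := congr1 (fun A : 'rV[R]_k => A 0 j) (mulmxKV uM r).
  by rewrite /= -/s mxE [r 0 j]mxE => <-; apply: eq_bigr => i _; congr (_ * _); rewrite mxE.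
pose w v := k%:R^-1 * \sum_i chi i v.
have kp : 0 < k%:R :> R by rewrite ltr0n.
have sw : state x w.
  split=> [|v].
    split=> [u v|a v]; rewrite /w.
      by rewrite -mulrDr -big_split; congr (_ * _); apply: eq_bigr => i _; rewrite (schi i).1.1.
    rewrite mulrCA; congr (_ * _); rewrite mulr_sumr.
    by apply: eq_bigr => i _; rewrite (schi i).1.2.
  rewrite /w mulrC ler_pdivrMr//; apply: (@le_trans _ _ (\sum_(i < k) p x v)).
    by apply: ler_sum => i _; exact: (schi i).2.
  by rewrite sum_ord_const mulrC.
exists w; apply/(faithful_stateP _ _ _ _ _ hsub he heN) => //.
  rewrite invr_ge0 mulr_ge0 ?ler0n//= invf_le1 ?mulr_gt0//.
  have : 1 <= k%:R :> R by rewrite ler1n.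
  by lra.
move=> g g0; rewrite mulrC ler_pdivrMr ?mulr_gt0//.
have [f sf <-] := state_attains _ _ _ _ hsub x g.
have [s s2 ->] := coord f sf.
have -> : w g * (2 * k%:R) = \sum_i 2 * chi i g.
  by rewrite /w -mulr_sumr; field; rewrite gt_eqF.
apply: ler_sum => i _; apply: ler_wpM2r.
  by have := state_ge _ _ _ _ _ _ g (schi i); lra.
exact: le_trans (ler_norm _) (s2 i).
Qed.

(** Lifting alone loses faithfulness. At points [y] of rank at most [k], however, a state is
    determined by its values on [b], so an approximation there controls it on all vectors. Moving
    [f] slightly towards the more faithful [w] first gives a margin that absorbs the error. *)
Lemma faithful_state_lift_rank x k (b : 'I_k -> V) (c d : R) f w n (v : 'I_n -> V) (eps : R) :
  independent_at x k b -> 0 <= c -> c < d -> d <= 1 ->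
  faithful_state x c f -> faithful_state x d w -> 0 < eps ->
  \forall y \near x, ~ rank_ge y (k + 1) ->
    exists2 g, faithful_state y c g & forall i, `|g (v i) - f (v i)| <= eps.
Proof.
move=> ib c0 cd d1 hf hw e0.
have sf : state x f by exact: faithful_state_state hf.
have swx : state x w by apply: faithful_state_state hw => //; lra.
have [C C0 hC] := independent_bound _ _ _ ib.
pose D := \sum_i 2 * Num.max (p x (v i)) (p x (- v i)) + 1.
have Bi i : 0 <= Num.max (p x (v i)) (p x (- v i)).
  by rewrite (le_trans (normr_ge0 _) (state_norm _ _ _ _ _ _ (v i) sf)).
have D0 : 0 < D by rewrite ltr_wpDl// sumr_ge0// => i _; rewrite mulr_ge0.
pose s := Num.min 1 (eps / 2 / D).
have s0 : 0 < s by rewrite lt_min ltr01 !divr_gt0.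
have s1 : s <= 1 by rewrite ge_min lexx.
have sD : s * D <= eps / 2 by rewrite -ler_pdivlMr// ge_min lexx orbT.
pose f' u := (1 - s) * f u + s * w u.
have hf' : faithful_state x ((1 - s) * c + s * d) f'.
  by apply: faithful_state_comb => //; rewrite (ltW s0).
set c' := (1 - s) * c + s * d in hf'.
have cc' : c < c' by rewrite /c'; nra.
have c'1 : c' <= 1 by rewrite /c'; nra.
have c'0 : 0 <= c' by lra.
have sf' : state x f' by exact: faithful_state_state c'0 hf'.
(* The first bound keeps [g] near [f] on the [v i], the second lets [p y a] control the coefficients
   of [a] ([TC]), the third fits the total error [3 * eta * T] into the margin [c' - c] ([fin]). *)
pose eta := Num.min (eps / 2) (Num.min (2 * C)^-1 ((c' - c) / (6 * C))).
have eta0 : 0 < eta by rewrite !lt_min !divr_gt0 ?invr_gt0 ?mulr_gt0// subr_gt0.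
have eta1 : eta <= eps / 2 by rewrite ge_min lexx.
have eta2 : eta * C <= 2^-1.
  have : eta <= (2 * C)^-1 by rewrite /eta !ge_min lexx !orbT.
  by move=> /(ler_wpM2r (ltW C0)); rewrite invfM divfK ?gt_eqF.
have eta3 : 6 * eta * C <= c' - c.
  have : eta <= (c' - c) / (6 * C) by rewrite /eta !ge_min lexx !orbT.
  by rewrite ler_pdivlMr ?mulr_gt0//; lra.
near=> y => nr.
have [w' sw' _] := state_attains _ _ _ _ hsub y 0.
pose u (i : 'I_(n + k)) := match fintype.split i with inl i => v i | inr j => b j end.
have [g sg hg] : exists2 g, state y g & forall i,
    `|(1 - 0) * g (u i) + 0 * w' (u i) - f' (u i)| <= eta.
  move: w' sw'; near: y.
  apply: (faithful_state_lift _ _ _ _ hsub hcont _ 0 f') => //.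
  - by rewrite lexx ltr01.
  - exact: state_faithful_state.
have {hg} hg i : `|g (u i) - f' (u i)| <= eta.
  by have := hg i; rewrite subr0 mul1r mul0r addr0.
have iby : independent_at y k b by near: y; exact: independent_near.
have eqc : forall t : 'I_k -> R,
    `|p y (\sum_i t i *: b i) - p x (\sum_i t i *: b i)| <= eta * \sum_i `|t i|.
  by near: y; exact: p_equicontinuous.
exists g; last first.
  move=> i; have := hg (lshift k i); rewrite /u (unsplitK (inl i)) => h1.
  have : `|f' (v i) - f (v i)| <= eps / 2.
    have -> : f' (v i) - f (v i) = s * (w (v i) - f (v i)) by rewrite /f'; ring.
    rewrite normrM (gtr0_norm s0) (le_trans _ sD)// ler_pM2l//.
    rewrite (le_trans (ler_normB _ _))//.
    have := state_norm _ _ _ _ _ _ (v i) sf; have := state_norm _ _ _ _ _ _ (v i) swx.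
    have : 2 * Num.max (p x (v i)) (p x (- v i)) <= D - 1.
      by rewrite /D addrK (bigD1 i)//= lerDl sumr_ge0// => j _; rewrite mulr_ge0.
    by lra.
  move: h1; rewrite !ler_norml => /andP[? ?] /andP[? ?].
  by apply/andP; split; lra.
apply/(faithful_stateP _ _ _ _ _ hsub he heN) => //; first by apply/andP; split; lra.
move=> h h0; have [t ht] := states_spanned _ _ _ h iby nr.
pose a := \sum_j t j *: b j; pose T := \sum_j `|t j|.
have T0 : 0 <= T by exact: sumr_ge0.
have pa : p y h = p y a.
  by apply: p_state_eq => q sq; rewrite (ht q sq) /a (linfn_sum _ _ _ _ _ _ sq.1).
have pNa : p y (- h) = p y (- a).
  apply: p_state_eq => q sq.
  by rewrite !(linfnN _ _ _ _ sq.1) (ht q sq) /a (linfn_sum _ _ _ _ _ _ sq.1).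
rewrite pa (ht g sg).
have ga : `|\sum_j t j * g (b j) - f' a| <= eta * T.
  rewrite /a (linfn_sum _ _ _ _ _ _ sf'.1) -sumrB (le_trans (ler_norm_sum _ _ _))//.
  rewrite mulr_sumr; apply: ler_sum => j _; rewrite -mulrBr normrM mulrC ler_wpM2r//.
  by have := hg (rshift n j); rewrite /u (unsplitK (inr j)).
have q1 := eqc t; rewrite -/a -/T in q1.
have q2 := eqc (fun j => - t j).
have eN : \sum_j - t j *: b j = - a.
  by rewrite /a -sumrN; apply: eq_bigr => j _; rewrite scaleNr.
have eT : \sum_j `|- t j| = T by apply: eq_bigr => j _; rewrite normrN.
rewrite eN eT in q2.
have hfa := hf'.2 (- a).
rewrite (linfnN _ _ _ _ sf'.1) /width opprK in hfa.
have hT := hC t; rewrite -/a -/T in hT.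
rewrite pNa in h0.
have pya0 : 0 <= p y a.
  by have := sublinN_ge _ _ _ a (hsub y); lra.
have TC : T <= 2 * C * p y a.
  have m1 : Num.max (p x a) (p x (- a)) <= p y a + eta * T.
    move: q1 q2; rewrite !ler_norml => /andP[? ?] /andP[? ?].
    by rewrite ge_max; apply/andP; split; lra.
  have : T <= C * (p y a + eta * T) by rewrite (le_trans hT)// ler_pM2l.
  by move: T0 eta2; nra.
have fin : 3 * (eta * T) <= (c' - c) * p y a.
  have : 3 * eta * T <= 3 * eta * (2 * C * p y a) by rewrite ler_pM2l ?mulr_gt0.
  have : 6 * eta * C * p y a <= (c' - c) * p y a by rewrite ler_wpM2r.
  by lra.
move: ga q1 q2; rewrite !ler_norml => /andP[g1 g2] /andP[q11 q12] /andP[q21 q22].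
have z0 : 0 <= eta * T by rewrite mulr_ge0// ltW.
move: fin g1 g2 q11 q12 q21 q22 hfa h0 z0.
set z := eta * T; set G := \sum_j _.
move: (f' a) (p x a) (p x (- a)) (p y a) (p y (- a)) => F P1 P2 Q1 Q2 *.
have : c' * (Q1 - z) <= c' * P1 by rewrite ler_wpM2l//; lra.
have : (1 - c') * P2 <= (1 - c') * z by rewrite ler_wpM2l//; lra.
have : c' * z <= z by rewrite ler_piMl.
by lra.
Unshelve. all: by end_near. Qed.

End StateRank.

(** * Countable bases, boundedness and ultrafilter limits *)

Section TopologyFacts.
Variable R : realType.

Lemma countable_nbhs_basis (X : pseudoMetricType R) (x0 : X) : compact [set: X] ->
  exists U : nat -> set X, forall x W, nbhs x W -> exists n, U n x /\ U n `<=` W.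
Proof.
move=> cX; pose T : pseudoPMetricType R := HB.pack X (isPointed.Build X x0).
have [B cB [Bo Bb]] := @compact_second_countable R T cX.
have [B0|/unsquash f] : B = set0 \/ $|{surjfun [set: nat] >-> B}| by exact/pfcard_geP.
  by have [U [+ _] _] := Bb x0 setT filterT; rewrite B0.
exists (fun n => f n) => x W /(Bb x W)[U [BU Ux] UW].
have [n _ fn] := @surj _ _ _ _ f _ BU.
by exists n; rewrite fn.
Qed.

Lemma continuous_compact_bounded (X : topologicalType) (f : X -> R^o) :
  compact [set: X] -> continuous f -> exists2 M : R, 0 < M & forall x, `|f x| <= M.
Proof.
move=> cX cf; have : compact (f @` setT).
  by apply: continuous_compact => //; exact: continuous_subspaceT.
move=> /compact_bounded /pinfty_ex_gt0[M M0 hM]; exists M => // x.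
by apply: hM; exists x.
Qed.

Lemma ultra_limit (T : Type) (F : set_system T) (f : T -> R) (b : R) :
  UltraFilter F -> F [set t | `|f t| <= b] ->
  exists l, forall eps : R, 0 < eps -> F [set t | `|f t - l| < eps].
Proof.
move=> UF Fb; have PF : ProperFilter F by exact: ultra_proper.
have : (f @ F) `[- b, b]%classic.
  apply: filterS Fb => t /= h; rewrite in_itv/=; rewrite -ler_norml; exact: h.
move=> /(segment_compact (fmap_proper_filter f PF)) [l [_ cl]].
exists l => eps e0; have [//|Fn] := in_ultra_setVsetC [set t | `|f t - l| < eps] UF.
have : nbhs l (ball l eps) by exact: nbhsx_ballx.
have Fn' : (f @ F) [set z | ~ (`|z - l| < eps)] by [].
move=> /(cl _ _ Fn')[z [/= zl]].
by rewrite /ball/= distrC.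
Qed.

End TopologyFacts.

(** * Weighted sums of bounded sequences *)

Section WeightedSum.
Variable R : realType.
Implicit Types (c d : nat -> R).

Definition wsum c : R := limn (series (fun n => c n * (4^-1) ^+ n) : nat -> R^o).

Lemma is_cvg_wsum c : (forall n, 0 <= c n <= 4) ->
  cvgn (series (fun n => c n * (4^-1) ^+ n) : nat -> R^o).
Proof.
move=> hc; have q : `|4^-1| < 1 :> R by rewrite ger0_norm//; lra.
have e0 n : 0 <= (4^-1) ^+ n :> R by rewrite exprn_ge0.
apply: (series_le_cvg _ _ _ (is_cvg_geometric_series (a := 4) q)) => n /=.
- by have /andP[? _] := hc n; rewrite mulr_ge0.
- by rewrite mulr_ge0.
- by have /andP[_ ?] := hc n; rewrite ler_wpM2r.
Qed.

Lemma wsumD c d : (forall n, 0 <= c n <= 4) -> (forall n, 0 <= d n <= 4) ->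
  wsum (fun n => c n + d n) = wsum c + wsum d.
Proof.
move=> hc hd; rewrite /wsum.
have -> : series (fun n => (c n + d n) * (4^-1) ^+ n) =
    series (fun n => c n * (4^-1) ^+ n) \+ series (fun n => d n * (4^-1) ^+ n).
  by apply/funext => n; rewrite /series/= -big_split; apply: eq_bigr => i _; rewrite mulrDl.
by apply/cvg_lim => //; apply: cvgD; exact: is_cvg_wsum.
Qed.

Lemma wsum_dist c d (eta : R) : (forall n, 0 <= c n <= 4) -> (forall n, 0 <= d n <= 4) ->
  (forall n, c n * (4^-1) ^+ n <= d n * (4^-1) ^+ n + eta * (2^-1) ^+ n) ->
  wsum c <= wsum d + 2 * eta.
Proof.
move=> hc hd h; have q : `|2^-1| < 1 :> R by rewrite ger0_norm//; lra.
have cg : series (geometric eta 2^-1) @ \oo --> (2 * eta : R^o).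
  by have := cvg_geometric_series (a := eta) q; rewrite (_ : eta / (1 - 2^-1) = 2 * eta)//; field.
have -> : wsum d + 2 * eta = limn (series (fun n => d n * (4^-1) ^+ n) \+ series (geometric eta 2^-1) : nat -> R^o).
  by apply/esym/cvg_lim => //; apply: cvgD => //; exact: is_cvg_wsum.
apply: ler_lim; first exact: is_cvg_wsum.
  by apply: is_cvgD; [exact: is_cvg_wsum|apply/cvg_ex; exists (2 * eta)].
near=> n; rewrite /series/= -big_split; apply: ler_sum => i _ /=; exact: h.
Unshelve. all: by end_near. Qed.

Lemma wsum_ge_term c n : (forall n, 0 <= c n <= 4) -> c n * (4^-1) ^+ n <= wsum c.
Proof.
move=> hc; have e0 i : 0 <= c i * (4^-1) ^+ i.
  by have /andP[? _] := hc i; rewrite mulr_ge0// exprn_ge0.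
have : series (fun i => c i * (4^-1) ^+ i) n.+1 <= wsum c.
  apply: nondecreasing_cvgn_le; last exact: is_cvg_wsum.
  by apply: nondecreasing_series => i _ _.
apply: le_trans; rewrite /series/= big_nat_recr//= lerDr sumr_ge0//.
Qed.

Lemma wsum_ge0 c : (forall n, 0 <= c n <= 4) -> 0 <= wsum c.
Proof.
move=> hc; apply: le_trans (wsum_ge_term c 0 hc).
by have /andP[? _] := hc 0; rewrite mulr1.
Qed.

Lemma wsum_near (eps : R) : 0 < eps -> exists m : nat, exists2 delta : R, 0 < delta &
  forall c d, (forall n, 0 <= c n <= 4) -> (forall n, 0 <= d n <= 4) ->
    (forall n, (n < m)%N -> `|c n - d n| <= delta) -> wsum c <= wsum d + eps.
Proof.
(* Perturbations are measured against [2^-n]: for [n > m] the spare factor [2^-n] of the weight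
   [4^-n] is at most [eps / 16], and each coefficient is at most 4. *)
move=> e0; pose m := Num.truncn (16 / eps); exists m.+1, (eps / 4); first lra.
move=> c d hc hd h; rewrite (le_trans (wsum_dist c d (eps / 2) hc hd _))//; last lra.
move=> n; have p2 : 0 < (2^-1) ^+ n :> R by rewrite exprn_gt0.
have e4 : (4^-1) ^+ n = (2^-1) ^+ n * (2^-1) ^+ n :> R.
  by rewrite -exprMn; congr (_ ^+ _); field.
have le1 : (2^-1) ^+ n <= 1 :> R by rewrite exprn_ile1//; lra.
rewrite -lerBlDl -mulrBl e4 mulrA ler_pM2r//.
have [nm|nm] := ltnP n m.+1.
  have := h n nm; rewrite ler_norml => /andP[_ h2].
  by have [cd|cd] := leP 0 (c n - d n); nra.
have : (2^-1) ^+ n <= (16 / eps)^-1.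
  rewrite exprVn lef_pV2 ?posrE ?exprn_gt0 ?divr_gt0//.
  rewrite (le_trans (ltW (truncnS_gt _)))// -natrX ler_nat.
  by rewrite (leq_trans nm)// ltnW// ltn_expl.
rewrite invf_div => h1; have /andP[? ?] := hc n; have /andP[? ?] := hd n.
by nra.
Qed.

End WeightedSum.

(** * Limits of states along ultrafilters *)

Section StateLimits.
Variables (R : realType) (X : topologicalType) (V : lmodType R) (e : V) (p : X -> V -> R).
Hypothesis hsub : forall x, sublin R V (p x).
Hypothesis hcont : forall v, continuous (fun x => p x v : R^o).
Implicit Types (x y : X) (c : R).

Local Notation state := (state R X V p).
Local Notation faithful_state := (faithful_state R X V p).

(** Weak-* compactness of states and closedness of [c]-faithfulness, jointly in the base point. The
    index type is arbitrary because it serves both for minimizing over functionals at one point and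
    for letting the point vary. *)
Lemma ultra_limit_state (T : Type) (F : set_system T) (y : T -> X) (phi : T -> V -> R) x c :
  UltraFilter F -> (forall W, nbhs x W -> F [set t | W (y t)]) -> 0 <= c -> c <= 1 ->
  F [set t | faithful_state (y t) c (phi t)] ->
  exists2 psi, faithful_state x c psi &
    forall v (eps : R), 0 < eps -> F [set t | `|phi t v - psi v| < eps].
Proof.
move=> UF Fx c0 c1 Fphi; have PF : ProperFilter F by exact: ultra_proper.
have p_le v (eps : R) : 0 < eps -> F [set t | `|p x v - p (y t) v| < eps].
  by move=> e0; apply: (Fx [set z | `|p x v - p z v| < eps]); exact: p_near.
have lim v : exists l, forall eps : R, 0 < eps -> F [set t | `|phi t v - l| < eps].
  apply: (ultra_limit _ _ _ (fun t => phi t v) (Num.max (p x v) (p x (- v)) + 1) UF).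
  apply: filterS (filterI Fphi (filterI (p_le v 1 ltr01) (p_le (- v) 1 ltr01))).
  move=> t [hphi /= [h1 h2]].
  have := state_norm _ _ _ _ _ _ v (faithful_state_state _ _ _ _ hsub _ _ _ c0 hphi).
  move=> /le_trans; apply; move: h1 h2; rewrite !ltr_norml => /andP[? ?] /andP[? ?].
  rewrite ge_max; apply/andP; split.
    by apply: (@le_trans _ _ (p x v + 1)); [lra|rewrite lerD2r le_max lexx].
  by apply: (@le_trans _ _ (p x (- v) + 1)); [lra|rewrite lerD2r le_max lexx orbT].
have [psi hpsi] := choice lim.
exists psi => //; split=> [|v]; last first.
  apply/ler_addgt0Pl => eps e0; have [d d0 ed] : exists2 d, 0 < d & eps = 8 * d.
    by exists (eps / 8); [rewrite divr_gt0|field].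
  have [t [[[/= h1 h2] h3] h4]] := filter_ex
    (filterI (filterI (filterI (hpsi v d d0) (p_le v d d0)) (p_le (- v) d d0)) Fphi).
  have := h4.2 v; rewrite /width.
  move: h1 h2 h3; rewrite !ltr_norml => /andP[? ?] /andP[? ?] /andP[? ?].
  have : c * (p x v + p x (- v) - p (y t) v - p (y t) (- v)) <= c * (2 * d).
    by rewrite ler_wpM2l//; lra.
  have : c * d <= d by rewrite ler_piMl// ltW.
  by rewrite ed; lra.
split=> [u v|a v].
  apply/eqP; rewrite -subr_eq0 -normr_le0; apply/ler_addgt0Pl => eps e0.
  have [d d0 ed] : exists2 d, 0 < d & eps = 8 * d.
    by exists (eps / 8); [rewrite divr_gt0|field].
  have [t [[[/= h1 h2] h3] h4]] := filter_ex
    (filterI (filterI (filterI (hpsi u d d0) (hpsi v d d0)) (hpsi (u + v) d d0)) Fphi).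
  move: h1 h2 h3; rewrite h4.1.1 !ltr_norml ler_norml => /andP[? ?] /andP[? ?] /andP[? ?].
  by apply/andP; split; lra.
apply/eqP; rewrite -subr_eq0 -normr_le0; apply/ler_addgt0Pl => eps e0.
pose d := eps / (`|a| + 1); have a1 : 0 < `|a| + 1 by rewrite ltr_wpDl.
have d0 : 0 < d by rewrite divr_gt0.
have [t [[/= h1 h2] h4]] := filter_ex
    (filterI (filterI (hpsi v d d0) (hpsi (a *: v) d d0)) Fphi).
move: h2; rewrite h4.1.2 => h2.
have -> : psi (a *: v) - a * psi v = a * (phi t v - psi v) - (a * phi t v - psi (a *: v)) by ring.
rewrite addr0 (le_trans (ler_normB _ _))// normrM.
have : `|a| * `|phi t v - psi v| <= `|a| * d by rewrite ler_wpM2l// ltW.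
have : d * (`|a| + 1) = eps by rewrite /d divfK ?gt_eqF.
by lra.
Qed.

End StateLimits.

(** * Selection of faithful states along the strata of the rank *)

Section Selection.
Variables (R : realType) (X : pseudoMetricType R) (V : lmodType R) (e : V) (p : X -> V -> R).
Hypothesis hsub : forall x, sublin R V (p x).
Hypothesis he : forall x, p x e = 1.
Hypothesis heN : forall x, p x (- e) = -1.
Hypothesis hcont : forall v, continuous (fun x => p x v : R^o).
Hypothesis cX : compact [set: X].
Hypothesis hX : hausdorff_space X.
Variable x0 : X.
Variable N : nat.
Hypothesis rank_lt : forall x k, (N <= k)%N -> ~ rank_ge R X V p x k.
Implicit Types (x y : X) (c : R) (f psi : V -> R).

Local Notation state := (state R X V p).
Local Notation faithful_state := (faithful_state R X V p).
Local Notation rank_ge := (rank_ge R X V p).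
Local Notation independent_at := (independent_at R X V p).

Lemma exact_rank x : exists k, [/\ (k < N)%N, rank_ge x k & ~ rank_ge x (k + 1)].
Proof.
have r0 := rank_ge0 R X V p x.
have N0 : (0 < N)%N by rewrite lt0n; apply/eqP => N0; apply: (rank_lt x 0) => //; rewrite N0.
have : exists k, `[< rank_ge x k >] by exists 0%N; apply/asboolP.
move=> ex; have ub k : `[< rank_ge x k >] -> (k <= N)%N.
  by move=> /asboolP rk; rewrite leqNgt; apply/negP => /ltnW /(rank_lt x).
have [k /asboolP rk kmax] := ex_maxnP ex ub.
exists k; split=> //; first by rewrite ltnNge; apply/negP => /(rank_lt x).
by move=> /asboolP /kmax; rewrite addn1 ltnn.
Qed.

(** Uniform lower bound for the constants [(2 k)^-1] of [faithful_state_exists], as all ranks [k]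
    are below [N]. *)
Let kappa : R := (2 * N%:R)^-1.

Lemma kappa_gt0 : 0 < kappa.
Proof.
have [k [kN _ _]] := exact_rank x0.
by rewrite invr_gt0 mulr_gt0// ltr0n (leq_ltn_trans _ kN).
Qed.

Lemma kappa_le : kappa <= 2^-1.
Proof.
have [k [kN _ _]] := exact_rank x0.
rewrite /kappa lef_pV2 ?posrE//; last first.
  by rewrite mulr_gt0// ltr0n (leq_ltn_trans _ kN).
by rewrite ler_peMr// ler1n (leq_ltn_trans _ kN).
Qed.

Lemma kappa_faithful_exists x : exists f, faithful_state x kappa f.
Proof.
have [k [kN rk nrk]] := exact_rank x.
have [k0 [f hf]] := faithful_state_exists _ _ _ _ _ hsub he heN x k rk nrk.
exists f; apply: faithful_state_weak hf => //.
rewrite /kappa lef_pV2 ?posrE ?mulr_gt0 ?ltr0n ?(leq_ltn_trans _ kN)//.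
by rewrite ler_pM2l// ler_nat ltnW.
Qed.

(** For every basic open set and every [k], one family independent on the whole set is chosen if
    there is any. Independence being an open condition, each point has such a family of size its
    exact rank, and that family determines its states. The vectors are then rescaled by a bound over
    the compact base. *)
Lemma separating_sequence : exists s : nat -> V,
  (forall n x f, state x f -> `|f (s n)| <= 1) /\
  (forall x f g, state x f -> state x g -> (forall n, f (s n) = g (s n)) -> f = g).
Proof.
have [U hU] := countable_nbhs_basis R X x0 cX.
have hb : forall nk : nat * nat, exists b : 'I_nk.2 -> V,
    (exists b' : 'I_nk.2 -> V, forall y, U nk.1 y -> independent_at y nk.2 b') ->
    forall y, U nk.1 y -> independent_at y nk.2 b.
  move=> nk; have [[b hb]|nb] := pselect (exists b' : 'I_nk.2 -> V, forall y, U nk.1 y -> independent_at y nk.2 b').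
    by exists b.
  by exists (fun=> 0) => /nb.
pose b nk := projT1 (cid (hb nk)).
have hbb nk : (exists b' : 'I_nk.2 -> V, forall y, U nk.1 y -> independent_at y nk.2 b') ->
    forall y, U nk.1 y -> independent_at y nk.2 (b nk) by exact: projT2 (cid (hb nk)).
pose s m : V := if unpickle m is Some (existT nk j) then b nk j else 0.
have sb nk j : exists m, s m = b nk j.
  by exists (pickle (existT (fun nk : nat * nat => 'I_nk.2) nk j)); rewrite /s pickleK.
have bound v : exists2 M : R, 0 < M & forall x f, state x f -> `|f v| <= M.
  have [M1 M10 h1] := continuous_compact_bounded _ _ _ cX (hcont v).
  have [M2 M20 h2] := continuous_compact_bounded _ _ _ cX (hcont (- v)).
  exists (M1 + M2) => [|x f sf]; first by rewrite addr_gt0.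
  rewrite (le_trans (state_norm _ _ _ _ _ _ v sf))// ge_max.
  have := h1 x; have := h2 x; rewrite !ler_norml => /andP[? ?] /andP[? ?].
  by apply/andP; split; lra.
have {}bound v : exists M : R, 0 < M /\ forall x f, state x f -> `|f v| <= M.
  by have [m m0 hm] := bound v; exists m.
have {bound} [M hM] := choice bound.
exists (fun n => (M (s n))^-1 *: s n); split=> [n x f sf|x f g sf sg fg].
  have [M0 /(_ x f sf) hf] := hM (s n).
  by rewrite sf.1.2 normrM normfV (gtr0_norm M0) mulrC ler_pdivrMr// mul1r.
have fs n : f (s n) = g (s n).
  have [M0 _] := hM (s n); have := fg n; rewrite sf.1.2 sg.1.2.
  by apply: mulfI; rewrite invr_eq0 gt_eqF.
have [k [_ [b0 ib0] nrk]] := exact_rank x.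
have [n [Ux Un]] := hU x _ (independent_near _ _ _ _ hsub hcont x k b0 ib0).
have ib := hbb (n, k) (ex_intro _ b0 (fun y Uy => Un y Uy)) x Ux.
apply/funext => v; have [t ht] := states_spanned _ _ _ _ x k (b (n, k)) v ib nrk.
rewrite (ht f sf) (ht g sg); apply: eq_bigr => j _.
by have [m <-] := sb (n, k) j; rewrite fs.
Qed.

Variable s : nat -> V.
Hypothesis s_le1 : forall n x f, state x f -> `|f (s n)| <= 1.
Hypothesis s_sep : forall x f g, state x f -> state x g ->
  (forall n, f (s n) = g (s n)) -> f = g.

Definition defect (a : nat -> R) f : R := wsum R (fun n => (f (s n) - a n) ^+ 2).

Let sq_bound (u v : R) : `|u| <= 1 -> `|v| <= 1 -> 0 <= (u - v) ^+ 2 <= 4.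
Proof.
rewrite !ler_norml => /andP[? ?] /andP[? ?]; rewrite sqr_ge0/=.
have : 0 <= (2 - (u - v)) * (2 + (u - v)) by apply: mulr_ge0; lra.
by nra.
Qed.

Lemma defect_ge0 x a f : (forall n, `|a n| <= 1) -> state x f -> 0 <= defect a f.
Proof. by move=> ha sf; apply: wsum_ge0 => n; apply: sq_bound => //; exact: s_le1 sf. Qed.

Lemma defect_eq0 x a f : (forall n, `|a n| <= 1) -> state x f -> defect a f <= 0 ->
  forall n, f (s n) = a n.
Proof.
move=> ha sf d0 n; have := wsum_ge_term R (fun n => (f (s n) - a n) ^+ 2) n.
move=> /(_ (fun n => sq_bound _ _ (s_le1 n x f sf) (ha n))) /le_trans/(_ d0).
rewrite pmulr_lle0 ?exprn_gt0// => h; apply/eqP; rewrite -subr_eq0 -sqrf_eq0.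
by apply/eqP/le_anti; rewrite h sqr_ge0.
Qed.

Lemma defect_refl f : defect (fun n => f (s n)) f = 0.
Proof.
rewrite /defect (_ : (fun n => _) = fun=> 0).
  rewrite /wsum (_ : series _ = fun=> 0) ?lim_cst//.
  by apply/funext => n; rewrite /series/= big1// => i _; rewrite mul0r.
by apply/funext => n; rewrite subrr expr0n.
Qed.

(** Joint continuity of the defect in the state and in the target values, tested on finitely many
    terms of the sequence. *)
Lemma defect_near (eps : R) : 0 < eps -> exists m : nat, exists2 delta : R, 0 < delta &
  forall x y f g (a b : nat -> R), state x f -> state y g ->
    (forall n, `|a n| <= 1) -> (forall n, `|b n| <= 1) ->
    (forall i : 'I_m, `|f (s i) - g (s i)| <= delta) ->
    (forall i : 'I_m, `|a i - b i| <= delta) -> defect a f <= defect b g + eps.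
Proof.
move=> e0; have [m [d d0 H]] := wsum_near R eps e0.
(* A difference of squares [(u - v) (u + v)] is at most [(d / 8 + d / 8) * 4 = d]. *)
exists m, (d / 8) => [|x y f g a b sf sg ha hb hfg hab]; first by rewrite divr_gt0.
apply: H => [n|n|n nm]; try by apply: sq_bound => //; exact: s_le1.
  by apply: sq_bound => //; exact: s_le1 sf.
  by apply: sq_bound => //; exact: s_le1 sg.
have := hfg (Ordinal nm); have := hab (Ordinal nm) => /=.
rewrite subr_sqr normrM; set u := f (s n) - a n; set v := g (s n) - b n => h1 h2.
have huv : `|u - v| <= d / 4.
  have -> : u - v = (f (s n) - g (s n)) - (a n - b n) by rewrite /u /v; ring.
  by rewrite (le_trans (ler_normB _ _))//; lra.
have h4 : `|u + v| <= 4.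
  have := s_le1 n x f sf; have := s_le1 n y g sg; have := ha n; have := hb n.
  have := ler_normD u v; have := ler_normB (f (s n)) (a n); have := ler_normB (g (s n)) (b n).
  by rewrite -/u -/v; lra.
have -> : d = d / 4 * 4 by field.
exact: ler_pM.
Qed.

(* Parallelogram identity: [defect a] is strictly convex. *)
Lemma defect_minimizer_unique x c a f g : (forall n, `|a n| <= 1) -> 0 <= c ->
  faithful_state x c f -> faithful_state x c g ->
  (forall h, faithful_state x c h -> defect a f <= defect a h) ->
  defect a g <= defect a f -> g = f.
Proof.
move=> ha c0 hf hg fmin gf.
have sf := faithful_state_state _ _ _ _ hsub _ _ _ c0 hf.
have sg := faithful_state_state _ _ _ _ hsub _ _ _ c0 hg.
pose h v := (1 - 2^-1) * f v + 2^-1 * g v.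
have hh : faithful_state x c h.
  have a01 : 0 <= (2^-1 : R) <= 1 by apply/andP; split; lra.
  have := faithful_state_comb _ _ _ _ x 2^-1 c c f g a01 hf hg.
  by rewrite (_ : (1 - 2^-1) * c + 2^-1 * c = c)//; field.
have sh := faithful_state_state _ _ _ _ hsub _ _ _ c0 hh.
pose A n := (f (s n) - a n) ^+ 2 / 2; pose B n := (g (s n) - a n) ^+ 2 / 2.
pose C n := (h (s n) - a n) ^+ 2; pose D n := ((f (s n) - g (s n)) / 2) ^+ 2.
have bf n := sq_bound _ _ (s_le1 n x f sf) (ha n).
have bg n := sq_bound _ _ (s_le1 n x g sg) (ha n).
have bh n := sq_bound _ _ (s_le1 n x h sh) (ha n).
have bA n : 0 <= A n <= 4 by have := bf n; rewrite /A => /andP[? ?]; apply/andP; split; lra.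
have bB n : 0 <= B n <= 4 by have := bg n; rewrite /B => /andP[? ?]; apply/andP; split; lra.
have bD n : 0 <= D n <= 4.
  have /andP[h1 h2] := sq_bound _ _ (s_le1 n x f sf) (s_le1 n x g sg).
  by rewrite /D exprMn; apply/andP; split; [rewrite mulr_ge0// sqr_ge0|lra].
have e1 : wsum R A + wsum R B = wsum R C + wsum R D.
  rewrite -!wsumD//; congr wsum; apply/funext => n.
  by rewrite /A /B /C /D /h; field.
have half u : (forall n, 0 <= u n <= 4) -> wsum R u = 2 * wsum R (fun n => u n / 2).
  move=> hu; have hu2 n : 0 <= u n / 2 <= 4 by have := hu n => /andP[? ?]; apply/andP; split; lra.
  by rewrite mulr_natl mulr2n -wsumD//; congr wsum; apply/funext => n; field.
have eA : defect a f = 2 * wsum R A by rewrite /defect half.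
have eB : defect a g = 2 * wsum R B by rewrite /defect half.
have D0 : wsum R D <= 0.
  have := fmin h hh; rewrite {2}/defect -/C; lra.
apply: (s_sep x) => // n; have := wsum_ge_term R D n bD => /le_trans/(_ D0).
rewrite pmulr_lle0 ?exprn_gt0// => h0; apply/eqP; rewrite eq_sym -subr_eq0.
have : ((f (s n) - g (s n)) / 2) ^+ 2 == 0.
  by apply/eqP/le_anti; rewrite h0 sqr_ge0.
by rewrite sqrf_eq0 mulf_eq0 invr_eq0 pnatr_eq0 orbF.
Qed.

(** Limit along an ultrafilter that contains all sets of near-minimizers. *)
Lemma defect_minimizer_exists x c a f0 : (forall n, `|a n| <= 1) -> 0 <= c -> c <= 1 ->
  faithful_state x c f0 -> exists2 f, faithful_state x c f &
    forall h, faithful_state x c h -> defect a f <= defect a h.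
Proof.
move=> ha c0 c1 hf0.
have ss f : faithful_state x c f -> state x f by exact: faithful_state_state.
pose Z := [set defect a f | f in [set f | faithful_state x c f]].
have Zi : has_inf Z.
  split; first by exists (defect a f0), f0.
  by exists 0 => _ [f /= hf <-]; apply: (defect_ge0 x) => //; exact: ss.
pose G (eps : R) := [set f | faithful_state x c f /\ defect a f < inf Z + eps].
pose F0 := filter_from [set eps : R | 0 < eps] G.
have PF0 : ProperFilter F0.
  apply: filter_from_proper; last first.
    move=> eps /= e0; have [_ [f hf <-] h] := inf_adherent e0 Zi.
    by exists f; split.
  apply: filter_from_filter; first by exists 1 => /=.
  move=> i j /= i0 j0; exists (Num.min i j); first by rewrite /= lt_min i0.
  move=> f [hf h]; split; split=> //; apply: (lt_le_trans h); rewrite lerD2l ge_min lexx ?orbT//.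
have [F [UF FF0]] := ultraFilterLemma PF0.
have PF : ProperFilter F by exact: ultra_proper.
have FG eps : 0 < eps -> F (G eps) by move=> e0; apply: FF0; exists eps.
have Fst : F [set f | faithful_state x c f].
  by apply: filterS (FG 1 ltr01) => f [].
have Fx W : nbhs x W -> F [set t : V -> R | W x].
  by move=> /nbhs_singleton Wx; apply: filterS filterT.
have [psi hpsi cvpsi] := ultra_limit_state _ _ _ _ hsub hcont _ F (fun=> x) id x c UF Fx c0 c1 Fst.
exists psi => // h hh; apply/ler_addgt0Pl => eps e0.
have [m [d d0 H]] := defect_near (eps / 2) (divr_gt0 e0 (ltr0Sn _ 1)).
have Fm : F [set f | forall i : 'I_m, `|f (s i) - psi (s i)| < d].
  by apply: filter_forall => i; exact: cvpsi.
have [f [/= hf [hfc hfd]]] := filter_ex (filterI Fm (FG (eps / 2) (divr_gt0 e0 (ltr0Sn _ 1)))).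
have := H x x psi f a a (ss _ hpsi) (ss _ hfc) ha ha _ _.
have Zh : inf Z <= defect a h by apply: ge_inf; [exact: Zi.2|exists h].
move=> /(_ _ _)/le_trans; apply => [i|i|]; last by lra.
  by rewrite distrC ltW.
by rewrite subrr normr0 ltW.
Qed.

(* The argument of Berge's maximum theorem. *)
Lemma minimizer_continuous (D : set X) (a : nat -> X -> R^o) (phi : X -> V -> R) c x :
  0 <= c -> c <= 1 -> (forall n, continuous (a n)) -> (forall n y, `|a n y| <= 1) ->
  (forall y, D y -> faithful_state y c (phi y)) -> D x ->
  (forall h, faithful_state x c h -> defect (a^~ x) (phi x) <= defect (a^~ x) h) ->
  (forall eps : R, 0 < eps -> \forall y \near x, D y ->
     defect (a^~ y) (phi y) <= defect (a^~ x) (phi x) + eps) ->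
  forall v (eps : R), 0 < eps -> \forall y \near x, D y -> `|phi y v - phi x v| < eps.
Proof.
move=> c0 c1 ca a1 hphi Dx xmin usc v eps e0; apply: contrapT => bad.
pose D' := [set y | D y /\ eps <= `|phi y v - phi x v|].
pose G := within D' (nbhs x).
have PG : ProperFilter G.
  apply: Build_ProperFilter => h; apply: bad.
  have {}h : \forall y \near x, D' y -> False by exact: h.
  apply: filterS h => y hy Dy; rewrite ltNge; apply/negP => le; exact: hy.
(* Along points where [phi] stays [eps] away from [phi x], the limit state [psi] is still a
   minimizer at [x] by semicontinuity, hence equals [phi x] by uniqueness. *)
have [F [UF GF]] := ultraFilterLemma PG.
have PF : ProperFilter F by exact: ultra_proper.
have Fx W : nbhs x W -> F W by move=> xW; apply: GF; apply: filterS xW => y.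
have FD' : F D' by apply: GF; rewrite /G /within/=; apply: nearW.
have Fst : F [set y | faithful_state y c (phi y)].
  by apply: filterS FD' => y [/hphi].
have [psi hpsi cvpsi] := ultra_limit_state _ _ _ _ hsub hcont _ F id phi x c UF Fx c0 c1 Fst.
have psix : psi = phi x.
  apply: (defect_minimizer_unique x c (a^~ x)) => //; first exact: hphi.
  apply/ler_addgt0Pl => eta eta0.
  have [m [d d0 H]] := defect_near (eta / 2) (divr_gt0 eta0 (ltr0Sn _ 1)).
  have Fm : F [set y | forall i : 'I_m, `|phi y (s i) - psi (s i)| < d].
    by apply: filter_forall => i; exact: cvpsi.
  have Fa : F [set y | forall i : 'I_m, `|a i x - a i y| < d].
    apply: filter_forall => i; apply: Fx.
    by have /cvgrPdist_lt := ca i x; apply.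
  have Fu := Fx _ (usc (eta / 2) (divr_gt0 eta0 (ltr0Sn _ 1))).
  have [y [[[/= h1 h2] h3] [Dy _]]] := filter_ex (filterI (filterI (filterI Fm Fa) Fu) FD').
  have sy := faithful_state_state _ _ _ _ hsub _ _ _ c0 (hphi y Dy).
  have sx := faithful_state_state _ _ _ _ hsub _ _ _ c0 hpsi.
  have := H x y psi (phi y) (a^~ x) (a^~ y) sx sy (fun n => a1 n x) (fun n => a1 n y).
  have k1 (i : 'I_m) : `|psi (s i) - phi y (s i)| <= d by rewrite distrC ltW.
  have k2 (i : 'I_m) : `|a i x - a i y| <= d by rewrite ltW.
  by move=> /(_ k1 k2); have := h3 Dy; lra.
have [y [/= h1 [_ h2]]] := filter_ex (filterI (cvpsi v eps e0) FD').
by move: h1; rewrite psix ltNge h2.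
Qed.

Let stratum k := [set x | forall j, (k <= j)%N -> ~ rank_ge x j].

Let closed_stratum k : closed (stratum k).
Proof.
pose O := [set x | exists2 j, (k <= j)%N & rank_ge x j].
have -> : stratum k = ~` O.
  apply/seteqP; split=> x /= hx; first by move=> [j kj]; exact: hx.
  by move=> j kj rj; apply: hx; exists j.
apply: open_closedC; rewrite openE => x [j kj [b ib]].
rewrite /interior/=; apply: filterS (independent_near _ _ _ _ hsub hcont x j b ib) => y iy.
by exists j => //; exists b.
Qed.

(* Going from [stratum k] to [stratum k.+1]: at points of [stratum k] the
   approximants are convex combinations with [kappa]-faithful states, which
   costs a factor [kappa]; at the other points the rank is locally constant. *)
Let minimizer_usc k c (a : nat -> X -> R^o) (phi : X -> V -> R) x :
  0 < c -> c <= kappa -> (forall n, continuous (a n)) -> (forall n y, `|a n y| <= 1) ->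
  (forall y, stratum k y -> exists2 f, faithful_state y c f & forall n, f (s n) = a n y) ->
  (forall y, faithful_state y (c * kappa) (phi y)) ->
  (forall y h, faithful_state y (c * kappa) h -> defect (a^~ y) (phi y) <= defect (a^~ y) h) ->
  stratum k.+1 x -> forall eps : R, 0 < eps ->
  \forall y \near x, stratum k.+1 y ->
     defect (a^~ y) (phi y) <= defect (a^~ x) (phi x) + eps.
Proof.
move=> c0 ck ca a1 hk hphi phimin Sx eps e0.
have k0 := kappa_gt0; have k2 := kappa_le.
have ck0 : 0 <= c * kappa by rewrite mulr_ge0// ltW.
have [m [d d0 H]] := defect_near eps e0.
have na : \forall y \near x, forall i : 'I_m, `|a i x - a i y| < d.
  by apply: filter_forall => i; have /cvgrPdist_lt := ca i x; apply.
have ss y f : faithful_state y (c * kappa) f -> state y f by exact: faithful_state_state.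
(* Since [phi y] is a minimizer, any equally faithful state at [y] that is close to [phi x] on
   finitely many [s i] bounds its defect. *)
suff : \forall y \near x, stratum k.+1 y -> exists2 psi, faithful_state y (c * kappa) psi &
    forall i : 'I_m, `|psi (s i) - phi x (s i)| <= d.
  move=> hpsi; near=> y => Sy.
  have hy : forall i : 'I_m, `|a i x - a i y| < d by near: y.
  have [psi hpsi1 hpsi2] : exists2 psi, faithful_state y (c * kappa) psi &
    forall i : 'I_m, `|psi (s i) - phi x (s i)| <= d by move: Sy; near: y.
  apply: (le_trans (phimin y psi hpsi1)).
  apply: (H y x psi (phi x) (a^~ y) (a^~ x) (ss _ _ hpsi1) (ss _ _ (hphi x))) => //.
  by move=> i; rewrite distrC ltW.
have [Skx|nSkx] := pselect (stratum k x).
  have [f hf fa] := hk x Skx.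
  have hf' : faithful_state x (c * kappa) f by apply: faithful_state_weak hf => //; nra.
  (* On the old stratum [f] competes with defect 0, so the minimizer must reproduce it. *)
  have phif : phi x = f.
    apply: (s_sep x); [exact: ss (hphi x)|exact: ss hf'|move=> n].
    rewrite fa; apply: (defect_eq0 x (a^~ x)) => //; first exact: ss (hphi x).
    rewrite (le_trans (phimin x f hf'))//.
    have -> : a^~ x = (fun n => f (s n)) by apply/funext => i; rewrite fa.
    by rewrite defect_refl.
  have c01 : 0 <= c < 1 by apply/andP; split; lra.
  have := faithful_state_lift _ _ _ _ hsub hcont x c f m (fun i => s i) d c01 hf d0.
  apply: filterS => y hy _.
  have [w hw] := kappa_faithful_exists y.
  have sw : state y w by exact: faithful_state_state (ltW k0) hw.
  have [g sg hg] := hy w sw.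
  exists (fun v => (1 - c) * g v + c * w v); last by rewrite phif.
  have c01' : 0 <= c <= 1 by apply/andP; split; lra.
  have := faithful_state_comb _ _ _ _ y c 0 kappa g w c01' (state_faithful_state _ _ _ _ _ _ sg) hw.
  by rewrite mulr0 add0r.
have [j kj [b ib]] : exists2 j, (k <= j)%N & rank_ge x j.
  by apply: contrapT => nj; apply: nSkx => j kj rj; apply: nj; exists j.
have jk : j = k.
  apply/eqP; rewrite eqn_leq kj andbT leqNgt; apply/negP => kj'.
  by apply: (Sx j kj'); exists b.
subst j.
have [w hw] := kappa_faithful_exists x.
have := faithful_state_lift_rank _ _ _ _ _ hsub he heN hcont x k b (c * kappa) kappa (phi x) w
   m (fun i => s i) d ib ck0.
have -> : c * kappa < kappa by rewrite gtr_pMl//; lra.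
have -> : kappa <= 1 by lra.
move=> /(_ isT isT (hphi x) hw d0); apply: filterS => y hy Sy; apply: hy.
by apply: Sy; rewrite addn1.
Unshelve. all: by end_near. Qed.

(** The induction carries the values [a n] of the selection, as functions on all of [X], rather than
    the selection itself: numbers can be extended by Tietze, although off the stratum they need not
    come from any state. *)
Let stratum_selection k : exists c (a : nat -> X -> R^o),
  [/\ 0 < c, c <= kappa, forall n, continuous (a n), forall n y, `|a n y| <= 1 &
    forall y, stratum k y -> exists2 f, faithful_state y c f & forall n, f (s n) = a n y].
Proof.
have k0 := kappa_gt0; have k2 := kappa_le.
elim: k => [|k [c [a [c0 ck ca a1 hk]]]].
  (* Stratum 0 is empty, because every rank is at least 0. *)
  exists kappa, (fun _ _ => 0); split=> //.
  - by move=> n; exact: cst_continuous.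
  - by move=> n y; rewrite normr0.
  - by move=> y /(_ 0%N (leqnn _)) []; exact: rank_ge0.
have ck0 : 0 <= c * kappa by rewrite mulr_ge0// ltW.
have ck1 : c * kappa <= 1 by nra.
have exmin x : exists f, faithful_state x (c * kappa) f /\
    forall h, faithful_state x (c * kappa) h -> defect (a^~ x) f <= defect (a^~ x) h.
  have [w hw] := kappa_faithful_exists x.
  have hw' : faithful_state x (c * kappa) w by apply: faithful_state_weak hw => //; nra.
  have [|f hf fmin] := defect_minimizer_exists x (c * kappa) (a^~ x) w _ ck0 ck1 hw'.
    by [].
  by exists f.
have [phi hphi] := choice exmin.
have usc := minimizer_usc k c a phi.
have cont x : stratum k.+1 x -> forall v (eps : R), 0 < eps ->
    \forall y \near x, stratum k.+1 y -> `|phi y v - phi x v| < eps.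
  move=> Sx; apply: (minimizer_continuous (stratum k.+1) a phi (c * kappa) x) => //.
  - by move=> y _; exact: (hphi y).1.
  - exact: (hphi x).2.
  - by apply: usc => // y; have [] := hphi y.
have ext n : exists g : X -> R^o, [/\ {in stratum k.+1, (fun x => phi x (s n) : R^o) =1 g},
    continuous g & forall x, `|g x| <= 1].
  apply: (continuous_bounded_extension (compact_normal hX cX) (closed_stratum k.+1)) => //.
    apply/subspace_continuousP => x Sx; apply/cvgrPdist_lt => eps e0.
    suff : \forall y \near x, stratum k.+1 y -> `|phi x (s n) - phi y (s n)| < eps by exact.
    have := cont x Sx (s n) eps e0.
    by apply: filterS => y hy Sy; rewrite distrC; exact: hy.
  move=> x Sx; apply: (s_le1 n x); exact: faithful_state_state ck0 (hphi x).1.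
have [g hg] := choice ext.
exists (c * kappa), g; split.
- by rewrite mulr_gt0.
- by nra.
- by move=> n; have [] := hg n.
- by move=> n y; have [] := hg n.
- move=> y Sy; exists (phi y); first exact: (hphi y).1.
  by move=> n; have [+ _ _] := hg n; apply; rewrite inE.
Qed.

Lemma faithful_selection_of_sequence : exists2 c, 0 < c & exists2 phi : X -> V -> R,
  (forall x, faithful_state x c (phi x)) & forall v, continuous (fun x => phi x v : R^o).
Proof.
have k2 := kappa_le.
have [c [a [c0 ck ca a1 hk]]] := stratum_selection N.
have hf x : exists f, faithful_state x c f /\ forall n, f (s n) = a n x.
  by have [f hf fa] := hk x (fun j => rank_lt x j); exists f.
have [phi hphi] := choice hf.
have d0 x : defect (a^~ x) (phi x) = 0.
  rewrite (_ : a^~ x = fun n => phi x (s n)) ?defect_refl//.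
  by apply/funext => n; rewrite (hphi x).2.
exists c => //; exists phi => [x|v x]; first exact: (hphi x).1.
apply/cvgrPdist_lt => eps e0.
(* On the last stratum, all of [X], the selected states have defect 0. They are thus minimizers, and
   continuity on the sequence [s] spreads to every [v]. *)
have := minimizer_continuous setT a phi c x (ltW c0) _ ca a1.
have -> : c <= 1 by lra.
move=> /(_ isT (fun y _ => (hphi y).1) I) h.
have {}h : forall v (eps : R), 0 < eps -> \forall y \near x, setT y -> `|phi y v - phi x v| < eps.
  apply: h => [h hh|eta eta0].
    rewrite d0; apply: (defect_ge0 x) => //; exact: faithful_state_state (ltW c0) hh.
  by apply: nearW => y _; rewrite !d0 add0r ltW.
by have := h v eps e0; apply: filterS => y hy; rewrite distrC; exact: hy.
Qed.

End Selection.

Theorem faithful_selection (R : realType) (X : pseudoMetricType R) (V : lmodType R) (e : V)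
    (p : X -> V -> R) (x0 : X) (N : nat) :
  (forall x, sublin R V (p x)) -> (forall x, p x e = 1) -> (forall x, p x (- e) = -1) ->
  (forall v, continuous (fun x => p x v : R^o)) ->
  hausdorff_space X -> compact [set: X] ->
  (forall x k, (N <= k)%N -> ~ rank_ge R X V p x k) ->
  exists2 c, 0 < c & exists2 phi : X -> V -> R,
    (forall x, faithful_state R X V p x c (phi x)) & forall v, continuous (fun x => phi x v : R^o).
Proof.
move=> hsub he heN hcont hX cX rank_lt.
have [s [s1 ssep]] := separating_sequence _ _ _ _ hsub hcont cX x0 N rank_lt.
exact: (faithful_selection_of_sequence _ _ _ _ _ hsub he heN hcont cX hX x0 N rank_lt s s1 ssep).
Qed.

(** * The algebra of continuous sections *)

Section ComplexModulus.
Variable R : realType.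

Lemma cabsE (a b : R) : cabs (a +i* b)%C = Num.sqrt (a ^+ 2 + b ^+ 2).
Proof. by rewrite /cabs normc_def. Qed.

Lemma cabs_real (a : R) : cabs (a%:C)%C = `|a|.
Proof. by rewrite cabsE expr0n addr0 sqrtr_sqr. Qed.

Lemma cabs_le (a b : R) : cabs (a +i* b)%C <= `|a| + `|b|.
Proof.
rewrite cabsE -(ler_pXn2r (ltn0Sn 1)) ?nnegrE ?sqrtr_ge0 ?addr_ge0//.
rewrite sqr_sqrtr ?addr_ge0 ?sqr_ge0// sqrrD -!normrX.
rewrite !(ger0_norm (sqr_ge0 _)).
have : 0 <= `|a| * `|b| by rewrite mulr_ge0.
by rewrite mulr2n; lra.
Qed.

End ComplexModulus.

(** * Operations in a single fibre *)

Section Fibre.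
Variables (R : realType) (X : topologicalType) (A : bundle_data R X).
Hypothesis hA : unital_Cstar_bundle A.

Local Notation T := (tot A).
Local Notation pi := (@Defs.proj _ _ A).
Local Notation badd := (@badd _ _ A).
Local Notation bscale := (@bscale _ _ A).
Local Notation bmul := (@bmul _ _ A).
Local Notation bstar := (@bstar _ _ A).
Local Notation nrm := (@bnorm _ _ A).
Local Notation bzero := (@bzero _ _ A).
Local Notation bone := (@bone _ _ A).

Lemma proj_zero x : pi (bzero x) = x. Proof. by have [[]] := hA.1 x. Qed.
Lemma proj_one x : pi (bone x) = x. Proof. by have [[]] := hA.1 x. Qed.

Lemma proj_add x p q : pi p = x -> pi q = x -> pi (badd p q) = x.
Proof. by move=> hp hq; have [_ [h _] _ _ _] := hA.1 x; have [] := h p q hp hq. Qed.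

Lemma proj_mul x p q : pi p = x -> pi q = x -> pi (bmul p q) = x.
Proof. by move=> hp hq; have [_ [h _] _ _ _] := hA.1 x; have [] := h p q hp hq. Qed.

Lemma proj_star x p : pi p = x -> pi (bstar p) = x.
Proof. by move=> hp; have [_ [h _] _ _ _] := hA.1 x; have [] := h p p hp hp. Qed.

Lemma proj_scale x a p : pi p = x -> pi (bscale a p) = x.
Proof. by move=> hp; have [_ [h _] _ _ _] := hA.1 x; have [_ _ _] := h p p hp hp; apply. Qed.

Lemma baddA x p q r : pi p = x -> pi q = x -> pi r = x ->
  badd p (badd q r) = badd (badd p q) r.
Proof. by move=> hp hq hr; have [_ [_ [h _]] _ _ _] := hA.1 x; have [] := h p q r hp hq hr. Qed.

Lemma baddC x p q : pi p = x -> pi q = x -> badd p q = badd q p.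
Proof. by move=> hp hq; have [_ [_ [h _]] _ _ _] := hA.1 x; have [] := h p q q hp hq hq. Qed.

Lemma badd0 x p : pi p = x -> badd p (bzero x) = p.
Proof. by move=> hp; have [_ [_ [h _]] _ _ _] := hA.1 x; have [] := h p p p hp hp hp. Qed.

Lemma baddN x p : pi p = x -> badd p (bscale (-1) p) = bzero x.
Proof. by move=> hp; have [_ [_ [h _]] _ _ _] := hA.1 x; have [] := h p p p hp hp hp. Qed.

Lemma bscale1 x p : pi p = x -> bscale 1 p = p.
Proof. by move=> hp; have [_ [_ [_ h]] _ _ _] := hA.1 x; have [] := h 0 0 p p hp hp. Qed.

Lemma bscaleA x a b p : pi p = x -> bscale a (bscale b p) = bscale (a * b) p.
Proof. by move=> hp; have [_ [_ [_ h]] _ _ _] := hA.1 x; have [] := h a b p p hp hp. Qed.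

Lemma bscaleDr x a p q : pi p = x -> pi q = x ->
  bscale a (badd p q) = badd (bscale a p) (bscale a q).
Proof. by move=> hp hq; have [_ [_ [_ h]] _ _ _] := hA.1 x; have [] := h a a p q hp hq. Qed.

Lemma bscaleDl x a b p : pi p = x -> bscale (a + b) p = badd (bscale a p) (bscale b p).
Proof. by move=> hp; have [_ [_ [_ h]] _ _ _] := hA.1 x; have [] := h a b p p hp hp. Qed.

Lemma bmulA x p q r : pi p = x -> pi q = x -> pi r = x ->
  bmul p (bmul q r) = bmul (bmul p q) r.
Proof. by move=> hp hq hr; have [_ _ [h _] _ _] := hA.1 x; have [] := h 0 p q r hp hq hr. Qed.

Lemma bmulDr x p q r : pi p = x -> pi q = x -> pi r = x ->
  bmul p (badd q r) = badd (bmul p q) (bmul p r).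
Proof. by move=> hp hq hr; have [_ _ [h _] _ _] := hA.1 x; have [] := h 0 p q r hp hq hr. Qed.

Lemma bmulDl x p q r : pi p = x -> pi q = x -> pi r = x ->
  bmul (badd p q) r = badd (bmul p r) (bmul q r).
Proof. by move=> hp hq hr; have [_ _ [h _] _ _] := hA.1 x; have [] := h 0 p q r hp hq hr. Qed.

Lemma bscaleAl x a p q : pi p = x -> pi q = x -> bscale a (bmul p q) = bmul (bscale a p) q.
Proof. by move=> hp hq; have [_ _ [h _] _ _] := hA.1 x; have [] := h a p q q hp hq hq. Qed.

Lemma bscaleAr x a p q : pi p = x -> pi q = x -> bscale a (bmul p q) = bmul p (bscale a q).
Proof. by move=> hp hq; have [_ _ [h _] _ _] := hA.1 x; have [] := h a p q q hp hq hq. Qed.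

Lemma bmul1l x p : pi p = x -> bmul (bone x) p = p.
Proof. by move=> hp; have [_ _ [_ [h _]] _ _] := hA.1 x; have [] := h p hp. Qed.

Lemma bmul1r x p : pi p = x -> bmul p (bone x) = p.
Proof. by move=> hp; have [_ _ [_ [h _]] _ _] := hA.1 x; have [] := h p hp. Qed.

Lemma bone_neq0 x : bone x <> bzero x.
Proof. by have [_ _ [_ [_ h]] _ _] := hA.1 x. Qed.

Lemma bstarK x p : pi p = x -> bstar (bstar p) = p.
Proof. by move=> hp; have [_ _ _ [h _] _] := hA.1 x; have [] := h 0 p p hp hp. Qed.

Lemma bstarD x p q : pi p = x -> pi q = x -> bstar (badd p q) = badd (bstar p) (bstar q).
Proof. by move=> hp hq; have [_ _ _ [h _] _] := hA.1 x; have [] := h 0 p q hp hq. Qed.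

Lemma bstarZ x a p : pi p = x -> bstar (bscale a p) = bscale (a^*)%C (bstar p).
Proof. by move=> hp; have [_ _ _ [h _] _] := hA.1 x; have [] := h a p p hp hp. Qed.

Lemma bstarM x p q : pi p = x -> pi q = x -> bstar (bmul p q) = bmul (bstar q) (bstar p).
Proof. by move=> hp hq; have [_ _ _ [h _] _] := hA.1 x; have [] := h 0 p q hp hq. Qed.

Lemma bnorm_eq0 x p : pi p = x -> nrm p = 0 <-> p = bzero x.
Proof. by move=> hp; have [_ _ _ [_ h] _] := hA.1 x; have [] := h 0 p p hp hp. Qed.

Lemma bnormD x p q : pi p = x -> pi q = x -> nrm (badd p q) <= nrm p + nrm q.
Proof. by move=> hp hq; have [_ _ _ [_ h] _] := hA.1 x; have [] := h 0 p q hp hq. Qed.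

Lemma bnormZ x a p : pi p = x -> nrm (bscale a p) = cabs a * nrm p.
Proof. by move=> hp; have [_ _ _ [_ h] _] := hA.1 x; have [] := h a p p hp hp. Qed.

Lemma bnormM x p q : pi p = x -> pi q = x -> nrm (bmul p q) <= nrm p * nrm q.
Proof. by move=> hp hq; have [_ _ _ [_ h] _] := hA.1 x; have [] := h 0 p q hp hq. Qed.

Lemma bnormS x p : pi p = x -> nrm (bmul (bstar p) p) = nrm p ^+ 2.
Proof. by move=> hp; have [_ _ _ [_ h] _] := hA.1 x; have [] := h 0 p p hp hp. Qed.

Lemma fibre_complete x (u : nat -> T) : (forall n, pi (u n) = x) ->
  (forall e : R, 0 < e -> exists n0, forall n m, (n0 <= n)%N -> (n0 <= m)%N ->
     nrm (bsub (u n) (u m)) < e) ->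
  exists2 l, pi l = x & forall e : R, 0 < e -> exists n0, forall n, (n0 <= n)%N -> nrm (bsub (u n) l) < e.
Proof. by have [_ _ _ _ h] := hA.1 x; exact: h. Qed.

Lemma bstar1 x : bstar (bone x) = bone x.
Proof.
have h1 := proj_one x; have hs := proj_star _ _ h1.
by rewrite -[LHS](bmul1r _ _ hs) -{2}(bstarK _ _ h1) -(bstarM _ _ _ hs h1) (bmul1r _ _ hs) (bstarK _ _ h1).
Qed.

Lemma bnorm0 x : nrm (bzero x) = 0.
Proof. exact/(bnorm_eq0 _ _ (proj_zero x)). Qed.

Lemma bnorm1 x : nrm (bone x) = 1.
Proof.
have h1 := proj_one x; have := bnormS _ _ h1; rewrite bstar1 (bmul1l _ _ h1) => e.
have n0 : nrm (bone x) != 0.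
  by apply/eqP => /(bnorm_eq0 _ _ h1); exact: bone_neq0.
by apply: (mulfI n0); rewrite mulr1 -expr2.
Qed.

Lemma bscale0 x p : pi p = x -> bscale 0 p = bzero x.
Proof.
move=> hp; apply/(bnorm_eq0 _ _ (proj_scale _ _ _ hp)).
by rewrite (bnormZ _ _ _ hp) cabs_real normr0 mul0r.
Qed.

Lemma proj_sub x p q : pi p = x -> pi q = x -> pi (bsub p q) = x.
Proof. by move=> hp hq; apply: proj_add => //; exact: proj_scale. Qed.

Lemma bsubK x p q : pi p = x -> pi q = x -> badd (bsub p q) q = p.
Proof.
move=> hp hq; have hNq := proj_scale _ (-1) _ hq.
by rewrite /bsub -(baddA x)// (baddC x _ q)// (baddN x)// (badd0 x).
Qed.

End Fibre.

(** * Stability of continuous sections under operations and uniform limits *)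

Section ContinuousSections.
Variables (R : realType) (X : topologicalType) (A : bundle_data R X).
Hypothesis hA : unital_Cstar_bundle A.

Local Notation T := (tot A).
Local Notation pi := (@Defs.proj _ _ A).
Local Notation badd := (@badd _ _ A).
Local Notation bscale := (@bscale _ _ A).
Local Notation bmul := (@bmul _ _ A).
Local Notation bstar := (@bstar _ _ A).
Local Notation nrm := (@bnorm _ _ A).
Local Notation bzero := (@bzero _ _ A).
Local Notation bone := (@bone _ _ A).
Local Notation is_section := (@is_section _ _ A).

Lemma is_sectionD s t : is_section s -> is_section t -> is_section (fun x => badd (s x) (t x)).
Proof.
move=> [cs ps] [ct pt]; split=> [x W hW|x]; last exact: proj_add.
have [_ _ [hD _] _ _] := hA.2.
have [U [U' [hU hU' H]]] := hD (s x) (t x) (eq_trans (ps x) (esym (pt x))) W hW.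
suff : \forall y \near x, W (badd (s y) (t y)) by exact.
near=> y; apply: H; last by rewrite ps pt.
  by near: y; exact: (cs x).
by near: y; exact: (ct x).
Unshelve. all: by end_near. Qed.

Lemma is_sectionM s t : is_section s -> is_section t -> is_section (fun x => bmul (s x) (t x)).
Proof.
move=> [cs ps] [ct pt]; split=> [x W hW|x]; last exact: proj_mul.
have [_ _ [_ [hM _]] _ _] := hA.2.
have [U [U' [hU hU' H]]] := hM (s x) (t x) (eq_trans (ps x) (esym (pt x))) W hW.
suff : \forall y \near x, W (bmul (s y) (t y)) by exact.
near=> y; apply: H; last by rewrite ps pt.
  by near: y; exact: (cs x).
by near: y; exact: (ct x).
Unshelve. all: by end_near. Qed.

Lemma is_sectionZ (f : X -> R[i]) s : contC f -> is_section s ->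
  is_section (fun x => bscale (f x) (s x)).
Proof.
move=> cf [cs ps]; split=> [x W hW|x]; last exact: proj_scale.
have [_ _ [_ [_ hZ]] _ _] := hA.2.
have [e [U [e0 hU H]]] := hZ (f x) (s x) W hW.
suff : \forall y \near x, W (bscale (f y) (s y)) by exact.
near=> y; apply: H.
  by near: y; exact: cf.
by near: y; exact: (cs x).
Unshelve. all: by end_near. Qed.

Lemma contC_cst (a : R[i]) : contC (fun _ : X => a).
Proof. by move=> x e e0; apply: nearW => y; rewrite subrr cabs_real normr0. Qed.

Lemma is_sectionS s : is_section s -> is_section (fun x => bstar (s x)).
Proof.
move=> [cs ps]; split=> [x|x]; last exact: proj_star.
have [_ _ _ [hS _] _] := hA.2.
by apply: continuous_comp; [exact: cs|exact: hS].
Qed.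

Lemma is_section0 : is_section bzero.
Proof.
split=> [x W|x]; last exact: proj_zero.
have [_ _ _ _ [hz _]] := hA.2.
move=> /hz[U [e [oU Ux e0 H]]]; rewrite /= nbhs_filterE.
have : nbhs x U by exact: open_nbhs_nbhs.
apply: filterS => y Uy /=; apply: H; first by rewrite proj_zero.
by rewrite bnorm0.
Qed.

Lemma is_section1 : is_section bone.
Proof. by have [_ _ _ _ [_ h1]] := hA.2; split=> // x; exact: proj_one. Qed.

Lemma bnorm_continuous s : is_section s -> continuous (fun x => nrm (s x) : R^o).
Proof.
move=> [cs _] x; have [_ _ _ [_ hN] _] := hA.2.
by apply: (continuous_comp (cs x)); exact: hN.
Qed.

(* Near [x], [l y] is the sum of the small element [l y - s n y] and of
   [s n y], which is close to [s n x], itself close to [l x]. *)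
Lemma uniform_limit_section (s : nat -> X -> T) (l : X -> T) :
  (forall n, is_section (s n)) -> (forall x, pi (l x) = x) ->
  (forall e : R, 0 < e -> exists n, forall x, nrm (bsub (l x) (s n x)) < e) -> is_section l.
Proof.
move=> hs pl hl; split=> // x W hW.
have [_ _ [hD _] _ [hz _]] := hA.2.
have eqpi : pi (bzero x) = pi (l x) by rewrite proj_zero.
have zl : badd (bzero x) (l x) = l x.
  by rewrite (baddC _ _ _ hA x) ?(badd0 _ _ _ hA x)// proj_zero.
have [|U [V [hU hV UV]]] := hD (bzero x) (l x) eqpi W; first by rewrite zl.
(* Continuity of addition at [(0, l x)] is used twice: here to put [s n x] in the interior of [V],
   and above to put [l y] in [W]. *)
have [|U' [V' [hU' hV' UV']]] := hD (bzero x) (l x) eqpi V°.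
  by rewrite zl; exact/nbhs_interior.
have [G [e [oG Gx e0 HG]]] := (hz x U).1 hU.
have [G' [e' [oG' Gx' e0' HG']]] := (hz x U').1 hU'.
have [n hn] := hl (Num.min e e') (ltac:(by rewrite lt_min e0)).
have psn z : pi (s n z) = z := (hs n).2 z.
have symm z : nrm (bsub (s n z) (l z)) = nrm (bsub (l z) (s n z)).
  have -> : bsub (s n z) (l z) = bscale (-1) (bsub (l z) (s n z)).
    rewrite /bsub (bscaleDr _ _ _ hA z)//; last exact: proj_scale.
    rewrite (bscaleA _ _ _ hA z)// mulrNN mulr1 (bscale1 _ _ _ hA z)//.
    by rewrite (baddC _ _ _ hA z)//; exact: proj_scale.
  rewrite (bnormZ _ _ _ hA z); last exact: proj_sub.
  by rewrite (_ : -1 = (-1)%:C%C) ?cabs_real ?normrN1 ?mul1r// rmorphN1.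
have snV : nbhs (s n x) V°.
  apply: open_nbhs_nbhs; split; first exact: open_interior.
  rewrite -(bsubK _ _ _ hA x (s n x) (l x))//; apply: UV'.
  - apply: HG'; first by rewrite (proj_sub _ _ _ hA x).
    by rewrite symm (lt_le_trans (hn x))// ge_min lexx orbT.
  - exact: nbhs_singleton.
  - by rewrite (proj_sub _ _ _ hA x)// pl.
suff : \forall y \near x, W (l y) by exact.
near=> y; rewrite -(bsubK _ _ _ hA y (l y) (s n y))//; apply: UV.
- apply: HG.
    rewrite (proj_sub _ _ _ hA y)//; near: y; exact: open_nbhs_nbhs.
  by rewrite (lt_le_trans (hn y))// ge_min lexx.
- apply: interior_subset; near: y; exact: ((hs n).1 x).
- by rewrite (proj_sub _ _ _ hA y).
Unshelve. all: by end_near. Qed.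

End ContinuousSections.

(* The proofs [hA] and the point [x0] are parameters of the type of sections
   because its ring structure (with [1 != 0]) depends on them. *)
Record csec {R : realType} {X : topologicalType} {A : bundle_data R X}
    (hA : unital_Cstar_bundle A) (x0 : X) := CSec {
  csec_val :> X -> tot A;
  csecP : is_section csec_val }.

Arguments CSec {R X A} hA x0 _ _.
Arguments csec_val {R X A hA x0} _ _.
Arguments csecP {R X A hA x0} _.

(** * The algebra of sections, its seminorms and its numerical range *)

Section SectionAlgebra.
Variables (R : realType) (X : topologicalType) (A : bundle_data R X).
Variables (hA : unital_Cstar_bundle A) (x0 : X).

Local Notation Gamma := (csec hA x0).
Local Notation pi := (@Defs.proj _ _ A).
Local Notation nrm := (@bnorm _ _ A).

Lemma csec_eq (s t : Gamma) : (forall x, s x = t x) -> s = t.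
Proof.
case: s t => [s hs] [t ht] /= st; have e : s = t by apply/funext.
by move: hs; rewrite e => hs; congr CSec; exact: Prop_irrelevance.
Qed.

Lemma csec_pi (s : Gamma) x : pi (s x) = x.
Proof. exact: (csecP s).2. Qed.

Definition csec_zero : Gamma := CSec hA x0 _ (is_section0 _ _ _ hA).
Definition csec_one : Gamma := CSec hA x0 _ (is_section1 _ _ _ hA).
Definition csec_add (s t : Gamma) : Gamma :=
  CSec hA x0 _ (is_sectionD _ _ _ hA _ _ (csecP s) (csecP t)).
Definition csec_mul (s t : Gamma) : Gamma :=
  CSec hA x0 _ (is_sectionM _ _ _ hA _ _ (csecP s) (csecP t)).
Definition csec_star (s : Gamma) : Gamma :=
  CSec hA x0 _ (is_sectionS _ _ _ hA _ (csecP s)).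
Definition csec_mulf (f : X -> R[i]) (cf : contC f) (s : Gamma) : Gamma :=
  CSec hA x0 _ (is_sectionZ _ _ _ hA f _ cf (csecP s)).
Definition csec_scale (a : R[i]) (s : Gamma) : Gamma := csec_mulf _ (contC_cst R X a) s.

HB.instance Definition _ := gen_eqMixin Gamma.
HB.instance Definition _ := gen_choiceMixin Gamma.

Let addA : associative csec_add.
Proof. by move=> s t u; apply: csec_eq => x; apply: (baddA _ _ _ hA x); exact: csec_pi. Qed.
Let addC : commutative csec_add.
Proof. by move=> s t; apply: csec_eq => x; apply: (baddC _ _ _ hA x); exact: csec_pi. Qed.
Let add0 : left_id csec_zero csec_add.
Proof.
by move=> s; rewrite addC; apply: csec_eq => x; apply: (badd0 _ _ _ hA x); exact: csec_pi.
Qed.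
Let addN : left_inverse csec_zero (csec_scale (-1)) csec_add.
Proof.
by move=> s; rewrite addC; apply: csec_eq => x; apply: (baddN _ _ _ hA x); exact: csec_pi.
Qed.
HB.instance Definition _ := GRing.isZmodule.Build Gamma addA addC add0 addN.

Let mulA : associative csec_mul.
Proof. by move=> s t u; apply: csec_eq => x; apply: (bmulA _ _ _ hA x); exact: csec_pi. Qed.
Let mul1l : left_id csec_one csec_mul.
Proof. by move=> s; apply: csec_eq => x; apply: (bmul1l _ _ _ hA x); exact: csec_pi. Qed.
Let mul1r : right_id csec_one csec_mul.
Proof. by move=> s; apply: csec_eq => x; apply: (bmul1r _ _ _ hA x); exact: csec_pi. Qed.
Let mulDl : left_distributive csec_mul +%R.
Proof. by move=> s t u; apply: csec_eq => x; apply: (bmulDl _ _ _ hA x); exact: csec_pi. Qed.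
Let mulDr : right_distributive csec_mul +%R.
Proof. by move=> s t u; apply: csec_eq => x; apply: (bmulDr _ _ _ hA x); exact: csec_pi. Qed.
Let one_neq0 : csec_one != 0.
Proof.
by apply/eqP => /(congr1 (fun s : Gamma => s x0)); exact: (bone_neq0 _ _ _ hA).
Qed.
HB.instance Definition _ := GRing.Zmodule_isNzRing.Build Gamma mulA mul1l mul1r mulDl mulDr one_neq0.

Let rscale (a : R) (s : Gamma) : Gamma := csec_scale (a%:C)%C s.
Let scaleA a b s : rscale a (rscale b s) = rscale (a * b) s.
Proof.
apply: csec_eq => x; rewrite /= (bscaleA _ _ _ hA x); last exact: csec_pi.
by rewrite -rmorphM.
Qed.
Let scale1 : left_id 1 rscale.
Proof. by move=> s; apply: csec_eq => x; apply: (bscale1 _ _ _ hA x); exact: csec_pi. Qed.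
Let scaleDr : right_distributive rscale +%R.
Proof. by move=> a s t; apply: csec_eq => x; apply: (bscaleDr _ _ _ hA x); exact: csec_pi. Qed.
Let scaleDl s : {morph rscale^~ s : a b / a + b}.
Proof.
move=> a b; apply: csec_eq => x; rewrite /= rmorphD.
by apply: (bscaleDl _ _ _ hA x); exact: csec_pi.
Qed.
HB.instance Definition _ := GRing.Zmodule_isLmodule.Build R Gamma scaleA scale1 scaleDr scaleDl.

Let scaleAl (a : R) (s t : Gamma) : a *: (s * t) = (a *: s) * t.
Proof. by apply: csec_eq => x; apply: (bscaleAl _ _ _ hA x); exact: csec_pi. Qed.
HB.instance Definition _ := GRing.Lmodule_isLalgebra.Build R Gamma scaleAl.

Let scaleAr (a : R) (s t : Gamma) : a *: (s * t) = s * (a *: t).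
Proof. by apply: csec_eq => x; apply: (bscaleAr _ _ _ hA x); exact: csec_pi. Qed.
HB.instance Definition _ := GRing.Lalgebra_isAlgebra.Build R Gamma scaleAr.

Definition csec_I : Gamma := csec_scale 'i%C 1.

Definition csec_norm (x : X) (s : Gamma) : R := nrm (s x).

Lemma csec_addE (s t : Gamma) x : (s + t) x = badd (s x) (t x). Proof. by []. Qed.

Lemma csec_scaleE (a : R) (s : Gamma) x : (a *: s) x = bscale (a%:C)%C (s x). Proof. by []. Qed.

Lemma csec_oppE (s : Gamma) x : (- s) x = bscale (-1) (s x). Proof. by []. Qed.

Lemma csec_I_mul (s : Gamma) : csec_I * s = csec_scale 'i%C s.
Proof.
apply: csec_eq => x; rewrite /= -(bscaleAl _ _ _ hA x); try exact: csec_pi; last exact: proj_one.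
by rewrite (bmul1l _ _ _ hA x)//; exact: csec_pi.
Qed.

Lemma csec_scale_complex (a b : R) (s : Gamma) :
  csec_scale (a +i* b)%C s = a *: s + b *: (csec_I * s).
Proof.
rewrite csec_I_mul; apply: csec_eq => x.
rewrite csec_addE !csec_scaleE /= (bscaleA _ _ _ hA x); last exact: csec_pi.
rewrite -(bscaleDl _ _ _ hA x); last exact: csec_pi.
by congr bscale; apply/eqP; rewrite eq_complex /=; apply/andP; split; apply/eqP; ring.
Qed.

Lemma csec_cstar_seminorm x : cstar_seminorm csec_star csec_I (csec_norm x).
Proof.
have p (s : Gamma) := csec_pi s x.
split.
- by move=> u v; apply: csec_eq => y; apply: (bstarD _ _ _ hA y); exact: csec_pi.
- move=> a u; apply: csec_eq => y; rewrite /= (bstarZ _ _ _ hA y); last exact: csec_pi.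
  by congr bscale; apply/eqP; rewrite eq_complex /= oppr0 !eqxx.
- by move=> u v; apply: csec_eq => y; apply: (bstarM _ _ _ hA y); exact: csec_pi.
- by move=> u; apply: csec_eq => y; apply: (bstarK _ _ _ hA y); exact: csec_pi.
- apply: csec_eq => y; rewrite csec_oppE /= (bstarZ _ _ _ hA y); last exact: proj_one.
  rewrite (bstar1 _ _ _ hA) (bscaleA _ _ _ hA y); last exact: proj_one.
  by congr bscale; apply/eqP; rewrite eq_complex /=; apply/andP; split; apply/eqP; ring.
- rewrite csec_I_mul; apply: csec_eq => y; rewrite csec_oppE /= (bscaleA _ _ _ hA y); last exact: proj_one.
  by congr bscale; apply/eqP; rewrite eq_complex /=; apply/andP; split; apply/eqP; ring.
- move=> u; rewrite csec_I_mul; apply: csec_eq => y /=.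
  rewrite -(bscaleAr _ _ _ hA y); [|exact: csec_pi|exact: proj_one].
  by rewrite (bmul1r _ _ _ hA y)//; exact: csec_pi.
- exact: bnorm1.
- by move=> u v; apply: (bnormD _ _ _ hA x).
- by move=> a u; rewrite /csec_norm csec_scaleE (bnormZ _ _ _ hA x)// cabs_real.
- by move=> u v; apply: (bnormM _ _ _ hA x).
- by move=> u; apply: (bnormS _ _ _ hA x).
Qed.

Lemma csec_norm_scale (a : R[i]) (s : Gamma) x :
  csec_norm x (csec_scale a s) = cabs a * csec_norm x s.
Proof. by apply: (bnormZ _ _ _ hA x); exact: csec_pi. Qed.

Lemma csec_norm_continuous (s : Gamma) : continuous (fun x => csec_norm x s : R^o).
Proof. exact: (bnorm_continuous _ _ _ hA _ (csecP s)). Qed.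

Lemma csec_eq0 (s : Gamma) : (forall x, csec_norm x s = 0) -> s = 0.
Proof.
by move=> h; apply: csec_eq => x; apply/(bnorm_eq0 _ _ _ hA x); [exact: csec_pi|exact: h].
Qed.

Lemma csec_subE (s t : Gamma) x : (s - t) x = bsub (s x) (t x). Proof. by []. Qed.

Definition numrange (x : X) (s : Gamma) : R :=
  lam (csec_norm x) (2^-1 *: (s + csec_star s)).

Let star_Re (s : Gamma) : csec_star (2^-1 *: (s + csec_star s)) = 2^-1 *: (s + csec_star s).
Proof.
have h := csec_cstar_seminorm x0.
by rewrite (csZ _ _ _ h) (csD _ _ _ h) (csK _ _ _ h) addrC.
Qed.

Lemma numrange_sa x (s : Gamma) : csec_star s = s -> numrange x s = lam (csec_norm x) s.
Proof.
move=> ss; rewrite /numrange ss -[s + s]mulr2n -[s *+ 2]scaler_nat scalerA mulVf// scale1r//.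
Qed.

Lemma numrange_sublin x : sublin R Gamma (numrange x).
Proof.
have h := csec_cstar_seminorm x; split=> [u v|a v a0]; rewrite /numrange.
  rewrite (csD _ _ _ h) addrACA scalerDr; exact: lamD h _ _.
by rewrite (csZ _ _ _ h) -scalerDr scalerA mulrC -scalerA (lamZ _ _ _ _ _ h).
Qed.

Lemma numrange_le_norm x s : numrange x s <= csec_norm x s.
Proof.
have h := csec_cstar_seminorm x.
rewrite /numrange (le_trans (lam_le_norm _ _ _ _ _ h _))// (csNZ _ _ _ h) ger0_norm//.
have := csND _ _ _ h s (csec_star s); rewrite (cs_norm_star _ _ _ _ _ h); lra.
Qed.

Lemma numrange1 x : numrange x 1 = 1.
Proof.
have h := csec_cstar_seminorm x; rewrite numrange_sa ?(cs_star1 _ _ _ _ _ h)//.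
by rewrite -[1 in LHS]scale1r (lam_scalar _ _ _ _ _ h).
Qed.

Lemma numrangeN1 x : numrange x (-1) = -1.
Proof.
have h := csec_cstar_seminorm x.
rewrite numrange_sa ?(cs_starN _ _ _ _ _ h) ?(cs_star1 _ _ _ _ _ h)//.
by rewrite -scaleN1r (lam_scalar _ _ _ _ _ h).
Qed.

(** Each difference quotient is continuous in [x], and by [cs_norm_rate] it approximates [lam]
    within [t * C], where [C] bounds the squared norm of [h] on a neighbourhood. *)
Lemma numrange_continuous (s : Gamma) : continuous (fun x => numrange x s : R^o).
Proof.
move=> x; rewrite /numrange; set h := _ *: _; have sh : csec_star h = h by exact: star_Re.
have H y := csec_cstar_seminorm y.
apply/cvgrPdist_lt => eps e0; pose C := (csec_norm x h + 1) ^+ 2 + 1.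
have C0 : 0 < C by rewrite ltr_wpDl// sqr_ge0.
pose t := eps / (4 * C); have t0 : 0 < t by rewrite divr_gt0// mulr_gt0.
have tC : t * C = eps / 4 by rewrite /t; field; rewrite gt_eqF.
have te : 0 < t * (eps / 4) by rewrite mulr_gt0// divr_gt0.
have c1 : \forall y \near x, `|csec_norm x h - csec_norm y h| < 1.
  by have /cvgrPdist_lt := csec_norm_continuous h x; apply.
have c2 : \forall y \near x, `|csec_norm x (1 + t *: h) - csec_norm y (1 + t *: h)| < t * (eps / 4).
  by have /cvgrPdist_lt := csec_norm_continuous (1 + t *: h) x; apply.
have bnd y : csec_norm y h <= csec_norm x h + 1 ->
    lam (csec_norm y) h <= dquot (csec_norm y) h t <= lam (csec_norm y) h + eps / 4.
  move=> hy; rewrite (lam_le_dquot _ _ _ _ _ (H y))//=.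
  have := cs_norm_rate _ _ _ _ _ (H y) h t sh t0; rewrite (dquotE _ _ _ _ _ t0).
  have y0 := cs_norm_ge0 _ _ _ _ _ (H y) h.
  have : csec_norm y h ^+ 2 <= C.
    by rewrite /C; move: hy y0; set u := csec_norm y h; set w := csec_norm x h; nra.
  move=> h1 h2; rewrite -(ler_pM2l t0) -tC mulrDr.
  have : t ^+ 2 * csec_norm y h ^+ 2 <= t * (t * C).
    by rewrite expr2 -mulrA ler_pM2l// ler_pM2l.
  by lra.
near=> y.
have h1 : `|csec_norm x h - csec_norm y h| < 1 by near: y.
have h2 : `|csec_norm x (1 + t *: h) - csec_norm y (1 + t *: h)| < t * (eps / 4) by near: y.
have hy : csec_norm y h <= csec_norm x h + 1.
  by move: h1; rewrite ltr_norml => /andP[? ?]; lra.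
have /andP[a1 a2] := bnd y hy.
have /andP[b1 b2] := bnd x (ltac:(by rewrite lerDl)).
have : `|dquot (csec_norm x) h t - dquot (csec_norm y) h t| < eps / 4.
  rewrite -(ltr_pM2l t0) -{1}(gtr0_norm t0) -normrM mulrBr.
  move: h2; rewrite (dquotE _ _ (csec_norm x) h t t0) (dquotE _ _ (csec_norm y) h t t0).
  by rewrite opprD addrACA subrr add0r.
by rewrite !ltr_norml => /andP[? ?]; apply/andP; split; lra.
Unshelve. all: by end_near. Qed.

End SectionAlgebra.

(** * Square roots of continuous sections *)

Section SquareRoot.
Variables (R : realType) (X : topologicalType) (A : bundle_data R X).
Variables (hA : unital_Cstar_bundle A) (x0 : X).
Local Notation Gamma := (csec hA x0).
Local Notation nrm := (csec_norm R X A hA x0).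
Local Notation starG := (csec_star R X A hA x0).

Lemma csec_norm_le_small (s : Gamma) (C : R) :
  (forall x n, nrm x s <= C / n.+2%:R) -> s = 0.
Proof.
move=> h; apply: csec_eq0 => x; apply/le_anti.
rewrite (cs_norm_ge0 _ _ _ _ _ (csec_cstar_seminorm _ _ _ hA x0 x)) andbT leNgt.
apply/negP => s0; have C0 : 0 < C.
  by have := lt_le_trans s0 (h x 0%N); rewrite ltr_pdivlMr// mul0r.
have := h x (Num.truncn (C / nrm x s)); rewrite leNgt => /negP; apply.
rewrite ltr_pdivrMr// mulrC -ltr_pdivrMr//.
by apply: (lt_trans (truncnS_gt _)); rewrite ltr_nat.
Qed.

(** The iterates converge in each complete fibre at the rate [2 / (n + 2)], which does not depend on
    the point, so the fibrewise limits form a continuous section. *)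
Lemma csec_sqrt (h : Gamma) : starG h = h -> (forall x, nrm x h <= 1) ->
  exists2 w : Gamma, starG w = w & w * w = 1 - h.
Proof.
move=> sh h1; have H x := csec_cstar_seminorm _ _ _ hA x0 x.
pose y n : Gamma := sqrt_iter h n.
have ycauchy x m n : (n <= m)%N -> nrm x (y m - y n) <= 2 / n.+2%:R.
  by move=> nm; exact: (sqrt_iter_cauchy _ _ _ _ _ (H x) h (h1 x) m n nm).
have small (e : R) : 0 < e -> exists n0 : nat, forall n, (n0 <= n)%N -> 2 / n.+2%:R < e.
  move=> e0; exists (Num.truncn (2 / e)) => n hn.
  rewrite ltr_pdivrMr// mulrC -ltr_pdivrMr// (lt_trans (truncnS_gt _))//.
  by rewrite ltr_nat !ltnS.
have lim x : exists l, Defs.proj l = x /\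
    forall e : R, 0 < e -> exists n0, forall n, (n0 <= n)%N -> bnorm (bsub (y n x) l) < e.
  have [||l pl hl] := fibre_complete _ _ _ hA x (fun n => y n x).
  - by move=> n; exact: csec_pi.
  - move=> e e0; have [n0 hn0] := small e e0; exists n0 => n m hn hm.
    suff sym a b : (n0 <= b)%N -> (b <= a)%N -> nrm x (y a - y b) < e.
      have [nm|mn] := leqP m n; first exact: sym.
      have := sym m n hn (ltnW mn).
      by rewrite -(cs_normN _ _ _ _ _ (H x)) opprB.
    by move=> hb ba; apply: le_lt_trans (ycauchy x a b ba) (hn0 b hb).
  by exists l.
have [l hl] := choice lim.
have pl x : Defs.proj (l x) = x := (hl x).1.
have dist x n : bnorm (bsub (l x) (y n x)) <= 2 / n.+2%:R.
  apply/ler_addgt0Pl => e e0; have [n0 hn0] := (hl x).2 e e0.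
  (* The index [m] depends on [x] and [e] but serves only as an intermediate term, so it disappears
     from the bound. *)
  pose m := maxn n0 n.
  have pm i : Defs.proj (y i x) = x by exact: csec_pi.
  have -> : bsub (l x) (y n x) = badd (bscale (-1) (bsub (y m x) (l x))) (bsub (y m x) (y n x)).
    have pN (z : tot A) : Defs.proj z = x -> Defs.proj (bscale (-1) z) = x by move=> ?; exact: (proj_scale _ _ _ hA).
    rewrite /bsub (bscaleDr _ _ _ hA x)//; last exact: pN.
    rewrite (bscaleA _ _ _ hA x)// mulrNN mulr1 (bscale1 _ _ _ hA x)//.
    rewrite (baddC _ _ _ hA x (bscale _ _) (l x)) ?pN//.
    rewrite -(baddA _ _ _ hA x) ?(pN _ (pm m))//; last by apply: (proj_add _ _ _ hA) => //; exact: pN.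
    rewrite (baddA _ _ _ hA x (bscale _ _) (y m x)) ?pN//.
    rewrite (baddC _ _ _ hA x (bscale _ _) (y m x)) ?pN// (baddN _ _ _ hA x)//.
    by rewrite (baddC _ _ _ hA x (bzero A x)) ?(badd0 _ _ _ hA x) ?(proj_zero _ _ _ hA) ?pN.
  rewrite (le_trans (bnormD _ _ _ hA x _ _ _ _))//.
  - by apply: (proj_scale _ _ _ hA) => //; exact: (proj_sub _ _ _ hA).
  - exact: (proj_sub _ _ _ hA).
  rewrite (bnormZ _ _ _ hA x); last exact: (proj_sub _ _ _ hA).
  rewrite (_ : -1 = (-1)%:C%C) ?cabs_real ?normrN1 ?mul1r; last by rewrite rmorphN1.
  apply: lerD; first by rewrite ltW// hn0// leq_maxl.
  by apply: (ycauchy x m n); rewrite leq_maxr.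
have secl : is_section l.
  apply: (uniform_limit_section _ _ _ hA y l) => // [n|e e0]; first exact: csecP.
  have [n hn] := small e e0; exists n => x.
  exact: le_lt_trans (dist x n) (hn n (leqnn n)).
pose L : Gamma := CSec hA x0 l secl.
have distL x n : nrm x (L - y n) <= 2 / n.+2%:R by exact: dist.
have ysa n : starG (y n) = y n by exact: (sqrt_iter_star _ _ _ _ _ (H x0)).
have sL : starG L = L.
  apply/eqP; rewrite -subr_eq0; apply/eqP/(csec_norm_le_small _ 4) => x n.
  have -> : starG L - L = starG (L - y n) - (L - y n).
    by rewrite (cs_starB _ _ _ _ _ (H x)) ysa opprB addrA subrK.
  rewrite (le_trans (cs_normB _ _ _ _ _ (H x) _ _))// (cs_norm_star _ _ _ _ _ (H x)).
  have := distL x n; have -> : 4 / n.+2%:R = 2 / n.+2%:R + 2 / n.+2%:R :> R by field.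
  by move=> d; rewrite lerD.
exists (1 - L).
  by rewrite (cs_starB _ _ _ _ _ (H x0)) (cs_star1 _ _ _ _ _ (H x0)) sL.
(* 14 = 3 * 2 + 2 * 2 + 2 * 2, from the three terms of [w^2 - (1 - h)] with [N w <= 3] and
   [N v <= 2]. *)
apply/eqP; rewrite -subr_eq0; apply/eqP/(csec_norm_le_small _ 14) => x n.
set w := 1 - L; pose v : Gamma := 1 - y n.
have vv : v * v = 1 - h + 2 *: (y n.+1 - y n) by exact: sqrt_iter_sqr.
have wv : nrm x (w - v) <= 2 / n.+2%:R.
  have -> : w - v = - (L - y n) by rewrite /w /v opprD opprK addrACA subrr add0r opprB addrC.
  by rewrite (cs_normN _ _ _ _ _ (H x)).
have d1 : 2 / n.+2%:R <= 1 :> R by rewrite ler_pdivrMr// mul1r ler_nat.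
have v2 : nrm x v <= 2.
  rewrite (le_trans (cs_normB _ _ _ _ _ (H x) _ _))// (csN1 _ _ _ (H x)).
  have := sqrt_iter_norm _ _ _ _ _ (H x) h (h1 x) n.
  have /andP[a1 _] := sqrt_iter_scalar_near1 R n.
  by rewrite -/(y n); lra.
have w3 : nrm x w <= 3.
  rewrite -[w](subrK v) (le_trans (csND _ _ _ (H x) _ _))//.
  by rewrite [leRHS](_ : 3 = 1 + 2); [rewrite lerD// (le_trans wv)|ring].
have -> : w * w - (1 - h) = w * (w - v) + (w - v) * v + 2 *: (y n.+1 - y n).
  have split_sqr (a b k z : Gamma) : b * b = k + z -> a * a - k = a * (a - b) + (a - b) * b + z.
    by move=> bb; rewrite mulrBr mulrBl addrA subrK bb opprD addrA subrK.
  exact: split_sqr.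
rewrite (le_trans (csND _ _ _ (H x) _ _))//.
have t1 := csND _ _ _ (H x) (w * (w - v)) ((w - v) * v).
have t2 : nrm x (w * (w - v)) <= 3 * (2 / n.+2%:R).
  rewrite (le_trans (csNM _ _ _ (H x) _ _))//.
  by apply: ler_pM => //; exact: (cs_norm_ge0 _ _ _ _ _ (H x)).
have t3 : nrm x ((w - v) * v) <= (2 / n.+2%:R) * 2.
  rewrite (le_trans (csNM _ _ _ (H x) _ _))//.
  by apply: ler_pM => //; exact: (cs_norm_ge0 _ _ _ _ _ (H x)).
have t4 : nrm x (2 *: (y n.+1 - y n)) <= 2 * (2 / n.+2%:R).
  by rewrite (csNZ _ _ _ (H x)) ger0_norm// ler_pM2l// ycauchy.
have -> : 14 / n.+2%:R = 3 * (2 / n.+2%:R) + (2 / n.+2%:R) * 2 + 2 * (2 / n.+2%:R) :> R by field.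
by rewrite lerD// (le_trans t1)// lerD.
Qed.

End SquareRoot.

(** * The rank is bounded by twice the complex dimension *)

Section Dimension.
Variables (R : realType) (X : topologicalType) (A : bundle_data R X).
Variables (hA : unital_Cstar_bundle A) (x0 : X).
Local Notation Gamma := (csec hA x0).
Local Notation nrm := (csec_norm R X A hA x0).
Local Notation state := (state R X Gamma (numrange R X A hA x0)).

Lemma state_le_norm x f (s : Gamma) : state x f -> f s <= nrm x s.
Proof. by move=> [_ h]; rewrite (le_trans (h s))// numrange_le_norm. Qed.

Lemma state_eq0 x f (s : Gamma) : state x f -> nrm x s = 0 -> f s = 0.
Proof.
move=> sf s0; have H := csec_cstar_seminorm _ _ _ hA x0 x.
have := state_le_norm _ _ s sf; have := state_le_norm _ _ (- s) sf.
rewrite (linfnN _ _ _ _ sf.1) (cs_normN _ _ _ _ _ H) s0; lra.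
Qed.

Let comb x N (b : 'I_N -> tot A) (c : 'I_N -> R[i]) : tot A :=
  \big[@badd R X A / bzero A x]_(i < N) bscale (c i) (b i).

Let combD x N (b : 'I_N -> tot A) c d : (forall i, Defs.proj (b i) = x) ->
  comb x N b (fun i => c i + d i) = badd (comb x N b c) (comb x N b d) /\
  Defs.proj (comb x N b c) = x /\ Defs.proj (comb x N b d) = x.
Proof.
move=> pb; rewrite /comb.
apply: (big_rec3 (fun u v w => w = badd u v /\ Defs.proj u = x /\ Defs.proj v = x)).
  by rewrite (badd0 _ _ _ hA x) ?(proj_zero _ _ _ hA).
move=> i u v w _ [-> [pu pv]].
have pc := proj_scale _ _ _ hA x (c i) _ (pb i); have pd := proj_scale _ _ _ hA x (d i) _ (pb i).
split; last by split; apply: (proj_add _ _ _ hA).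
rewrite (bscaleDl _ _ _ hA x)// -!(baddA _ _ _ hA x)//; try by apply: (proj_add _ _ _ hA).
congr badd; rewrite !(baddA _ _ _ hA x)//; congr badd.
exact: (baddC _ _ _ hA x).
Qed.

Let combZ x N (b : 'I_N -> tot A) a c : (forall i, Defs.proj (b i) = x) ->
  comb x N b (fun i => a * c i) = bscale a (comb x N b c) /\ Defs.proj (comb x N b c) = x.
Proof.
move=> pb; rewrite /comb.
apply: (big_rec2 (fun u v => v = bscale a u /\ Defs.proj u = x)).
  have z := proj_zero _ _ _ hA x; split=> //.
  apply/esym/(bnorm_eq0 _ _ _ hA x); first exact: (proj_scale _ _ _ hA).
  by rewrite (bnormZ _ _ _ hA x)// (bnorm0 _ _ _ hA) mulr0.
move=> i u v _ [-> pu]; have pc := proj_scale _ _ _ hA x (c i) _ (pb i).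
split; last by apply: (proj_add _ _ _ hA).
by rewrite (bscaleDr _ _ _ hA x)// (bscaleA _ _ _ hA x).
Qed.

Let comb0 x N (b : 'I_N -> tot A) : (forall i, Defs.proj (b i) = x) ->
  comb x N b (fun=> 0) = bzero A x.
Proof.
move=> pb; apply: (big_rec (fun u => u = bzero A x)) => // i u _ ->.
by rewrite (bscale0 _ _ _ hA x)// (badd0 _ _ _ hA x)// (proj_zero _ _ _ hA).
Qed.

(** More than [2 N] sections have real-linearly dependent values at [x], since [N] complex
    coordinates are [2 N] real ones. The combination vanishing at [x] is killed by every state
    there, which makes the matrix singular. *)
Lemma csec_rank_lt x N (b : 'I_N -> tot A) : (forall i, Defs.proj (b i) = x) ->
  (forall p, Defs.proj p = x -> exists c : 'I_N -> R[i],
     p = \big[@badd R X A / bzero A x]_(i < N) bscale (c i) (b i)) ->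
  forall k, (N + N < k)%N -> ~ rank_ge R X Gamma (numrange R X A hA x0) x k.
Proof.
move=> pb spanb k Nk [g [chi schi /eqP]]; apply.
have hc j := spanb (g j x) (csec_pi _ _ _ hA x0 (g j) x).
have [c {}hc] := choice hc.
pose M : 'M[R]_(k, N + N) := row_mx (\matrix_(j, i) complex.Re (c j i)) (\matrix_(j, i) complex.Im (c j i)).
have : ~~ row_free M.
  by rewrite /row_free neq_ltn (leq_ltn_trans (rank_leq_col M)).
rewrite -kermx_eq0 => /rowV0Pn[v /sub_kermxP vM v0].
rewrite mul_mx_row in vM.
have vM0 : row_mx (v *m \matrix_(j, i) complex.Re (c j i)) (v *m \matrix_(j, i) complex.Im (c j i)) = row_mx 0 0.
  by rewrite vM row_mx0.
have [vRe vIm] := eq_row_mx vM0.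
pose w : Gamma := \sum_j v 0 j *: g j.
have sumc i : \sum_j (v 0 j)%:C%C * c j i = 0.
  apply/eqP; rewrite eq_complex; apply/andP; split; apply/eqP.
    have := congr1 (fun B : 'rV[R]_N => B 0 i) vRe; rewrite !mxE => h.
    apply: (eq_trans _ h); rewrite raddf_sum; apply: eq_bigr => j _; rewrite mxE.
    by case: (c j i) => ? ? /=; ring.
  have := congr1 (fun B : 'rV[R]_N => B 0 i) vIm; rewrite !mxE => h.
  apply: (eq_trans _ h); rewrite raddf_sum; apply: eq_bigr => j _; rewrite mxE.
  by case: (c j i) => ? ? /=; ring.
have wx : w x = comb x N b (fun i => \sum_j (v 0 j)%:C%C * c j i).
  have rel : forall d : 'I_N -> R[i], (forall i, d i = \sum_j (v 0 j)%:C%C * c j i) -> w x = comb x N b d.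
    have -> : forall P : ('I_N -> R[i]) -> Prop, (forall d, (forall i, d i = \sum_j (v 0 j)%:C%C * c j i) -> P d) =
        P (fun i => \sum_j (v 0 j)%:C%C * c j i).
      move=> P; apply/propext; split=> [h|h d hd]; first exact: h.
      by have -> : d = fun i => \sum_j (v 0 j)%:C%C * c j i by apply/funext.
    rewrite /w; elim: (index_enum _) => [|j r IH].
      rewrite big_nil; under [X in comb _ _ _ X]funext do rewrite big_nil.
      by rewrite comb0.
    rewrite big_cons csec_addE csec_scaleE IH hc.
    under [X in _ = comb _ _ _ X]funext do rewrite big_cons.
    by rewrite (combD _ _ _ _ _ pb).1 (combZ _ _ _ _ _ pb).1.
  by apply: rel.
have w0 : nrm x w = 0.
  rewrite /csec_norm wx; under [X in comb _ _ _ X]funext do rewrite sumc.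
  by rewrite comb0// (bnorm0 _ _ _ hA).
rewrite -det_tr; apply/eqP/det0P; exists v => //; apply/rowP => i; rewrite !mxE.
have chiw : chi i w = 0 by exact: (state_eq0 _ _ _ (schi i)).
rewrite -[RHS]chiw /w (linfn_sum _ _ _ _ _ _ (schi i).1).
by apply: eq_bigr => j _; rewrite !mxE.
Qed.

End Dimension.

(** * The conditional expectation *)

Section Expectation.
Variables (R : realType) (X : pseudoMetricType R) (A : bundle_data R X).
Variables (hA : unital_Cstar_bundle A) (x0 : X).
Hypothesis cX : compact [set: X].
Local Notation Gamma := (csec hA x0).
Local Notation nrm := (csec_norm R X A hA x0).
Local Notation starG := (csec_star R X A hA x0).
Local Notation I := (csec_I R X A hA x0).
Local Notation scaleG := (csec_scale R X A hA x0).
Local Notation nr := (numrange R X A hA x0).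
Variables (c : R) (phi : X -> Gamma -> R).
Hypotheses (c0 : 0 < c) (c1 : c <= 1).
Hypothesis hphi : forall x, faithful_state R X Gamma nr x c (phi x).
Hypothesis cphi : forall s, continuous (fun x => phi x s : R^o).

Let H x := csec_cstar_seminorm R X A hA x0 x.
Let lphi x : linfn R Gamma (phi x) := (hphi x).1.
Let sphi x : state R X Gamma nr x (phi x).
Proof. exact: (faithful_state_state _ _ _ _ (numrange_sublin R X A hA x0) _ _ _ (ltW c0) (hphi x)). Qed.

(* Complexification of the real state [phi x], which sees only self-adjoint
   parts; non-sections are sent to the junk value 0. *)
Definition expect (s : X -> tot A) (x : X) : R[i] :=
  match pselect (is_section s) with
  | left h => let S := CSec hA x0 s h in (phi x S +i* (- phi x (I * S)))%C
  | right _ => 0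
  end.

Lemma expectE (S : Gamma) x : expect S x = (phi x S +i* (- phi x (I * S)))%C.
Proof.
rewrite /expect; case: pselect => [h|]; last by move=> /(_ (csecP S)).
by have -> : CSec hA x0 S h = S by exact: csec_eq.
Qed.

Lemma phi1 x : phi x 1 = 1.
Proof.
by apply: (state_e _ _ _ _ _ _ _ x) => //; [exact: numrange1|exact: numrangeN1].
Qed.

(** [I S] is skew-adjoint, so its self-adjoint part and hence its numerical range vanish. *)
Lemma phi_I_mul_sa x (S : Gamma) : starG S = S -> phi x (I * S) = 0.
Proof.
move=> sS; have n0 : nr x (I * S) = 0 /\ nr x (- (I * S)) = 0.
  have e : starG (I * S) = - (I * S).
    by rewrite (csM _ _ _ (H x)) (csI _ _ _ (H x)) sS mulrN (csIC _ _ _ (H x)).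
  rewrite /numrange (cs_starN _ _ _ _ _ (H x)) e opprK subrr addNr scaler0.
  by rewrite (lam0 _ _ _ _ _ (H x)).
have := (sphi x).2 (I * S); have := (sphi x).2 (- (I * S)).
by rewrite (linfnN _ _ _ _ (lphi x)) n0.1 n0.2; lra.
Qed.

Lemma phiI x : phi x I = 0.
Proof. by rewrite -[I]mulr1 phi_I_mul_sa// (cs_star1 _ _ _ _ _ (H x)). Qed.

Lemma phi_eq x (S T : Gamma) : S x = T x -> phi x S = phi x T.
Proof.
move=> e; apply/eqP; rewrite -subr_eq0 -(linfnB _ _ _ _ _ (lphi x)); apply/eqP.
apply: (state_eq0 _ _ _ _ _ x) => //.
have -> : nrm x (S - T) = nrm x (T - T) by rewrite /csec_norm !csec_subE e.
by rewrite subrr (cs_norm0 _ _ _ _ _ (H x)).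
Qed.

Lemma expectZ (a : R[i]) (S : Gamma) x : expect (scaleG a S) x = a * expect S x.
Proof.
rewrite !expectE; case: a => u v; rewrite csec_scale_complex.
rewrite mulrDr -!scalerAr mulrA (csII _ _ _ (H x)) mulN1r.
rewrite !(lphi x).1 !(lphi x).2 (linfnN _ _ _ _ (lphi x)).
by apply/eqP; rewrite eq_complex /=; apply/andP; split; apply/eqP; ring.
Qed.

(** Multiplying [S] by the conjugate of [z = expect S x] makes the expectation equal to the real
    number [|z|^2], to which the bound for the real state applies. *)
Lemma expect_norm (S : Gamma) x : cabs (expect S x) <= nrm x S.
Proof.
have [z0|nz] := eqVneq (cabs (expect S x)) 0.
  by rewrite z0 (cs_norm_ge0 _ _ _ _ _ (H x)).
have := expectE S x; set a := phi x S; set b := phi x (I * S) => e.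
have zp : 0 < cabs (expect S x).
  by rewrite lt_neqAle eq_sym nz e cabsE sqrtr_ge0.
have sq : cabs (expect S x) ^+ 2 = a ^+ 2 + b ^+ 2.
  by rewrite e cabsE sqrrN sqr_sqrtr// addr_ge0 ?sqr_ge0.
have v : phi x (scaleG (a +i* b)%C S) = cabs (expect S x) ^+ 2.
  rewrite csec_scale_complex (lphi x).1 !(lphi x).2 -/a -/b sq; ring.
have : phi x (scaleG (a +i* b)%C S) <= cabs (expect S x) * nrm x S.
  rewrite (le_trans (state_le_norm _ _ _ _ _ _ _ _ (sphi x)))// csec_norm_scale.
  by rewrite e !cabsE sqrrN.
by rewrite v expr2 ler_pM2l.
Qed.

Lemma expect_contC s : is_section s -> contC (expect s).
Proof.
move=> hs x e e0; have e2 : 0 < e / 2 by rewrite divr_gt0.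
pose S : Gamma := CSec hA x0 s hs.
have h1 : \forall y \near x, `|phi x S - phi y S| < e / 2.
  by have /cvgrPdist_lt := cphi S x; apply.
have h2 : \forall y \near x, `|phi x (I * S) - phi y (I * S)| < e / 2.
  by have /cvgrPdist_lt := cphi (I * S) x; apply.
near=> y; rewrite -[s]/(S : X -> tot A) !expectE.
have -> : ((phi y S +i* - phi y (I * S)) - (phi x S +i* - phi x (I * S)))%C =
   ((phi y S - phi x S) +i* (phi x (I * S) - phi y (I * S)))%C.
  by apply/eqP; rewrite eq_complex /=; apply/andP; split; apply/eqP; ring.
rewrite (le_lt_trans (cabs_le _ _ _))// distrC.
have k1 : `|phi x S - phi y S| < e / 2 by near: y.
have k2 : `|phi x (I * S) - phi y (I * S)| < e / 2 by near: y.
by lra.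
Unshelve. all: by end_near. Qed.

Lemma expect_embC f : contC f -> expect (embC A f) = f.
Proof.
move=> cf; apply/funext => x.
have -> : embC A f = csec_mulf R X A hA x0 f cf 1 :> (X -> tot A) by [].
set S := csec_mulf _ _ _ _ _ _ _ _.
have e : expect S x = expect (scaleG (f x) 1) x.
  have hx : S x = scaleG (f x) 1 x by [].
  rewrite !expectE (phi_eq x S (scaleG (f x) 1))//; congr (_ +i* - _)%C.
  by apply: phi_eq; rewrite /=; congr bmul.
by rewrite e expectZ expectE mulr1 phi1 phiI oppr0 mulr1.
Qed.

Lemma nrm_bounded (S : Gamma) : exists2 M : R, 0 < M & forall x, nrm x S <= M.
Proof.
have [M M0 hM] := continuous_compact_bounded R X _ cX (csec_norm_continuous R X A hA x0 S).
by exists M => // x; exact: le_trans (ler_norm _) (hM x).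
Qed.

Lemma expect_cond_exp : cond_exp expect.
Proof.
have bdd (s : X -> tot A) (hs : is_section s) : has_sup (range (fun x => bnorm (s x))).
  have [M _ hM] := nrm_bounded (CSec hA x0 s hs).
  by split; [exists (bnorm (s x0)), x0|exists M => _ [x _ <-]; exact: hM].
have E1 : expect (csec_one R X A hA x0) = fun=> 1.
  by apply/funext => x; rewrite expectE mulr1 phi1 phiI oppr0.
split.
- exact: expect_contC.
- move=> s t hs ht; apply/funext => x.
  pose S : Gamma := CSec hA x0 s hs; pose T : Gamma := CSec hA x0 t ht.
  have -> : (fun x => badd (s x) (t x)) = (S + T : Gamma) :> (X -> tot A) by [].
  rewrite -[s]/(S : X -> tot A) -[t]/(T : X -> tot A) !expectE mulrDr !(lphi x).1.
  by apply/eqP; rewrite eq_complex /=; apply/andP; split; apply/eqP; ring.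
- move=> a s hs; apply/funext => x; pose S : Gamma := CSec hA x0 s hs.
  exact: (expectZ a S x).
- by move=> s hs; apply: expect_embC; exact: expect_contC.
- split=> [f cf|].
    exists (embC A f); split; last exact: expect_embC.
    exact: (csecP (csec_mulf R X A hA x0 f cf 1)).
  apply/le_anti/andP; split.
    apply: ge_sup.
      exists (Cnorm (expect (csec_one R X A hA x0))), (csec_one R X A hA x0) => //.
      split; first exact: csecP.
      apply: ge_sup => [|_ [x _ <-]]; first by exists (bnorm (bone A x0)), x0.
      by rewrite (bnorm1 _ _ _ hA).
    move=> _ [s [hs s1] <-]; apply: ge_sup => [|_ [x _ <-]].
      by exists (cabs (expect s x0)), x0.
    rewrite (le_trans (expect_norm (CSec hA x0 s hs) x))// (le_trans _ s1)//.
    by apply: ub_le_sup; [exact: (bdd s hs).2|exists x].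
  apply: ub_le_sup.
    exists 1 => _ [s [hs s1] <-]; apply: ge_sup => [|_ [x _ <-]].
      by exists (cabs (expect s x0)), x0.
    rewrite (le_trans (expect_norm (CSec hA x0 s hs) x))// (le_trans _ s1)//.
    by apply: ub_le_sup; [exact: (bdd s hs).2|exists x].
  exists (csec_one R X A hA x0).
    split; first exact: csecP.
    apply: ge_sup => [|_ [x _ <-]]; first by exists (bnorm (bone A x0)), x0.
    by rewrite (bnorm1 _ _ _ hA).
  rewrite /Cnorm E1 (_ : range _ = [set 1]) ?sup1//.
  apply/seteqP; split=> [_ [x _ <-]|_ ->]; first by rewrite /= cabs_real normr1.
  by exists x0 => //; rewrite cabs_real normr1.
Qed.

Lemma phi_star_mul_ge x (T : Gamma) : c * nrm x (starG T * T) <= phi x (starG T * T).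
Proof.
have sS : starG (starG T * T) = starG T * T by rewrite (csM _ _ _ (H x)) (csK _ _ _ (H x)).
have sNS : starG (- (starG T * T)) = - (starG T * T) by rewrite (cs_starN _ _ _ _ _ (H x)) sS.
have g0 : nr x (- (starG T * T)) <= 0.
  by rewrite numrange_sa//; exact: (lam_star_mulN_le0 _ _ _ _ _ (H x)).
have gn : nr x (starG T * T) = nrm x (starG T * T).
  by rewrite numrange_sa// (lam_star_mul _ _ _ _ _ (H x)) (csNS _ _ _ (H x)).
have := (hphi x).2 (- (starG T * T)).
rewrite (linfnN _ _ _ _ (lphi x)) /width opprK gn.
move: g0; set a := nr x _; set b := nrm x _; move: (phi x _) => F a0.
have : 0 <= (1 - c) * - a by rewrite mulr_ge0 ?subr_ge0// oppr_ge0.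
by clearbody a b; lra.
Qed.

(** Faithfulness gives [nrm x S <= g x] in every fibre, so [U = g - S] is positive there. Positivity
    in the algebra of sections requires one global square root, obtained by scaling so that
    [1 - U / M] lies in the unit ball of all fibres at once. *)
Lemma expect_faithful K : 1 <= K -> c^-1 <= K -> KE_minus_id_positive expect K.
Proof.
move=> K1 cK s hs [t [ht st]].
pose S : Gamma := CSec hA x0 s hs; pose T : Gamma := CSec hA x0 t ht.
have eS : S = starG T * T by apply: csec_eq => x; exact: st.
have sS : starG S = S by rewrite eS (csM _ _ _ (H x0)) (csK _ _ _ (H x0)).
pose g x := K * phi x S.
have gE x : K%:C%C * expect s x = (g x)%:C%C.
  rewrite -[s]/(S : X -> tot A) expectE phi_I_mul_sa// oppr0.
  by rewrite /g rmorphM.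
have hg x : nrm x S <= g x.
  have := phi_star_mul_ge x T; rewrite -eS /g => h.
  have n0 := cs_norm_ge0 _ _ _ _ _ (H x) S.
  have ci : 0 < c^-1 by rewrite invr_gt0.
  have : c^-1 * (c * nrm x S) <= K * phi x S.
    apply: ler_pM => //; first exact: ltW.
    by rewrite mulr_ge0// ltW.
  by rewrite mulKf// gt_eqF.
have cg : contC (fun x => K%:C%C * expect s x).
  have cKf : contC (fun x => K%:C%C * expect s x).
    rewrite (_ : (fun x => _) = expect (scaleG (K%:C%C) S)).
      exact: expect_contC (csecP _).
    by apply/funext => x; rewrite expectZ.
  exact: cKf.
pose G : Gamma := csec_mulf R X A hA x0 _ cg 1.
have sG : starG G = G.
  apply: csec_eq => x; rewrite /= (bstarZ _ _ _ hA x); last exact: (proj_one _ _ _ hA).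
  by rewrite (bstar1 _ _ _ hA) gE; congr bscale; apply/eqP; rewrite eq_complex /= oppr0 !eqxx.
have [M1 M10 hM1] := nrm_bounded S.
pose M := K * M1; have M0 : 0 < M by rewrite mulr_gt0//; lra.
have gM x : g x <= M.
  rewrite /g /M ler_pM2l; last lra.
  by rewrite (le_trans (state_le_norm _ _ _ _ _ _ _ _ (sphi x))).
pose U : Gamma := G - S; pose h : Gamma := 1 - M^-1 *: U.
have sU : starG U = U by rewrite /U (cs_starB _ _ _ _ _ (H x0)) sG sS.
have sh : starG h = h.
  by rewrite /h (cs_starB _ _ _ _ _ (H x0)) (cs_star1 _ _ _ _ _ (H x0)) (csZ _ _ _ (H x0)) sU.
have h1 x : nrm x h <= 1.
  (* [G] agrees with the constant multiple [g x *: 1] only at [x], so the two sections are compared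
     through the seminorm at [x]. There [h] becomes [(1 - g x / M) + S / M], of norm at most 1. *)
  have -> : nrm x h = nrm x ((1 - M^-1 * g x) *: (1 : Gamma) + M^-1 *: S).
    suff e : nrm x (h - ((1 - M^-1 * g x) *: (1 : Gamma) + M^-1 *: S)) = 0.
      have a1 := cs_norm_dist _ _ _ _ _ (H x) h ((1 - M^-1 * g x) *: (1 : Gamma) + M^-1 *: S).
      have a2 := cs_norm_dist _ _ _ _ _ (H x) ((1 - M^-1 * g x) *: (1 : Gamma) + M^-1 *: S) h.
      move: a2; rewrite -(cs_normN _ _ _ _ _ (H x) (_ - h)) opprB => a2.
      by apply/le_anti/andP; split; lra.
    have -> : h - ((1 - M^-1 * g x) *: (1 : Gamma) + M^-1 *: S) = (- M^-1) *: (G - g x *: 1).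
      have cancel (a u v w : Gamma) : a - (u - v) - (a - w + v) = - u + w.
        apply/eqP; rewrite subr_eq opprB -addrA (addrA w) (addrCA w a) subrr addr0.
        by rewrite (addrCA (- u)) (addrC (- u)).
      rewrite /h /U !scalerBr [(1 - _) *: _]scalerBl scale1r !scalerA mulNr !scaleNr opprK.
      exact: cancel.
    rewrite (csNZ _ _ _ (H x)).
    have -> : nrm x (G - g x *: 1) = nrm x (G - G).
      by rewrite /csec_norm !csec_subE; congr (bnorm (bsub _ _)); rewrite /= gE.
    by rewrite subrr (cs_norm0 _ _ _ _ _ (H x)) mulr0.
  have Mi : 0 < M^-1 by rewrite invr_gt0.
  rewrite (le_trans (csND _ _ _ (H x) _ _))// !(csNZ _ _ _ (H x)) (csN1 _ _ _ (H x)) mulr1.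
  rewrite (gtr0_norm Mi) ger0_norm.
    by have : M^-1 * nrm x S <= M^-1 * g x; [rewrite ler_pM2l|lra].
  by rewrite subr_ge0 mulrC ler_pdivrMr// mul1r.
have [w sw ww] := csec_sqrt R X A hA x0 h sh h1.
exists (Num.sqrt M *: w : Gamma); split; first exact: csecP.
have UE : starG (Num.sqrt M *: w) * (Num.sqrt M *: w) = U.
  rewrite (csZ _ _ _ (H x0)) sw -scalerAl -scalerAr scalerA -[Num.sqrt M * _]expr2.
  rewrite sqr_sqrtr ?(ltW M0)// ww /h opprB addrC subrK scalerA divff ?gt_eqF// scale1r//.
by move=> x; rewrite -[LHS]/(U x) -UE.
Qed.

End Expectation.

Theorem theorem2p12 (R : realType) (X : pseudoMetricType R) (x0 : X)
  (A : bundle_data R X) :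
  hausdorff_space X -> compact [set: X] ->
  unital_Cstar_bundle A -> subhomogeneous A ->
  exists E : (X -> tot A) -> (X -> R[i]),
    cond_exp E /\ (Kconst E < +oo)%E.
Proof.
move=> hX cX hA [N hN].
have [c c0 [phi hphi cphi]] := faithful_selection R X (csec hA x0) 1 (numrange R X A hA x0) x0
  (N + N).+1 (numrange_sublin R X A hA x0) (numrange1 R X A hA x0) (numrangeN1 R X A hA x0)
  (numrange_continuous R X A hA x0) hX cX
  (fun x k Nk => let: ex_intro b hb := hN x in csec_rank_lt R X A hA x0 x N b hb.1 hb.2 k Nk).
(* The estimate [phi_star_mul_ge] works with a constant at most 1, and faithfulness persists when
   the constant shrinks. *)
pose d := Num.min c 1; have d0 : 0 < d by rewrite lt_min c0 ltr01.
have d1 : d <= 1 by rewrite ge_min lexx orbT.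
have hd x : faithful_state R X _ (numrange R X A hA x0) x d (phi x).
  apply: faithful_state_weak (hphi x); first exact: numrange_sublin.
  by rewrite ge_min lexx.
exists (expect R X A hA x0 phi); split; first exact: (expect_cond_exp _ _ _ _ _ cX d).
apply: (@le_lt_trans _ _ (Num.max 1 d^-1)%:E); last exact: ltry.
apply: ereal_inf_lbound; exists (Num.max 1 d^-1) => //; split; first by rewrite le_max lexx.
by apply: (expect_faithful _ _ _ _ _ cX d); rewrite ?le_max ?lexx ?orbT.
Qed.
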